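(* Let $\mathcal{L}\in\mathcal{SP}$ with polynomial Euler product of order $m$ and degree $\mathrm{d}_{\mathcal{L}}$, and let $C>0$, $\ell>0$, $c\ge1$, $T\ge e$ be such that $$\log|\mathcal{L}(s)|\le\frac14\mathrm{d}_{\mathcal{L}}\log(c|t|)+\ell\log\log(c|t|)+\log^{+}C$$ for all $s=\sigma+\mathrm{i}t$ with $|t|\ge T$, $\sigma\ge1/2$ and $\mathcal{L}(s)\ne0$. Let $0<C_1\le1$, $0<C_2\le2C_1$, $C_3\ge1$ and $0<C_4\le C_2/2.0001$. Let $s=\sigma+\mathrm{i}t$ and $$|t|\ge t_0\ge T_1\ge\max\left\{\exp\left(e^{2(1.00006C_2+C_4)}\right),e^{4m/\mathrm{d}_{\mathcal{L}}},C_3,\exp\left(e^2\right)\right\}+1$$ be such that $$t_0-C_3\log\log(ct_0)-\frac32\ge T_2\ge\max\left\{T+1,\exp\left(e^2\right)\right\},\qquad T_1-2C_3\log\log T_1\ge1.$$ Assume that $\mathcal{L}(z)\ne0$ for $\Re\{z\}>1/2$ and $|\Im\{z\}-t|\le C_3\log\log(c(|t|+1))+3$. Then $$\left|\frac{\mathcal{L}'}{\mathcal{L}}(s)\right|\le a_2\left(b_2\log(c|t|)\right)^{2(1-\sigma)}\left(\log\log(c|t|)\right)^2$$ for $$\sigma\in\left[\frac12+\frac{1.00006C_2+C_4}{\log\log(c|t|)},\ 1+\frac{C_4}{\log\log(c|t|)}\right],$$ where $$a_2=\frac{1.0002\,m}{C_2C_4}\exp\left(2C_4\left(1+\frac{\log^{+}b_2}{\log\log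 T_1}\right)+\left(1+\frac{\log^{+}b_2}{\log\log(T_1-1)}\right)\mathcal{R}_2\right),$$ $$b_2=b_1\left(\mathrm{d}_{\mathcal{L}},m,\ell,C,C_1,C_3,T_1-1,T_2\right),\qquad \mathcal{R}_2=\mathcal{R}\left(C_2,C_3,T_1-1\right),$$ with the functions $b_1(\cdot)$ and $\mathcal{R}(\cdot)$ defined in the context.
   Context: The class $\mathcal{SP}$ (Selberg class of functions with a polynomial Euler product) consists of Dirichlet series $\mathcal{L}(s)=\sum_{n\ge1}a(n)n^{-s}$ satisfying: (1) $a(n)\ll_{\varepsilon}n^{\varepsilon}$ for every $\varepsilon>0$. (2) There is an integer $k\ge0$ such that $(s-1)^k\mathcal{L}(s)$ is an entire function of finite order. (3) $\Lambda_{\mathcal{L}}(s)=\omega\overline{\Lambda_{\mathcal{L}}(1-\bar s)}$, where $\Lambda_{\mathcal{L}}(s)=\mathcal{L}(s)Q^s\prod_{j=1}^{f}\Gamma(\lambda_js+\mu_j)$ with $Q,\lambda_j>0$ real, $\mu_j,\omega\in\mathbb{C}$, $\Re\{\mu_j\}\ge0$, $|\omega|=1$. (4) Polynomial Euler product of order $m$: there is $m\in\mathbb{N}$ and for every prime $p$ numbers $\alpha_j(p)\in\mathbb{C}$, $1\le j\le m$, such that $\mathcal{L}(s)=\prod_p\prod_{j=1}^m(1-\alpha_j(p)p^{-s})^{-1}$. The degree is $\mathrm{d}_{\mathcal{L}}=2\sum_{j=1}^f\lambda_j$ (well defined). $\log^{+}u=\max\{0,\log u\}$ for $u>0$; $\gamma$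 is the Euler–Mascheroni constant. Functions used: $$K(\mathrm{d}_{\mathcal{L}},m,\ell,C,C_1,u)=\frac14\mathrm{d}_{\mathcal{L}}+\frac{C_1\mathrm{d}_{\mathcal{L}}}{2\log\log u}+\left(1+\frac{2C_1}{\log\log u}\right)\left(\frac{\ell\log\log u}{\log u}+\frac{m}{\log u}\left(\log\log\log u+\log\frac{1}{C_1}+\frac{\gamma C_1}{\log\log u}\right)+\frac{\log^{+}C}{\log u}\right),$$ $$b_1(\mathrm{d}_{\mathcal{L}},m,\ell,C,C_1,C_3,v,u)=\frac1mK(\mathrm{d}_{\mathcal{L}},m,\ell,C,C_1,u)\left(1+\frac{\log\left(1+\frac{C_3\log\log v+3/2}{v}\right)}{\log v}\right)\left(1+\frac{\log\left(1+\frac{1}{\log v}\log\left(1+\frac{2C_3\log\log v+1}{v}\right)\right)}{\log\log v}\right),$$ $$\mathcal{R}(C_2,C_3,v)=\left(2C_2+\frac{1}{2C_3}\right)\left(1-\frac{1}{4C_3\log\log v}\right)^{-1}.$$ *)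

(* Defs.v *)
From Stdlib Require Export Reals List ZArith Znumtheory.
From Coquelicot Require Export Coquelicot.
Open Scope R_scope.

(* For x > 0 and s complex: x^s = exp (s log x). *)
Definition cexp (z : C) : C := (exp (Re z) * cos (Im z), exp (Re z) * sin (Im z)).
Definition cpow (x : R) (s : C) : C := cexp (s * RtoC (ln x))%C.

Definition Cprod {A : Type} (f : A -> C) (l : list A) : C :=
  fold_right Cmult (RtoC 1) (map f l).

Definition is_Clim_seq (u : nat -> C) (l : C) : Prop :=
  filterlim u eventually (locally (l : C_UniformSpace)).

(* Gauss's limit  Gamma(z) = lim n! n^z / (z (z+1) ... (z+n)),  valid at every
   z other than 0, -1, -2, ...; at those poles the value is meaningless. *)
Definition Gamma_seq (z : C) (n : nat) : C :=
  (RtoC (INR (fact n)) * cpow (INR n) z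
     / Cprod (fun k => z + RtoC (INR k)) (seq 0 (S n)))%C.
Definition Gamma (z : C) : C :=
  (real (Lim_seq (fun n => Re (Gamma_seq z n))),
   real (Lim_seq (fun n => Im (Gamma_seq z n)))).
Definition Gamma_pole (z : C) : Prop := exists n : nat, z = RtoC (- INR n).

Definition euler_gamma : R :=
  real (Lim_seq (fun n => sum_n_m (fun k => / INR k) 1 n - ln (INR n))).

Definition entire (F : C -> C) : Prop :=
  forall z : C, ex_derive (K := C_AbsRing) (V := C_NormedModule) F z.

Definition finite_order (F : C -> C) : Prop :=
  exists A r : R, 0 < r /\
    forall z : C, r <= Cmod z -> Cmod (F z) <= exp (Rpower (Cmod z) A).

Definition is_Dirichlet_series (a : nat -> C) (L : C -> C) : Prop :=
  forall s : C, 1 < Re s ->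
    is_series (K := C_AbsRing) (V := C_NormedModule)
      (fun n => (a (S n) * cpow (INR (S n)) (- s))%C) (L s).

Definition Ramanujan (a : nat -> C) : Prop :=
  forall eps : R, 0 < eps ->
    exists M : R, forall n : nat, (1 <= n)%nat -> Cmod (a n) <= M * Rpower (INR n) eps.

(* A function of the class is represented by a total L : C -> C, meaningful
   away from s = 1, the only possible singularity; L 1 is never constrained. *)
Definition continuation (L : C -> C) : Prop :=
  exists (k : nat) (F : C -> C), entire F /\ finite_order F /\
    forall s : C, s <> RtoC 1 -> F s = ((s - RtoC 1) ^ k * L s)%C.

Definition completed (L : C -> C) (Q : R) (f : nat) (lambda : nat -> R)
    (mu : nat -> C) (s : C) : C :=
  (L s * cpow Q s * Cprod (fun j => Gamma (RtoC (lambda j) * s + mu j)) (seq 1 f))%C.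

(* The functional equation is an identity of meromorphic functions: it is
   required off the possible singularities of the factors on either side. *)
Definition functional_equation (L : C -> C) (Q : R) (f : nat)
    (lambda : nat -> R) (mu : nat -> C) (omega : C) : Prop :=
  0 < Q /\
  (forall j, (1 <= j <= f)%nat -> 0 < lambda j /\ 0 <= Re (mu j)) /\
  Cmod omega = 1 /\
  forall s : C,
    s <> RtoC 0 -> s <> RtoC 1 ->
    (forall j, (1 <= j <= f)%nat ->
       ~ Gamma_pole (RtoC (lambda j) * s + mu j)%C /\
       ~ Gamma_pole (RtoC (lambda j) * (RtoC 1 - Cconj s) + mu j)%C) ->
    completed L Q f lambda mu s
      = (omega * Cconj (completed L Q f lambda mu (RtoC 1 - Cconj s)))%C.

Definition has_degree (L : C -> C) (d : R) : Prop :=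
  exists (Q : R) (f : nat) (lambda : nat -> R) (mu : nat -> C) (omega : C),
    functional_equation L Q f lambda mu omega /\ d = 2 * sum_n_m lambda 1 f.

Definition primes_upto (N : nat) : list nat :=
  filter (fun p => if prime_dec (Z.of_nat p) then true else false) (seq 0 (S N)).

(* The factors must be finite: inversion in C is total, so 1 - alpha_j(p) p^(-s) = 0
   has to be excluded explicitly. *)
Definition polynomial_Euler_product (L : C -> C) (m : nat) : Prop :=
  (1 <= m)%nat /\
  exists alpha : nat -> nat -> C,
    forall s : C, 1 < Re s ->
      let factor j p := (RtoC 1 - alpha j p * cpow (INR p) (- s))%C in
      (forall p j, prime (Z.of_nat p) -> (1 <= j <= m)%nat ->
         factor j p <> RtoC 0) /\
      is_Clim_seq
        (fun N => Cprod (fun p => Cprod (fun j => Cinv (factor j p)) (seq 1 m))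
                        (primes_upto N))
        (L s).

Definition SP (L : C -> C) : Prop :=
  (exists a : nat -> C, is_Dirichlet_series a L /\ Ramanujan a) /\
  continuation L /\
  (exists d : R, has_degree L d) /\
  (exists m : nat, polynomial_Euler_product L m).

Definition log_plus (u : R) : R := Rmax 0 (ln u).

Definition K_fun (d : R) (m : nat) (ell C0 C1 u : R) : R :=
  / 4 * d + C1 * d / (2 * ln (ln u))
  + (1 + 2 * C1 / ln (ln u))
    * (ell * ln (ln u) / ln u
       + INR m / ln u * (ln (ln (ln u)) + ln (1 / C1) + euler_gamma * C1 / ln (ln u))
       + log_plus C0 / ln u).

Definition b1_fun (d : R) (m : nat) (ell C0 C1 C3 v u : R) : R :=
  1 / INR m * K_fun d m ell C0 C1 u
  * (1 + ln (1 + (C3 * ln (ln v) + 3 / 2) / v) / ln v)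
  * (1 + ln (1 + 1 / ln v * ln (1 + (2 * C3 * ln (ln v) + 1) / v)) / ln (ln v)).

Definition R_fun (C2 C3 v : R) : R :=
  (2 * C2 + 1 / (2 * C3)) * / (1 - 1 / (4 * C3 * ln (ln v))).

(* Main.v *)
(* Write lam = log log (c|t|).  On the zero-free box around s, f = log L is holomorphic; to the right of
   1 the Euler product, whose parameters satisfy |alpha_j(p)| <= 1, gives |f(z)| <= m log zeta(Re z).
   Borel-Caratheodory on discs centred on Re = 1 + C1/log log U, with zeta(1+x) <= e^(gamma x)/x at the
   centre, bounds f by (m lam/C2) b2 log(c|t|) on Re >= 1/2 + C2/lam, while |f| <= m lam/C2 on
   Re >= 1 + C2/lam.  The three circles theorem, for circles of radii C3 lam - 1/2 and C3 lam,
   interpolates between these bounds, and Cauchy's estimate on the disc of radius C4/lam around s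
   bounds f' = L'/L.  Both estimates rest on a maximum principle for 2 pi i-periodic strips, proved by the
   second derivative test; Goursat's theorem is needed only for the existence of log L and for the
   differentiability of F', where F is the entire function (s-1)^k L(s). *)
Require Import Defs.
From Stdlib Require Zpow_facts.
From Stdlib Require Import Lra Lia Psatz ClassicalEpsilon Classical FunctionalExtensionality.
Open Scope R_scope.

(** * Complex derivatives *)

(** [SP] gives the Euler product only as an ordered limit, with no bound on its parameters.
    Nonvanishing of the factors for Re s > 1 yields just |alpha_j(p)| <= p, which is enough for
    absolute convergence at the points s = k + 3. Letting k grow there shows that multiplying the
    Dirichlet series by the reciprocal Euler factors of the primes up to N kills all coefficients at
    2..N. Along the powers of one prime this is a power series identity, and Ramanujan's bound then
    forces |alpha_j(p)| <= 1. The functions of the statement come from separate estimates. [K_fun]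
    is the Borel-Caratheodory bound divided by log U, where U = c (|t| + C3 lam + 3/2) bounds every
    argument reached; the factor of [b1_fun] that follows it converts log U into log(c|t|). In units
    of 1/lam, [R_fun] is the loss in the exponent of the three circles theorem, and 2 C4 the
    variation of 2 (1 - Re z) over Cauchy's disc. Both are paid for by (b2 log(c|t|))^(1/lam) <=
    exp(1 + log+ b2 / lam), which holds because log log(c|t|) = lam. *)

Definition Cderiv (f : C -> C) (z l : C) : Prop :=
  forall eps, 0 < eps -> exists delta, 0 < delta /\ forall w,
    Cmod (w - z) < delta -> Cmod (f w - f z - l * (w - z)) <= eps * Cmod (w - z).

Definition Ccont (f : C -> C) (z : C) : Prop :=
  forall eps, 0 < eps -> exists delta, 0 < delta /\ forall w,
    Cmod (w - z) < delta -> Cmod (f w - f z) < eps.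

Lemma C_ext (z w : C) : Re z = Re w -> Im z = Im w -> z = w.
Proof. destruct z, w; simpl; intros -> ->; reflexivity. Qed.

Lemma Cmod_minus_sym (z w : C) : Cmod (z - w) = Cmod (w - z).
Proof. rewrite <- Cmod_opp. f_equal. ring. Qed.

Lemma Cmod_triangle_minus (z w : C) : Cmod (z - w) <= Cmod z + Cmod w.
Proof. unfold Cminus. eapply Rle_trans; [apply Cmod_triangle|]. rewrite Cmod_opp. lra. Qed.

Lemma Cmod_triangle_inv (z w : C) : Cmod z - Cmod w <= Cmod (z - w).
Proof.
  pose proof (Cmod_triangle (z - w) w) as H.
  replace (z - w + w)%C with z in H by ring. lra.
Qed.

Lemma im_le_Cmod (z : C) : Rabs (Im z) <= Cmod z.
Proof. eapply Rle_trans; [|apply Rmax_Cmod]. apply Rmax_r. Qed.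

Lemma Cmod_le_Re_Im (z : C) : Cmod z <= Rabs (Re z) + Rabs (Im z).
Proof.
  replace z with (RtoC (Re z) + Ci * RtoC (Im z))%C at 1
    by (apply C_ext; simpl; ring).
  eapply Rle_trans; [apply Cmod_triangle|].
  rewrite Cmod_mult, Cmod_Ci, !Cmod_R. lra.
Qed.

(** The bridge to Coquelicot: [entire] is read through it, and [C_derive] in the conclusion is
    reached through it. In between, the epsilon form keeps filters out of the computations. *)
Lemma Cderiv_is_derive (f : C -> C) (z l : C) :
  Cderiv f z l <-> is_derive (K := C_AbsRing) (V := C_NormedModule) f z l.
Proof.
  split.
  - intros H. split.
    + apply (is_linear_scal_l (K := C_AbsRing) (V := C_NormedModule) l).
    + intros x Hx eps.
      apply (is_filter_lim_locally_unique (K := C_AbsRing) (V := AbsRing_NormedModule C_AbsRing)) in Hx.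
      subst x. destruct (H eps (cond_pos eps)) as [d [Hd H1]].
      exists (mkposreal d Hd). intros w Hw.
      specialize (H1 w Hw).
      change (Cmod (f w - f z - (w - z) * l) <= eps * Cmod (w - z)).
      rewrite (Cmult_comm (w - z) l). exact H1.
  - intros [_ H] eps Heps.
    destruct (H z (fun P HP => HP) (mkposreal eps Heps)) as [d Hd].
    exists d. split; [apply cond_pos|]. intros w Hw.
    specialize (Hd w Hw).
    change (Cmod (f w - f z - (w - z) * l) <= eps * Cmod (w - z)) in Hd.
    rewrite (Cmult_comm (w - z) l) in Hd. exact Hd.
Qed.

Lemma Cderiv_const (c z : C) : Cderiv (fun _ => c) z 0.
Proof.
  intros eps He. exists 1. split; [lra|]. intros w _.
  replace (c - c - 0 * (w - z))%C with (RtoC 0) by ring.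
  rewrite Cmod_0. apply Rmult_le_pos; [lra|apply Cmod_ge_0].
Qed.

Lemma Cderiv_id (z : C) : Cderiv (fun w => w) z 1.
Proof.
  intros eps He. exists 1. split; [lra|]. intros w _.
  replace (w - z - 1 * (w - z))%C with (RtoC 0) by ring.
  rewrite Cmod_0. apply Rmult_le_pos; [lra|apply Cmod_ge_0].
Qed.

Lemma Cderiv_eq (f : C -> C) (z l l' : C) : Cderiv f z l -> l = l' -> Cderiv f z l'.
Proof. intros H <-. exact H. Qed.

Lemma Cderiv_local (f g : C -> C) (z l : C) (r : R) :
  0 < r -> (forall w, Cmod (w - z) < r -> f w = g w) -> Cderiv f z l -> Cderiv g z l.
Proof.
  intros Hr E H eps He. destruct (H eps He) as [d [Hd H1]].
  exists (Rmin d r). split; [apply Rmin_case; assumption|]. intros w Hw.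
  rewrite <- !E; [apply H1| |].
  - eapply Rlt_le_trans; [exact Hw|apply Rmin_l].
  - replace (z - z)%C with (RtoC 0) by ring. rewrite Cmod_0. exact Hr.
  - eapply Rlt_le_trans; [exact Hw|apply Rmin_r].
Qed.

Lemma Cderiv_ext (f g : C -> C) (z l : C) :
  (forall w, f w = g w) -> Cderiv f z l -> Cderiv g z l.
Proof. intros E. apply (Cderiv_local f g z l 1); [lra|auto]. Qed.

Lemma Cderiv_lipschitz (f : C -> C) (z l : C) :
  Cderiv f z l -> exists delta, 0 < delta /\ forall w,
    Cmod (w - z) < delta -> Cmod (f w - f z) <= (Cmod l + 1) * Cmod (w - z).
Proof.
  intros H. destruct (H 1 Rlt_0_1) as [d [Hd H1]]. exists d. split; [exact Hd|].
  intros w Hw. specialize (H1 w Hw).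
  replace (f w - f z)%C with (f w - f z - l * (w - z) + l * (w - z))%C by ring.
  eapply Rle_trans; [apply Cmod_triangle|]. rewrite Cmod_mult. lra.
Qed.

Lemma Cderiv_Ccont (f : C -> C) (z l : C) : Cderiv f z l -> Ccont f z.
Proof.
  intros H eps He. destruct (Cderiv_lipschitz f z l H) as [d [Hd H1]].
  pose proof (Cmod_ge_0 l) as Hl.
  exists (Rmin d (eps / (Cmod l + 1))). split.
  - apply Rmin_case; [exact Hd|]. apply Rdiv_lt_0_compat; lra.
  - intros w Hw. eapply Rle_lt_trans.
    + apply H1. eapply Rlt_le_trans; [exact Hw|apply Rmin_l].
    + assert (Hw' : Cmod (w - z) < eps / (Cmod l + 1))
        by (eapply Rlt_le_trans; [exact Hw|apply Rmin_r]).
      apply (Rmult_lt_compat_l (Cmod l + 1)) in Hw'; [|lra].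
      replace ((Cmod l + 1) * (eps / (Cmod l + 1))) with eps in Hw' by (field; lra).
      exact Hw'.
Qed.

Lemma Cderiv_plus (f g : C -> C) (z l m : C) :
  Cderiv f z l -> Cderiv g z m -> Cderiv (fun w => f w + g w)%C z (l + m).
Proof.
  intros Hf Hg eps He.
  destruct (Hf (eps / 2)) as [d1 [Hd1 H1]]; [lra|].
  destruct (Hg (eps / 2)) as [d2 [Hd2 H2]]; [lra|].
  exists (Rmin d1 d2). split; [apply Rmin_case; assumption|]. intros w Hw.
  specialize (H1 w (Rlt_le_trans _ _ _ Hw (Rmin_l _ _))).
  specialize (H2 w (Rlt_le_trans _ _ _ Hw (Rmin_r _ _))).
  replace (f w + g w - (f z + g z) - (l + m) * (w - z))%C
    with ((f w - f z - l * (w - z)) + (g w - g z - m * (w - z)))%C by ring.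
  eapply Rle_trans; [apply Cmod_triangle|]. lra.
Qed.

Lemma Cderiv_comp (f g : C -> C) (z l m : C) :
  Cderiv f (g z) l -> Cderiv g z m -> Cderiv (fun w => f (g w)) z (l * m).
Proof.
  intros Hf Hg eps He.
  destruct (Cderiv_lipschitz g z m Hg) as [d0 [Hd0 H0]].
  pose proof (Cmod_ge_0 l) as Hl. pose proof (Cmod_ge_0 m) as Hm.
  set (e1 := eps / (2 * (Cmod m + 1))).
  set (e2 := eps / (2 * (Cmod l + 1))).
  assert (He1 : 0 < e1) by (apply Rdiv_lt_0_compat; lra).
  assert (He2 : 0 < e2) by (apply Rdiv_lt_0_compat; lra).
  assert (E1 : e1 * (Cmod m + 1) = eps / 2) by (unfold e1; field; lra).
  assert (E2 : e2 * (Cmod l + 1) = eps / 2) by (unfold e2; field; lra).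
  destruct (Hf e1 He1) as [d1 [Hd1 H1]].
  destruct (Hg e2 He2) as [d2 [Hd2 H2]].
  set (d3 := d1 / (Cmod m + 1)).
  assert (Hd3 : 0 < d3) by (apply Rdiv_lt_0_compat; lra).
  assert (E3 : (Cmod m + 1) * d3 = d1) by (unfold d3; field; lra).
  exists (Rmin d0 (Rmin d2 d3)).
  split; [repeat apply Rmin_case; assumption|].
  intros w Hw.
  assert (W0 : Cmod (w - z) < d0) by (eapply Rlt_le_trans; [exact Hw|apply Rmin_l]).
  assert (W1 : Cmod (w - z) < Rmin d2 d3) by (eapply Rlt_le_trans; [exact Hw|apply Rmin_r]).
  assert (W2 : Cmod (w - z) < d2) by (eapply Rlt_le_trans; [exact W1|apply Rmin_l]).
  assert (W3 : Cmod (w - z) < d3) by (eapply Rlt_le_trans; [exact W1|apply Rmin_r]).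
  specialize (H0 w W0). specialize (H2 w W2).
  assert (Hgw : Cmod (g w - g z) < d1).
  { eapply Rle_lt_trans; [exact H0|]. rewrite <- E3. apply Rmult_lt_compat_l; lra. }
  specialize (H1 (g w) Hgw).
  replace (f (g w) - f (g z) - l * m * (w - z))%C
    with ((f (g w) - f (g z) - l * (g w - g z)) + l * (g w - g z - m * (w - z)))%C by ring.
  eapply Rle_trans; [apply Cmod_triangle|]. rewrite Cmod_mult.
  pose proof (Cmod_ge_0 (w - z)) as Hwz.
  assert (Cmod (f (g w) - f (g z) - l * (g w - g z)) <= eps / 2 * Cmod (w - z)).
  { eapply Rle_trans; [exact H1|]. rewrite <- E1, Rmult_assoc.
    apply Rmult_le_compat_l; lra. }
  assert (Cmod l * Cmod (g w - g z - m * (w - z)) <= eps / 2 * Cmod (w - z)).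
  { rewrite <- E2. apply Rle_trans with (Cmod l * (e2 * Cmod (w - z))).
    - apply Rmult_le_compat_l; lra.
    - assert (0 <= e2 * Cmod (w - z)) by (apply Rmult_le_pos; lra). nra. }
  lra.
Qed.

Lemma Cderiv_scal (c : C) (f : C -> C) (z l : C) :
  Cderiv f z l -> Cderiv (fun w => c * f w)%C z (c * l).
Proof.
  intros Hf. apply (Cderiv_comp (fun u => c * u)%C f z c l); [|exact Hf].
  intros eps He. exists 1. split; [lra|]. intros w _.
  replace (c * w - c * f z - c * (w - f z))%C with (RtoC 0) by ring.
  rewrite Cmod_0. apply Rmult_le_pos; [lra|apply Cmod_ge_0].
Qed.

Lemma Cderiv_minus (f g : C -> C) (z l m : C) :
  Cderiv f z l -> Cderiv g z m -> Cderiv (fun w => f w - g w)%C z (l - m).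
Proof.
  intros Hf Hg.
  apply (Cderiv_ext (fun w => f w + (- (1)) * g w)%C); [intros; ring|].
  apply (Cderiv_eq _ z (l + (- (1)) * m)); [|ring].
  apply Cderiv_plus; [exact Hf|]. apply Cderiv_scal. exact Hg.
Qed.

Lemma Cderiv_sqr (z : C) : Cderiv (fun w => w * w)%C z (2 * z).
Proof.
  intros eps He. exists eps. split; [lra|]. intros w Hw.
  replace (w * w - z * z - 2 * z * (w - z))%C with ((w - z) * (w - z))%C by ring.
  rewrite Cmod_mult. apply Rmult_le_compat_r; [apply Cmod_ge_0|lra].
Qed.

(* Polarization: fg = ((f+g)^2 - (f-g)^2)/4 reduces products to the chain rule. *)
Lemma Cderiv_mult (f g : C -> C) (z l m : C) :
  Cderiv f z l -> Cderiv g z m -> Cderiv (fun w => f w * g w)%C z (l * g z + f z * m).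
Proof.
  intros Hf Hg.
  apply (Cderiv_ext (fun w => / 4 * ((f w + g w) * (f w + g w) - (f w - g w) * (f w - g w)))%C).
  { intros w. field. }
  apply (Cderiv_eq _ z (/ 4 * (2 * (f z + g z) * (l + m) - 2 * (f z - g z) * (l - m))));
    [|field].
  apply Cderiv_scal. apply Cderiv_minus.
  - apply (Cderiv_comp (fun u => u * u)%C (fun w => f w + g w)%C); [apply Cderiv_sqr|].
    apply Cderiv_plus; assumption.
  - apply (Cderiv_comp (fun u => u * u)%C (fun w => f w - g w)%C); [apply Cderiv_sqr|].
    apply Cderiv_minus; assumption.
Qed.

Lemma Cderiv_Cinv (z : C) : z <> 0 -> Cderiv Cinv z (- / (z * z)).
Proof.
  intros Hz eps He. pose proof (proj1 (Cmod_gt_0 z) Hz) as Hm.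
  set (M := Cmod z) in *.
  (* The error is (w - z)^2 / (w z^2), and the radius M / 2 keeps |w| > M / 2. *)
  exists (Rmin (M / 2) (eps * (M * M * M / 2))).
  assert (0 < M * M * M / 2) by (assert (0 < M * M) by nra; nra).
  split; [apply Rmin_case; [lra|apply Rmult_lt_0_compat; lra]|].
  intros w Hw.
  assert (W1 : Cmod (w - z) < M / 2) by (eapply Rlt_le_trans; [exact Hw|apply Rmin_l]).
  assert (W2 : Cmod (w - z) < eps * (M * M * M / 2))
    by (eapply Rlt_le_trans; [exact Hw|apply Rmin_r]).
  assert (Hmw : M / 2 < Cmod w).
  { pose proof (Cmod_triangle_inv z w). rewrite Cmod_minus_sym in W1. fold M in H0. lra. }
  assert (Hw0 : w <> 0) by (apply Cmod_gt_0; lra).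
  replace (/ w - / z - - / (z * z) * (w - z))%C
    with ((w - z) * ((w - z) * / (w * z * z)))%C by (field; auto).
  rewrite !Cmod_mult, Cmod_inv, !Cmod_mult by (repeat apply Cmult_neq_0; assumption).
  fold M. rewrite (Rmult_comm eps). apply Rmult_le_compat_l; [apply Cmod_ge_0|].
  apply Rmult_le_reg_r with (Cmod w * M * M); [repeat apply Rmult_lt_0_compat; lra|].
  rewrite Rmult_assoc, Rinv_l by (repeat apply Rmult_integral_contrapositive_currified; lra).
  rewrite Rmult_1_r. apply Rlt_le. eapply Rlt_le_trans; [exact W2|].
  apply Rmult_le_compat_l; [lra|]. 
  replace (M * M * M / 2) with (M / 2 * M * M) by field.
  repeat apply Rmult_le_compat_r; lra.
Qed.

Lemma Cderiv_inv (f : C -> C) (z l : C) :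
  f z <> 0 -> Cderiv f z l -> Cderiv (fun w => / f w)%C z (- / (f z * f z) * l).
Proof. intros H0 Hf. apply (Cderiv_comp Cinv f); [apply Cderiv_Cinv; exact H0|exact Hf]. Qed.

Lemma Cderiv_div (f g : C -> C) (z l m : C) :
  g z <> 0 -> Cderiv f z l -> Cderiv g z m ->
  Cderiv (fun w => f w / g w)%C z ((l * g z - f z * m) / (g z * g z)).
Proof.
  intros H0 Hf Hg. eapply Cderiv_eq.
  - apply (Cderiv_mult f (fun w => / g w)%C); [exact Hf|]. apply Cderiv_inv; eassumption.
  - field. exact H0.
Qed.

(** * Algebra of the complex exponential *)

Lemma cexp_0 : cexp 0 = 1.
Proof. unfold cexp; simpl. rewrite exp_0, cos_0, sin_0. apply C_ext; simpl; ring. Qed.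

Lemma cexp_plus (z w : C) : cexp (z + w) = (cexp z * cexp w)%C.
Proof.
  destruct z as [x y], w as [x' y']. unfold cexp; simpl.
  rewrite exp_plus, cos_plus, sin_plus. apply C_ext; simpl; ring.
Qed.

Lemma Cmod_cexp (z : C) : Cmod (cexp z) = exp (Re z).
Proof.
  unfold cexp, Cmod; simpl.
  replace (_ + _) with ((exp (Re z)) * (exp (Re z)) * (Rsqr (sin (Im z)) + Rsqr (cos (Im z))))
    by (unfold Rsqr; ring).
  rewrite sin2_cos2, Rmult_1_r. apply sqrt_square. left. apply exp_pos.
Qed.

Lemma cexp_neq_0 (z : C) : cexp z <> 0.
Proof. apply Cmod_gt_0. rewrite Cmod_cexp. apply exp_pos. Qed.

Lemma cexp_opp (z : C) : cexp (- z) = (/ cexp z)%C.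
Proof.
  assert (H : (cexp (- z) * cexp z)%C = 1)
    by (rewrite <- cexp_plus, <- cexp_0; f_equal; ring).
  rewrite <- (Cmult_1_l (/ cexp z)%C), <- H. field. apply cexp_neq_0.
Qed.

(** * Restriction to real lines and the mean value inequality *)

Lemma is_derive_R_eps (g : R -> R) (t d : R) :
  (forall eps, 0 < eps -> exists delta, 0 < delta /\ forall u,
     Rabs (u - t) < delta -> Rabs (g u - g t - (u - t) * d) <= eps * Rabs (u - t)) ->
  is_derive g t d.
Proof.
  intros H. split.
  - apply (is_linear_scal_l (K := R_AbsRing) (V := R_NormedModule) d).
  - intros x Hx eps.
    apply (is_filter_lim_locally_unique (K := R_AbsRing) (V := AbsRing_NormedModule R_AbsRing)) in Hx.
    subst x. destruct (H eps (cond_pos eps)) as [e [He H1]].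
    exists (mkposreal e He). intros w Hw. exact (H1 w Hw).
Qed.

Lemma norm_C_R (z : C) : @norm R_AbsRing C_R_NormedModule z = Cmod z.
Proof.
  unfold norm; simpl. unfold prod_norm, Cmod, norm; simpl. unfold abs; simpl.
  f_equal. rewrite !Rmult_1_r, <- !Rabs_mult, !Rabs_right by nra. reflexivity.
Qed.

Lemma is_derive_C_R_eps (g : R -> C) (t : R) (d : C) :
  (forall eps, 0 < eps -> exists delta, 0 < delta /\ forall u,
     Rabs (u - t) < delta -> Cmod (g u - g t - RtoC (u - t) * d) <= eps * Rabs (u - t)) ->
  is_derive (K := R_AbsRing) (V := C_R_NormedModule) g t d.
Proof.
  intros H. split.
  - apply (is_linear_scal_l (K := R_AbsRing) (V := C_R_NormedModule) d).
  - intros x Hx eps.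
    apply (is_filter_lim_locally_unique (K := R_AbsRing) (V := AbsRing_NormedModule R_AbsRing)) in Hx.
    subst x. destruct (H eps (cond_pos eps)) as [e [He H1]].
    exists (mkposreal e He). intros w Hw. specialize (H1 w Hw).
    eapply Rle_trans; [|exact H1]. right.
    eapply eq_trans; [apply (norm_C_R _)|]. f_equal.
    apply C_ext; unfold minus, plus, opp, scal; simpl; unfold plus, opp, scal; simpl; unfold mult; simpl;
      unfold Re, Im; match goal with |- ?x = ?y => change (@eq R x y) end; ring.
Qed.

(** Chain rule along a line, kept in epsilon form so that the versions for f, Re f and Im f are all
    read off from it. *)
Lemma Cderiv_line_eps (f : C -> C) (p b : C) (t : R) (l : C) :
  Cderiv f (p + RtoC t * b) l ->
  forall eps, 0 < eps -> exists delta, 0 < delta /\ forall u,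
     Rabs (u - t) < delta ->
     Cmod (f (p + RtoC u * b) - f (p + RtoC t * b) - RtoC (u - t) * (l * b))%C <= eps * Rabs (u - t).
Proof.
  intros H eps He. pose proof (Cmod_ge_0 b) as Hb.
  destruct (H (eps / (Cmod b + 1))) as [d [Hd H1]]; [apply Rdiv_lt_0_compat; lra|].
  exists (d / (Cmod b + 1)). split; [apply Rdiv_lt_0_compat; lra|].
  intros u Hu. set (w := (p + RtoC u * b)%C). set (z := (p + RtoC t * b)%C).
  assert (E : (w - z)%C = (RtoC (u - t) * b)%C) by (unfold w, z; rewrite RtoC_minus; ring).
  assert (Em : Cmod (w - z) = Rabs (u - t) * Cmod b) by (rewrite E, Cmod_mult, Cmod_R; reflexivity).
  assert (Hle : Cmod (w - z) <= Rabs (u - t) * (Cmod b + 1)) 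
    by (rewrite Em; apply Rmult_le_compat_l; [apply Rabs_pos|lra]).
  assert (Hu' : Rabs (u - t) * (Cmod b + 1) < d).
  { apply (Rmult_lt_compat_r (Cmod b + 1)) in Hu; [|lra].
    replace (d / (Cmod b + 1) * (Cmod b + 1)) with d in Hu by (field; lra). exact Hu. }
  specialize (H1 w (Rle_lt_trans _ _ _ Hle Hu')).
  replace (RtoC (u - t) * (l * b))%C with (l * (w - z))%C by (rewrite E; ring).
  eapply Rle_trans; [exact H1|].
  apply Rle_trans with (eps / (Cmod b + 1) * (Rabs (u - t) * (Cmod b + 1))).
  - apply Rmult_le_compat_l; [|exact Hle]. left. apply Rdiv_lt_0_compat; lra.
  - right. field. lra.
Qed.

Lemma Cderiv_line (f : C -> C) (p b : C) (t : R) (l : C) :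
  Cderiv f (p + RtoC t * b) l ->
  is_derive (K := R_AbsRing) (V := C_R_NormedModule) (fun t => f (p + RtoC t * b)%C) t (l * b)%C.
Proof. intros H. apply is_derive_C_R_eps. apply Cderiv_line_eps. exact H. Qed.

Lemma Cderiv_line_Re (f : C -> C) (p b : C) (t : R) (l : C) :
  Cderiv f (p + RtoC t * b) l ->
  is_derive (fun t => Re (f (p + RtoC t * b)%C)) t (Re (l * b)%C).
Proof.
  intros H. apply is_derive_R_eps. intros eps He.
  destruct (Cderiv_line_eps f p b t l H eps He) as [d [Hd H1]].
  exists d. split; [exact Hd|]. intros u Hu. eapply Rle_trans; [|apply (H1 u Hu)].
  eapply Rle_trans; [|apply re_le_Cmod]. right. f_equal. unfold Re, Im. simpl. ring.
Qed.

Lemma Cderiv_line_Im (f : C -> C) (p b : C) (t : R) (l : C) :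
  Cderiv f (p + RtoC t * b) l ->
  is_derive (fun t => Im (f (p + RtoC t * b)%C)) t (Im (l * b)%C).
Proof.
  intros H. apply is_derive_R_eps. intros eps He.
  destruct (Cderiv_line_eps f p b t l H eps He) as [d [Hd H1]].
  exists d. split; [exact Hd|]. intros u Hu. eapply Rle_trans; [|apply (H1 u Hu)].
  eapply Rle_trans; [|apply im_le_Cmod]. right. f_equal. unfold Re, Im. simpl. ring.
Qed.

Lemma is_derive_continuity_pt (f : R -> R) (x l : R) : is_derive f x l -> continuity_pt f x.
Proof.
  intros H. apply continuity_pt_filterlim. apply (ex_derive_continuous f x). exists l. exact H.
Qed.

(** There is no mean value equality for complex values. The real theorem is applied to Re (conj D *
    f) along the segment, with D = f q - f p, whose increment is |D|^2. *)
Lemma Cderiv_increment_bound (f f' : C -> C) (p q : C) (M : R) :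
  (forall t, 0 <= t <= 1 -> Cderiv f (p + RtoC t * (q - p)) (f' (p + RtoC t * (q - p)))%C) ->
  (forall t, 0 <= t <= 1 -> Cmod (f' (p + RtoC t * (q - p))%C) <= M) ->
  Cmod (f q - f p) <= M * Cmod (q - p).
Proof.
  intros Hd HM. set (D := (f q - f p)%C).
  set (phi := fun t : R => Re (Cconj D * f (p + RtoC t * (q - p)))%C).
  set (dphi := fun t : R => Re (Cconj D * f' (p + RtoC t * (q - p)) * (q - p))%C).
  assert (Hphi : forall t, 0 <= t <= 1 -> is_derive phi t (dphi t)).
  { intros t Ht. apply (Cderiv_line_Re (fun w => Cconj D * f w)%C). apply Cderiv_scal. auto. }
  destruct (MVT_gen phi 0 1 dphi) as [c [Hc E]].
  - intros x Hx. rewrite Rmin_left, Rmax_right in Hx by lra. apply Hphi; lra.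
  - intros x Hx. rewrite Rmin_left, Rmax_right in Hx by lra.
    eapply is_derive_continuity_pt. apply Hphi; lra.
  - rewrite Rmin_left, Rmax_right in Hc by lra.
    assert (E1 : phi 1 - phi 0 = Cmod D * Cmod D).
    { unfold phi. replace (p + 1 * (q - p))%C with q by ring.
      replace (p + 0 * (q - p))%C with p by ring.
      pose proof (Cmod2_alt D) as H. simpl in H. rewrite !Rmult_1_r in H.
      rewrite H. unfold D. simpl. ring. }
    assert (E2 : dphi c <= Cmod D * (M * Cmod (q - p))).
    { eapply Rle_trans; [apply Rle_abs|]. eapply Rle_trans; [apply re_le_Cmod|].
      rewrite !Cmod_mult, Cmod_conj, Rmult_assoc.
      apply Rmult_le_compat_l; [apply Cmod_ge_0|].
      apply Rmult_le_compat_r; [apply Cmod_ge_0|]. apply HM. exact Hc. }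
    rewrite E1 in E.
    destruct (Req_dec (Cmod D) 0) as [H0|H0].
    + rewrite H0. apply Rmult_le_pos; [|apply Cmod_ge_0].
      eapply Rle_trans; [apply Cmod_ge_0|apply (HM 0); lra].
    + pose proof (Cmod_ge_0 D). apply Rmult_le_reg_l with (Cmod D); [lra|]. lra.
Qed.

Lemma exp_sub_1_abs_le (a : R) : Rabs a <= 1 -> Rabs (exp a - 1) <= 3 * Rabs a.
Proof.
  intros Ha.
  destruct (MVT_gen exp 0 a exp) as [c [Hc E]].
  - intros x _. apply is_derive_exp.
  - intros x _. eapply is_derive_continuity_pt. apply is_derive_exp.
  - rewrite exp_0 in E. rewrite E, Rminus_0_r, Rabs_mult.
    apply Rmult_le_compat_r; [apply Rabs_pos|].
    rewrite Rabs_right by (left; apply exp_pos).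
    apply Rle_trans with (exp 1); [|apply exp_le_3].
    assert (Hc1 : c <= 1).
    { apply Rabs_le_between in Ha. destruct Hc as [_ Hc]. eapply Rle_trans; [exact Hc|].
      apply Rmax_lub; lra. }
    destruct Hc1 as [Hc1| ->]; [left; apply exp_increasing; exact Hc1|right; reflexivity].
Qed.

Lemma Rabs_between_0 (c a : R) : Rmin 0 a <= c <= Rmax 0 a -> Rabs c <= Rabs a.
Proof.
  intros H. destruct (Rle_dec 0 a) as [Ha|Ha].
  - rewrite Rmin_left, Rmax_right in H by lra. rewrite !Rabs_right; lra.
  - rewrite Rmin_right, Rmax_left in H by lra. rewrite !Rabs_left1; lra.
Qed.

Lemma exp_sub_1_sub_abs_le (a : R) : Rabs a <= 1 -> Rabs (exp a - 1 - a) <= 3 * (a * a).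
Proof.
  intros Ha.
  destruct (MVT_gen (fun x => exp x - x) 0 a (fun x => exp x - 1)) as [c [Hc E]].
  - intros x _. auto_derive; [trivial|ring].
  - intros x _. eapply (is_derive_continuity_pt _ _ (exp x - 1)). auto_derive; [trivial|ring].
  - rewrite exp_0 in E. replace (exp a - 1 - a) with ((exp c - 1) * a) by lra.
    apply Rabs_between_0 in Hc.
    rewrite Rabs_mult. rewrite <- (Rabs_right (a * a)) by nra. rewrite Rabs_mult, <- Rmult_assoc.
    apply Rmult_le_compat_r; [apply Rabs_pos|].
    eapply Rle_trans; [apply exp_sub_1_abs_le; lra|]. lra.
Qed.

Lemma sin_abs_le (b : R) : Rabs (sin b) <= Rabs b.
Proof.
  destruct (MVT_gen sin 0 b cos) as [c [Hc E]].
  - intros x _. apply is_derive_sin.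
  - intros x _. eapply is_derive_continuity_pt. apply is_derive_sin.
  - rewrite sin_0 in E. replace (sin b) with (cos c * b) by lra. rewrite Rabs_mult.
    pose proof (COS_bound c). assert (Rabs (cos c) <= 1) by (apply Rabs_le; lra).
    pose proof (Rabs_pos b). nra.
Qed.

Lemma cos_sub_1_abs_le (b : R) : Rabs (cos b - 1) <= b * b.
Proof.
  destruct (MVT_gen cos 0 b (fun x => - sin x)) as [c [Hc E]].
  - intros x _. apply is_derive_cos.
  - intros x _. eapply is_derive_continuity_pt. apply is_derive_cos.
  - rewrite cos_0 in E. rewrite E, Rminus_0_r, Rabs_mult, Rabs_Ropp.
    rewrite <- (Rabs_right (b * b)) by nra. rewrite (Rabs_mult b b).
    apply Rmult_le_compat_r; [apply Rabs_pos|].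
    eapply Rle_trans; [apply sin_abs_le|]. apply Rabs_between_0. exact Hc.
Qed.

Lemma sin_sub_abs_le (b : R) : Rabs (sin b - b) <= b * b * Rabs b.
Proof.
  destruct (MVT_gen (fun x => sin x - x) 0 b (fun x => cos x - 1)) as [c [Hc E]].
  - intros x _. auto_derive; [trivial|ring].
  - intros x _. eapply (is_derive_continuity_pt _ _ (cos x - 1)). auto_derive; [trivial|ring].
  - rewrite sin_0 in E. replace (sin b - b) with ((cos c - 1) * b) by lra.
    rewrite Rabs_mult. apply Rmult_le_compat_r; [apply Rabs_pos|].
    eapply Rle_trans; [apply cos_sub_1_abs_le|]. apply Rabs_between_0 in Hc.
    rewrite <- (Rabs_right (c * c)), <- (Rabs_right (b * b)) by nra. rewrite !Rabs_mult.
    pose proof (Rabs_pos c). nra.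
Qed.

(** The real and imaginary parts split into four terms, each at most 3 |h|^2; hence the 12. *)
Lemma cexp_sub_1_sub_le (h : C) : Cmod h <= 1 -> Cmod (cexp h - 1 - h) <= 12 * (Cmod h * Cmod h).
Proof.
  intros Hh. destruct h as [a b].
  pose proof (re_le_Cmod (a, b)) as Ha. pose proof (im_le_Cmod (a, b)) as Hb. simpl in Ha, Hb.
  set (h := Cmod (a, b)) in *.
  pose proof (exp_sub_1_abs_le a ltac:(lra)) as E1.
  pose proof (exp_sub_1_sub_abs_le a ltac:(lra)) as E2.
  pose proof (sin_abs_le b) as E3. pose proof (cos_sub_1_abs_le b) as E4.
  pose proof (sin_sub_abs_le b) as E5.
  pose proof (Rabs_pos a) as Pa. pose proof (Rabs_pos b) as Pb.
  assert (Xe : Rabs (exp a) <= 3).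
  { rewrite Rabs_right by (left; apply exp_pos). apply Rle_trans with (exp 1); [|apply exp_le_3].
    pose proof (Rle_abs a). destruct (Rle_lt_or_eq_dec a 1 ltac:(lra)) as [H1| ->]; 
    [left; apply exp_increasing; exact H1|lra]. }
  assert (Xa : a * a <= h * h).
  { rewrite <- (Rabs_right (a * a)), Rabs_mult by nra. nra. }
  assert (Xb : b * b <= h * h).
  { rewrite <- (Rabs_right (b * b)), Rabs_mult by nra. nra. }
  assert (Hh0 : 0 <= h) by lra.
  eapply Rle_trans; [apply Cmod_le_Re_Im|]. simpl.
  replace (exp a * cos b + - (1) + - a) with (exp a * (cos b - 1) + (exp a - 1 - a)) by ring.
  replace (exp a * sin b + - 0 + - b) with (exp a * (sin b - b) + b * (exp a - 1)) by ring.
  assert (Y1 : Rabs (exp a * (cos b - 1)) <= 3 * (h * h)).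
  { rewrite Rabs_mult. apply Rmult_le_compat; try apply Rabs_pos; lra. }
  assert (Y2 : Rabs (exp a * (sin b - b)) <= 3 * (h * h)).
  { rewrite Rabs_mult. apply Rmult_le_compat; try apply Rabs_pos; [lra|].
    eapply Rle_trans; [exact E5|]. nra. }
  assert (Y3 : Rabs (b * (exp a - 1)) <= h * (2 * h + h)).
  { rewrite Rabs_mult. apply Rmult_le_compat; try apply Rabs_pos; lra. }
  pose proof (Rabs_triang (exp a * (cos b - 1)) (exp a - 1 - a)).
  pose proof (Rabs_triang (exp a * (sin b - b)) (b * (exp a - 1))).
  nra.
Qed.

Lemma Cderiv_cexp (z : C) : Cderiv cexp z (cexp z).
Proof.
  intros eps He. pose proof (proj1 (Cmod_gt_0 _) (cexp_neq_0 z)) as HE.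
  set (E := Cmod (cexp z)) in *.
  exists (Rmin 1 (eps / (E * 12))). split.
  { apply Rmin_case; [lra|]. apply Rdiv_lt_0_compat; lra. }
  intros w Hw. set (h := (w - z)%C) in *.
  assert (H1 : Cmod h < 1) by (eapply Rlt_le_trans; [exact Hw|apply Rmin_l]).
  assert (H2 : Cmod h < eps / (E * 12)) by (eapply Rlt_le_trans; [exact Hw|apply Rmin_r]).
  replace (cexp w) with (cexp z * cexp h)%C
    by (rewrite <- cexp_plus; f_equal; unfold h; ring).
  replace (cexp z * cexp h - cexp z - cexp z * h)%C with (cexp z * (cexp h - 1 - h))%C by ring.
  rewrite Cmod_mult. fold E.
  apply Rle_trans with (E * (12 * (Cmod h * Cmod h))).
  { apply Rmult_le_compat_l; [lra|]. apply cexp_sub_1_sub_le. lra. }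
  pose proof (Cmod_ge_0 h).
  apply (Rmult_lt_compat_l (E * 12)) in H2; [|lra].
  replace (E * 12 * (eps / (E * 12))) with eps in H2 by (field; lra).
  nra.
Qed.

Lemma Cderiv_cexp_comp (f : C -> C) (z l : C) :
  Cderiv f z l -> Cderiv (fun w => cexp (f w)) z (cexp (f z) * l).
Proof. intros H. apply (Cderiv_comp cexp f); [apply Cderiv_cexp|exact H]. Qed.

(** * Goursat's theorem and primitives *)

Notation CInt := (RInt (V := C_R_CompleteNormedModule)).
Notation ex_CInt := (ex_RInt (V := C_R_CompleteNormedModule)).

Lemma continuous_C_R_eps (g : R -> C) (t : R) :
  (forall eps, 0 < eps -> exists delta, 0 < delta /\ forall u,
     Rabs (u - t) < delta -> Cmod (g u - g t) < eps) ->
  continuous (U := C_R_CompleteNormedModule) g t.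
Proof.
  intros H. apply filterlim_locally. intros eps.
  destruct (H eps (cond_pos eps)) as [d [Hd H1]].
  exists (mkposreal d Hd). intros u Hu. specialize (H1 u Hu).
  split.
  - eapply Rle_lt_trans; [|exact H1]. eapply Rle_trans; [|apply re_le_Cmod]. apply Rle_refl.
  - eapply Rle_lt_trans; [|exact H1]. eapply Rle_trans; [|apply im_le_Cmod]. apply Rle_refl.
Qed.

Lemma Cmod_horizontal (u x c : R) : Cmod ((u, c) - (x, c)) = Rabs (u - x).
Proof. rewrite <- Cmod_R. f_equal. apply C_ext; simpl; ring. Qed.

Lemma Cmod_vertical (a u y : R) : Cmod ((a, u) - (a, y)) = Rabs (u - y).
Proof.
  replace ((a, u) - (a, y))%C with (Ci * RtoC (u - y))%C by (apply C_ext; simpl; ring).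
  rewrite Cmod_mult, Cmod_Ci, Cmod_R. ring.
Qed.

Lemma Ccont_horizontal (f : C -> C) (x c : R) :
  Ccont f (x, c) -> continuous (U := C_R_CompleteNormedModule) (fun u : R => f (u, c)) x.
Proof.
  intros H. apply continuous_C_R_eps. intros eps He. destruct (H eps He) as [d [Hd H1]].
  exists d. split; [exact Hd|]. intros u Hu. apply H1. rewrite Cmod_horizontal. exact Hu.
Qed.

Lemma Ccont_vertical (f : C -> C) (a y : R) :
  Ccont f (a, y) -> continuous (U := C_R_CompleteNormedModule) (fun u : R => Ci * f (a, u))%C y.
Proof.
  intros H. apply continuous_C_R_eps. intros eps He. destruct (H eps He) as [d [Hd H1]].
  exists d. split; [exact Hd|]. intros u Hu.
  replace (Ci * f (a, u) - Ci * f (a, y))%C with (Ci * (f (a, u) - f (a, y)))%C by ring.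
  rewrite Cmod_mult, Cmod_Ci, Rmult_1_l. apply H1. rewrite Cmod_vertical. exact Hu.
Qed.

Ltac cring := match goal with |- ?x = ?y => change (@eq C x y) end; ring.

(** Insensitive to the order of the end points: a primitive is differentiated with w on any side of
    z. *)
Definition box (a b c d : R) (z : C) : Prop :=
  Rmin a b <= Re z <= Rmax a b /\ Rmin c d <= Im z <= Rmax c d.

Lemma ex_CInt_horizontal (f : C -> C) (a b c : R) :
  (forall x, Rmin a b <= x <= Rmax a b -> Ccont f (x, c)) -> ex_CInt (fun u => f (u, c)) a b.
Proof. intros H. apply ex_RInt_continuous. intros z Hz. apply Ccont_horizontal. auto. Qed.

Lemma ex_CInt_vertical (f : C -> C) (a c d : R) :
  (forall y, Rmin c d <= y <= Rmax c d -> Ccont f (a, y)) -> ex_CInt (fun u => Ci * f (a, u))%C c d.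
Proof. intros H. apply ex_RInt_continuous. intros z Hz. apply Ccont_vertical. auto. Qed.

Lemma CInt_Chasles (g : R -> C) (a b c : R) :
  ex_CInt g a b -> ex_CInt g b c -> (CInt g a b + CInt g b c)%C = CInt g a c.
Proof. intros H1 H2. apply (RInt_Chasles (V := C_R_CompleteNormedModule) g a b c H1 H2). Qed.

Lemma CInt_minus (f g : R -> C) (a b : R) :
  ex_CInt f a b -> ex_CInt g a b ->
  CInt (fun x => f x - g x)%C a b = (CInt f a b - CInt g a b)%C.
Proof. intros H1 H2. apply (RInt_minus (V := C_R_CompleteNormedModule) f g a b H1 H2). Qed.

(** Integration takes place in C as a real vector space, where k is not a scalar; hence the detour
    through components. *)
Lemma CInt_scal (g : R -> C) (a b : R) (k : C) :
  ex_CInt g a b -> CInt (fun y => g y * k)%C a b = (CInt g a b * k)%C.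
Proof.
  intros Hg. destruct k as [k1 k2].
  pose proof (RInt_correct (V := C_R_CompleteNormedModule) g a b Hg) as Ig.
  apply (is_RInt_unique (V := C_R_CompleteNormedModule)).
  set (J := CInt g a b) in *.
  pose proof (is_RInt_fct_extend_fst _ _ _ _ Ig) as I1.
  pose proof (is_RInt_fct_extend_snd _ _ _ _ Ig) as I2.
  apply (is_RInt_ext (V := C_R_NormedModule)
    (fun y => (k1 * fst (g y) - k2 * snd (g y), k1 * snd (g y) + k2 * fst (g y)) : C)).
  { intros y _. apply C_ext; simpl; ring. }
  replace (J * (k1, k2))%C with ((k1 * fst J - k2 * snd J, k1 * snd J + k2 * fst J) : C)
    by (apply C_ext; simpl; ring).
  apply (is_RInt_fct_extend_pair (U := R_NormedModule) (V := R_NormedModule)).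
  - apply (is_RInt_minus (V := R_NormedModule));
      apply (is_RInt_scal (V := R_NormedModule)); assumption.
  - apply (is_RInt_plus (V := R_NormedModule));
      apply (is_RInt_scal (V := R_NormedModule)); assumption.
Qed.

Lemma Cmod_CInt_le (f : R -> C) (a b M : R) :
  ex_CInt f a b -> (forall x, Rmin a b <= x <= Rmax a b -> Cmod (f x) <= M) ->
  Cmod (CInt f a b) <= Rabs (b - a) * M.
Proof.
  intros H1 H2. rewrite <- norm_C_R.
  apply (norm_RInt_le_const_abs (V := C_R_NormedModule) f).
  - intros x Hx. rewrite norm_C_R. auto.
  - apply (RInt_correct (V := C_R_CompleteNormedModule)). exact H1.
Qed.

Lemma CInt_derive_horizontal (F f : C -> C) (a b c : R) :
  (forall x, Rmin a b <= x <= Rmax a b -> Cderiv F (x, c) (f (x, c)) /\ Ccont f (x, c)) ->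
  CInt (fun x => f (x, c)) a b = (F (b, c) - F (a, c))%C.
Proof.
  intros H. apply is_RInt_unique.
  assert (E : forall x, (x, c) = ((0, c) + RtoC x * 1)%C) by (intros; apply C_ext; simpl; ring).
  apply (is_RInt_derive (V := C_R_CompleteNormedModule) (fun x => F (x, c)) (fun x => f (x, c))).
  - intros x Hx. 
    apply (is_derive_ext (V := C_R_NormedModule) (fun x => F ((0, c) + RtoC x * 1)%C)).
    { intros t. rewrite (E t). reflexivity. }
    replace (f (x, c)) with (f (x, c) * 1)%C by ring.
    apply (Cderiv_line F). rewrite <- E. apply H. exact Hx.
  - intros x Hx. apply Ccont_horizontal. apply H. exact Hx.
Qed.

Lemma CInt_derive_vertical (F f : C -> C) (a c d : R) :
  (forall y, Rmin c d <= y <= Rmax c d -> Cderiv F (a, y) (f (a, y)) /\ Ccont f (a, y)) ->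
  CInt (fun y => Ci * f (a, y))%C c d = (F (a, d) - F (a, c))%C.
Proof.
  intros H. apply is_RInt_unique.
  assert (E : forall y, (a, y) = ((a, 0) + RtoC y * Ci)%C) by (intros; apply C_ext; simpl; ring).
  apply (is_RInt_derive (V := C_R_CompleteNormedModule) (fun x => F (a, x)) (fun x => Ci * f (a, x))%C).
  - intros x Hx. 
    apply (is_derive_ext (V := C_R_NormedModule) (fun x => F ((a, 0) + RtoC x * Ci)%C)).
    { intros t. rewrite (E t). reflexivity. }
    rewrite Cmult_comm.
    apply (Cderiv_line F). rewrite <- E. apply H. exact Hx.
  - intros x Hx. apply Ccont_vertical. apply H. exact Hx.
Qed.

(** The contour integral of f(z) dz, counterclockwise when a <= b and c <= d; [Ci] is dz/dy on the
    vertical sides. *)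
Definition boundary_int (f : C -> C) (a b c d : R) : C :=
  (CInt (fun x => f (x, c)) a b - CInt (fun x => f (x, d)) a b
   + CInt (fun y => Ci * f (b, y)) c d - CInt (fun y => Ci * f (a, y)) c d)%C.

Definition cont_box (f : C -> C) (a b c d : R) : Prop := forall z, box a b c d z -> Ccont f z.

Lemma box_intro (a b c d x y : R) :
  Rmin a b <= x <= Rmax a b -> Rmin c d <= y <= Rmax c d -> box a b c d (x, y).
Proof. intros; split; assumption. Qed.

Lemma Rmin_max_l (a b : R) : Rmin a b <= a <= Rmax a b.
Proof. split; [apply Rmin_l|apply Rmax_l]. Qed.

Lemma Rmin_max_r (a b : R) : Rmin a b <= b <= Rmax a b.
Proof. split; [apply Rmin_r|apply Rmax_r]. Qed.

Lemma boundary_int_minus (f g : C -> C) (a b c d : R) :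
  cont_box f a b c d -> cont_box g a b c d ->
  boundary_int (fun z => f z - g z)%C a b c d
    = (boundary_int f a b c d - boundary_int g a b c d)%C.
Proof.
  intros Hf Hg. unfold boundary_int.
  assert (E : forall x, (fun y : R => Ci * (f (x, y) - g (x, y)))%C
     = (fun y : R => Ci * f (x, y) - Ci * g (x, y))%C)
    by (intros x; apply functional_extensionality; intros y; ring).
  rewrite !E.
  rewrite (CInt_minus (fun x => f (x, c)) (fun x => g (x, c))),
    (CInt_minus (fun x => f (x, d)) (fun x => g (x, d))),
    (CInt_minus (fun y => Ci * f (b, y))%C (fun y => Ci * g (b, y))%C),
    (CInt_minus (fun y => Ci * f (a, y))%C (fun y => Ci * g (a, y))%C);
  [ring| apply ex_CInt_vertical.. | apply ex_CInt_horizontal | apply ex_CInt_horizontal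
  | apply ex_CInt_horizontal | apply ex_CInt_horizontal ];
  intros; (apply Hf || apply Hg);
    apply box_intro; trivial; apply Rmin_max_l || apply Rmin_max_r.
Qed.

Lemma Cmod_boundary_int_le (f : C -> C) (a b c d M : R) :
  cont_box f a b c d -> (forall z, box a b c d z -> Cmod (f z) <= M) ->
  Cmod (boundary_int f a b c d) <= 2 * (Rabs (b - a) + Rabs (d - c)) * M.
Proof.
  intros Hf HM. unfold boundary_int.
  assert (H1 : Cmod (CInt (fun x => f (x, c)) a b) <= Rabs (b - a) * M).
  { apply Cmod_CInt_le.
    - apply ex_CInt_horizontal. intros; apply Hf; apply box_intro; trivial; apply Rmin_max_l.
    - intros; apply HM; apply box_intro; trivial; apply Rmin_max_l. }
  assert (H2 : Cmod (CInt (fun x => f (x, d)) a b) <= Rabs (b - a) * M).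
  { apply Cmod_CInt_le.
    - apply ex_CInt_horizontal. intros; apply Hf; apply box_intro; trivial; apply Rmin_max_r.
    - intros; apply HM; apply box_intro; trivial; apply Rmin_max_r. }
  assert (H3 : Cmod (CInt (fun y => Ci * f (b, y))%C c d) <= Rabs (d - c) * M).
  { apply Cmod_CInt_le.
    - apply ex_CInt_vertical. intros; apply Hf; apply box_intro; trivial; apply Rmin_max_r.
    - intros. rewrite Cmod_mult, Cmod_Ci, Rmult_1_l.
      apply HM; apply box_intro; trivial; apply Rmin_max_r. }
  assert (H4 : Cmod (CInt (fun y => Ci * f (a, y))%C c d) <= Rabs (d - c) * M).
  { apply Cmod_CInt_le.
    - apply ex_CInt_vertical. intros; apply Hf; apply box_intro; trivial; apply Rmin_max_l.
    - intros. rewrite Cmod_mult, Cmod_Ci, Rmult_1_l.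
      apply HM; apply box_intro; trivial; apply Rmin_max_l. }
  eapply Rle_trans; [apply Cmod_triangle_minus|].
  eapply Rle_trans; [apply Rplus_le_compat_r, Cmod_triangle|].
  eapply Rle_trans; [apply Rplus_le_compat_r, Rplus_le_compat_r, Cmod_triangle_minus|].
  lra.
Qed.

Lemma boundary_int_derive (F f : C -> C) (a b c d : R) :
  (forall z, box a b c d z -> Cderiv F z (f z)) -> cont_box f a b c d ->
  boundary_int f a b c d = 0.
Proof.
  intros HF Hf. unfold boundary_int.
  rewrite !(CInt_derive_horizontal F), !(CInt_derive_vertical F); [ring|..];
    intros; split; (apply HF || apply Hf);
    apply box_intro; trivial; apply Rmin_max_l || apply Rmin_max_r.
Qed.

Lemma box_le (a b c d : R) (z : C) :
  a <= b -> c <= d -> box a b c d z <-> (a <= Re z <= b /\ c <= Im z <= d).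
Proof. intros H1 H2. unfold box. rewrite !Rmin_left, !Rmax_right by assumption. tauto. Qed.

Lemma boundary_int_split (f : C -> C) (a e b c g d : R) :
  a <= e <= b -> c <= g <= d -> cont_box f a b c d ->
  boundary_int f a b c d
  = (boundary_int f a e c g + boundary_int f e b c g
     + boundary_int f a e g d + boundary_int f e b g d)%C.
Proof.
  intros He Hg Hf. unfold boundary_int.
  assert (Hh : forall y u v, c <= y <= d -> a <= u <= b -> a <= v <= b ->
            ex_CInt (fun x => f (x, y)) u v).
  { intros y u v Hy Hu Hv. apply ex_CInt_horizontal. intros x Hx. apply Hf.
    apply box_le; [lra..|]. simpl. split; [|exact Hy]. split.
    - eapply Rle_trans; [|apply Hx]. apply Rmin_glb; lra.
    - eapply Rle_trans; [apply Hx|]. apply Rmax_lub; lra. }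
  assert (Hv : forall x u v, a <= x <= b -> c <= u <= d -> c <= v <= d ->
            ex_CInt (fun y => Ci * f (x, y))%C u v).
  { intros x u v Hx Hu Hv. apply ex_CInt_vertical. intros y Hy. apply Hf.
    apply box_le; [lra..|]. simpl. split; [exact Hx|]. split.
    - eapply Rle_trans; [|apply Hy]. apply Rmin_glb; lra.
    - eapply Rle_trans; [apply Hy|]. apply Rmax_lub; lra. }
  rewrite <- (CInt_Chasles (fun x => f (x, c)) a e b) by (apply Hh; lra).
  rewrite <- (CInt_Chasles (fun x => f (x, d)) a e b) by (apply Hh; lra).
  rewrite <- (CInt_Chasles (fun y => Ci * f (a, y))%C c g d) by (apply Hv; lra).
  rewrite <- (CInt_Chasles (fun y => Ci * f (b, y))%C c g d) by (apply Hv; lra).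
  ring.
Qed.

Lemma cont_box_Cderiv (F f : C -> C) (a b c d : R) :
  (forall z, box a b c d z -> Cderiv F z (f z)) -> cont_box F a b c d.
Proof. intros H z Hz. eapply Cderiv_Ccont. apply H. exact Hz. Qed.

Lemma boundary_int_affine (p q z0 : C) (a b c d : R) :
  boundary_int (fun z => p + q * (z - z0))%C a b c d = 0.
Proof.
  apply (boundary_int_derive (fun z => p * z + q / 2 * ((z - z0) * (z - z0)))%C).
  - intros z _. eapply Cderiv_eq.
    + apply Cderiv_plus; [apply Cderiv_scal, Cderiv_id|]. apply Cderiv_scal.
      apply (Cderiv_comp (fun u => u * u)%C (fun w => w - z0)%C); [apply Cderiv_sqr|].
      apply Cderiv_minus; [apply Cderiv_id|apply Cderiv_const].
    + field.
  - apply (cont_box_Cderiv _ (fun _ => 0 + q * (1 - 0))%C). intros z _.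
    apply Cderiv_plus; [apply Cderiv_const|]. apply Cderiv_scal.
    apply Cderiv_minus; [apply Cderiv_id|apply Cderiv_const].
Qed.

Lemma boundary_int_quarter (f : C -> C) (a b c d : R) :
  a <= b -> c <= d -> cont_box f a b c d ->
  exists a' b' c' d', (a <= a' /\ a' <= b' /\ b' <= b) /\ (c <= c' /\ c' <= d' /\ d' <= d) /\
    b' - a' = (b - a) / 2 /\ d' - c' = (d - c) / 2 /\
    Cmod (boundary_int f a b c d) <= 4 * Cmod (boundary_int f a' b' c' d').
Proof.
  intros Hab Hcd Hf. set (e := (a + b) / 2). set (g := (c + d) / 2).
  pose proof (boundary_int_split f a e b c g d ltac:(unfold e; lra) ltac:(unfold g; lra) Hf) as E.
  set (B := boundary_int f a b c d) in *.
  destruct (Rle_dec (Cmod B) (4 * Cmod (boundary_int f a e c g))) as [H1|H1].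
  { exists a, e, c, g. unfold e, g in *. repeat split; trivial; lra. }
  destruct (Rle_dec (Cmod B) (4 * Cmod (boundary_int f e b c g))) as [H2|H2].
  { exists e, b, c, g. unfold e, g in *. repeat split; trivial; lra. }
  destruct (Rle_dec (Cmod B) (4 * Cmod (boundary_int f a e g d))) as [H3|H3].
  { exists a, e, g, d. unfold e, g in *. repeat split; trivial; lra. }
  destruct (Rle_dec (Cmod B) (4 * Cmod (boundary_int f e b g d))) as [H4|H4].
  { exists e, b, g, d. unfold e, g in *. repeat split; trivial; lra. }
  exfalso.
  pose proof (Cmod_triangle (boundary_int f a e c g + boundary_int f e b c g
     + boundary_int f a e g d) (boundary_int f e b g d)) as T1.
  pose proof (Cmod_triangle (boundary_int f a e c g + boundary_int f e b c g)
    (boundary_int f a e g d)) as T2.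
  pose proof (Cmod_triangle (boundary_int f a e c g) (boundary_int f e b c g)) as T3.
  rewrite E in H1, H2, H3, H4. lra.
Qed.

Lemma nested_intervals_point (a b : nat -> R) :
  (forall n, a n <= a (S n)) -> (forall n, b (S n) <= b n) -> (forall n, a n <= b n) ->
  exists x, forall n, a n <= x <= b n.
Proof.
  intros Ha Hb Hab.
  assert (Ma : forall n k, a n <= a (n + k)%nat).
  { intros n k. induction k as [|k IH]; [rewrite Nat.add_0_r; lra|].
    rewrite Nat.add_succ_r. eapply Rle_trans; [exact IH|apply Ha]. }
  assert (Mb : forall n k, b (n + k)%nat <= b n).
  { intros n k. induction k as [|k IH]; [rewrite Nat.add_0_r; lra|].
    rewrite Nat.add_succ_r. eapply Rle_trans; [apply Hb|exact IH]. }
  assert (Mab : forall n k, a n <= b k).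
  { intros n k. eapply Rle_trans; [apply (Ma n k)|]. eapply Rle_trans; [apply Hab|].
    rewrite Nat.add_comm. apply Mb. }
  destruct (completeness (fun x => exists n, x = a n)) as [x [H1 H2]].
  - exists (b 0%nat). intros y [n ->]. apply Mab.
  - exists (a 0%nat). exists 0%nat. reflexivity.
  - exists x. intros n. split; [apply H1; exists n; reflexivity|].
    apply H2. intros y [k ->]. apply Mab.
Qed.

Lemma pow_half_lt (S d : R) : 0 <= S -> 0 < d -> exists n, S / 2 ^ n < d.
Proof.
  intros HS Hd.
  assert (Hh : Rabs (/ 2) < 1) by (rewrite Rabs_right; lra).
  destruct (pow_lt_1_zero (/ 2) Hh (d / (S + 1)))
    as [n Hn]; [apply Rdiv_lt_0_compat; lra|].
  specialize (Hn n (Nat.le_refl n)).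
  rewrite pow_inv, Rabs_right in Hn by (left; apply Rinv_0_lt_compat, pow_lt; lra).
  exists n. unfold Rdiv.
  assert (0 < / 2 ^ n) by (apply Rinv_0_lt_compat, pow_lt; lra).
  apply (Rmult_lt_compat_l (S + 1)) in Hn; [|lra].
  replace ((S + 1) * (d / (S + 1))) with d in Hn by (field; lra). nra.
Qed.

(** Bisection: the size halves while the integral loses at most a factor 4. Near the limit point f
    differs from an affine map, whose integral vanishes, by o(size), so the integral is
    o(size^2). *)
Lemma goursat_le (f : C -> C) (a b c d : R) :
  a <= b -> c <= d ->
  (forall z, box a b c d z -> exists l, Cderiv f z l) ->
  boundary_int f a b c d = 0.
Proof.
  intros Hab Hcd Hf.
  set (ok := fun r : R * R * R * R => let '(a', b', c', d') := r in
    a' <= b' /\ c' <= d' /\ a <= a' /\ b' <= b /\ c <= c' /\ d' <= d).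
  set (step := fun r r' : R * R * R * R =>
    let '(a, b, c, d) := r in let '(a', b', c', d') := r' in
    (a <= a' /\ a' <= b' /\ b' <= b) /\ (c <= c' /\ c' <= d' /\ d' <= d) /\
    b' - a' = (b - a) / 2 /\ d' - c' = (d - c) / 2 /\
    Cmod (boundary_int f a b c d) <= 4 * Cmod (boundary_int f a' b' c' d')).
  assert (Hcont : forall a' b' c' d', ok (a', b', c', d') -> cont_box f a' b' c' d').
  { intros a' b' c' d' (H1 & H2 & H3 & H4 & H5 & H6) z Hz.
    apply (proj1 (box_le _ _ _ _ z H1 H2)) in Hz.
    destruct (Hf z) as [l Hl]; [apply box_le; lra|]. eapply Cderiv_Ccont; exact Hl. }
  (* [step] is only required of admissible rectangles, so that the chosen successor is a total
     function. *)
  assert (Hex : forall r, exists r', ok r -> step r r').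
  { intros [[[a' b'] c'] d']. destruct (classic (ok (a', b', c', d'))) as [H|H].
    - destruct (boundary_int_quarter f a' b' c' d') as (a1 & b1 & c1 & d1 & H1).
      + apply H. + apply H. + apply Hcont, H.
      + exists (a1, b1, c1, d1). intros _. exact H1.
    - exists (a', b', c', d'). tauto. }
  set (next := fun r => proj1_sig (constructive_indefinite_description _ (Hex r))).
  assert (Hnext : forall r, ok r -> step r (next r)).
  { intros r. exact (proj2_sig (constructive_indefinite_description _ (Hex r))). }
  set (r := fun n => Nat.iter n next (a, b, c, d)).
  assert (Hok : forall n, ok (r n)).
  { intros n. induction n as [|n IH]; [simpl; lra|].
    specialize (Hnext _ IH). change (r (S n)) with (next (r n)).
    destruct (r n) as [[[a1 b1] c1] d1]. destruct (next (a1, b1, c1, d1)) as [[[a2 b2] c2] d2].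
    unfold step, ok in *. lra. }
  assert (Hstep : forall n, step (r n) (r (S n))) by (intros n; apply Hnext, Hok).
  set (pa := fun r : R * R * R * R => fst (fst (fst r))).
  set (pb := fun r : R * R * R * R => snd (fst (fst r))).
  set (pc := fun r : R * R * R * R => snd (fst r)).
  set (pd := fun r : R * R * R * R => snd r).
  destruct (nested_intervals_point (fun n => pa (r n)) (fun n => pb (r n))) as [x Hx].
  { intros n. specialize (Hstep n).
    destruct (r n) as [[[a1 b1] c1] d1], (r (S n)) as [[[a2 b2] c2] d2]. unfold pa, pb; simpl. apply Hstep. }
  { intros n. specialize (Hstep n).
    destruct (r n) as [[[a1 b1] c1] d1], (r (S n)) as [[[a2 b2] c2] d2]. unfold pa, pb; simpl. apply Hstep. }
  { intros n. specialize (Hok n).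
    destruct (r n) as [[[a1 b1] c1] d1]. unfold pa, pb; simpl. apply Hok. }
  destruct (nested_intervals_point (fun n => pc (r n)) (fun n => pd (r n))) as [y Hy].
  { intros n. specialize (Hstep n).
    destruct (r n) as [[[a1 b1] c1] d1], (r (S n)) as [[[a2 b2] c2] d2]. unfold pc, pd; simpl. apply Hstep. }
  { intros n. specialize (Hstep n).
    destruct (r n) as [[[a1 b1] c1] d1], (r (S n)) as [[[a2 b2] c2] d2]. unfold pc, pd; simpl. apply Hstep. }
  { intros n. specialize (Hok n).
    destruct (r n) as [[[a1 b1] c1] d1]. unfold pc, pd; simpl. apply Hok. }
  set (z := (x, y) : C).
  destruct (Hf z) as [l Hl].
  { apply box_le; [assumption..|]. split; [apply (Hx 0%nat)|apply (Hy 0%nat)]. }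
  set (S0 := (b - a) + (d - c)).
  set (I := fun r : R * R * R * R => boundary_int f (pa r) (pb r) (pc r) (pd r)).
  assert (Hsize : forall n, (pb (r n) - pa (r n)) + (pd (r n) - pc (r n)) = S0 / 2 ^ n).
  { induction n as [|n IH]; [unfold pa, pb, pc, pd, S0; simpl; field|].
    specialize (Hstep n). 
    destruct (r n) as [[[a1 b1] c1] d1], (r (S n)) as [[[a2 b2] c2] d2].
    unfold pa, pb, pc, pd in *; simpl in *.
    destruct Hstep as (_ & _ & E1 & E2 & _). rewrite E1, E2.
    replace (S0 / (2 * 2 ^ n)) with (S0 / 2 ^ n / 2) by (field; apply pow_nonzero; lra).
    rewrite <- IH. field. }
  assert (HI : forall n, Cmod (I (r 0%nat)) <= 4 ^ n * Cmod (I (r n))).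
  { induction n as [|n IH]; [rewrite pow_O, Rmult_1_l; apply Rle_refl|].
    specialize (Hstep n). eapply Rle_trans; [exact IH|].
    assert (Hs : Cmod (I (r n)) <= 4 * Cmod (I (r (S n)))).
    { destruct (r n) as [[[a1 b1] c1] d1], (r (S n)) as [[[a2 b2] c2] d2]. apply Hstep. }
    rewrite <- tech_pow_Rmult, (Rmult_comm 4), Rmult_assoc.
    apply Rmult_le_compat_l; [apply pow_le; lra|exact Hs]. }
  assert (HS0 : 0 <= S0) by (unfold S0; lra).
  (* At level n the perimeter is 2 S0 / 2^n and the integrand at most eps S0 / 2^n; the product is
     compensated exactly by 4^n. *)
  assert (Hbound : forall eps, 0 < eps -> Cmod (I (r 0%nat)) <= eps * (2 * S0 * S0)).
  { intros eps He. destruct (Hl eps He) as [dl [Hdl H1]].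
    destruct (pow_half_lt S0 dl HS0 Hdl) as [n Hn].
    eapply Rle_trans; [apply (HI n)|].
    specialize (Hok n). specialize (Hsize n). specialize (Hx n). specialize (Hy n).
    unfold I. destruct (r n) as [[[a1 b1] c1] d1] eqn:Er.
    unfold pa, pb, pc, pd in *; simpl in *.
    assert (E : boundary_int f a1 b1 c1 d1
      = boundary_int (fun w => f w - (f z + l * (w - z)))%C a1 b1 c1 d1).
    { rewrite boundary_int_minus, boundary_int_affine; [ring|apply Hcont; exact Hok|].
      apply (cont_box_Cderiv _ (fun _ => 0 + l * (1 - 0))%C). intros w _.
      apply Cderiv_plus; [apply Cderiv_const|]. apply Cderiv_scal.
      apply Cderiv_minus; [apply Cderiv_id|apply Cderiv_const]. }
    rewrite E.
    assert (Hb : Cmod (boundary_int (fun w => f w - (f z + l * (w - z)))%C a1 b1 c1 d1)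
      <= 2 * (Rabs (b1 - a1) + Rabs (d1 - c1)) * (eps * (S0 / 2 ^ n))).
    { apply Cmod_boundary_int_le.
      - intros w Hw. destruct (Hf w) as [l' Hl'].
        { apply (proj1 (box_le a1 b1 c1 d1 w ltac:(lra) ltac:(lra))) in Hw. apply box_le; lra. }
        eapply Cderiv_Ccont. apply Cderiv_minus; [exact Hl'|].
        apply Cderiv_plus; [apply Cderiv_const|]. apply Cderiv_scal.
        apply Cderiv_minus; [apply Cderiv_id|apply Cderiv_const].
      - intros w Hw. apply (proj1 (box_le a1 b1 c1 d1 w ltac:(lra) ltac:(lra))) in Hw.
        assert (Hd : Cmod (w - z) <= S0 / 2 ^ n).
        { eapply Rle_trans; [apply Cmod_le_Re_Im|]. rewrite <- Hsize.
          apply Rplus_le_compat; apply Rabs_le; unfold z, Re, Im in *; simpl; lra. }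
        replace (f w - (f z + l * (w - z)))%C with (f w - f z - l * (w - z))%C by ring.
        eapply Rle_trans; [apply H1; lra|]. apply Rmult_le_compat_l; lra. }
    rewrite !Rabs_right, Hsize in Hb by lra.
    pose proof (pow_lt 2 n ltac:(lra)) as Hp.
    apply (Rmult_le_compat_l (4 ^ n)) in Hb; [|apply pow_le; lra].
    eapply Rle_trans; [exact Hb|]. right.
    replace 4 with (2 * 2) by ring. rewrite Rpow_mult_distr. field. lra. }
  apply Cmod_eq_0. change (Cmod (I (r 0%nat)) = 0).
  apply Rle_antisym; [|apply Cmod_ge_0]. apply le_epsilon. intros eps He.
  rewrite Rplus_0_l.
  eapply Rle_trans; [apply (Hbound (eps / (2 * S0 * S0 + 1)))|].
  - apply Rdiv_lt_0_compat; nra.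
  - unfold Rdiv. rewrite Rmult_assoc. rewrite <- (Rmult_1_r eps) at 2.
    apply Rmult_le_compat_l; [lra|].
    apply Rmult_le_reg_l with (2 * S0 * S0 + 1); [nra|].
    rewrite <- Rmult_assoc, Rinv_r by nra. lra.
Qed.

(** * Extreme values on compact rectangles *)

Definition CRcont (u : C -> R) (z : C) : Prop :=
  forall eps, 0 < eps -> exists delta, 0 < delta /\ forall w,
    Cmod (w - z) < delta -> Rabs (u w - u z) < eps.

(** The gauge is capped by 1 / (|u| + 1) besides the modulus of continuity. The positive lower bound
    e that compactness provides for the gauge at a tag near each point then bounds |u| there by 1 /
    e. *)
Lemma CRcont_bounded (u : C -> R) (a b c d : R) :
  a <= b -> c <= d -> (forall z, box a b c d z -> CRcont u z) ->
  exists M, forall z, box a b c d z -> u z <= M.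
Proof.
  intros Hab Hcd Hu.
  assert (Hex : forall z, exists dl, 0 < dl /\ (box a b c d z -> forall w,
    Cmod (w - z) < dl -> Rabs (u w - u z) < 1)).
  { intros z. destruct (classic (box a b c d z)) as [H|H].
    - destruct (Hu z H 1 Rlt_0_1) as [dl [H1 H2]]. exists dl. auto.
    - exists 1. split; [lra|tauto]. }
  set (dl := fun z => proj1_sig (constructive_indefinite_description _ (Hex z))).
  assert (Hdl : forall z, 0 < dl z /\ (box a b c d z -> forall w,
    Cmod (w - z) < dl z -> Rabs (u w - u z) < 1))
    by (intros z; exact (proj2_sig (constructive_indefinite_description _ (Hex z)))).
  assert (Hpos : forall x y, 0 < Rmin (dl (x, y) / 2) (/ (Rabs (u (x, y)) + 1))).
  { intros x y. destruct (Hdl (x, y)) as [H _]. apply Rmin_case; [lra|].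
    apply Rinv_0_lt_compat. pose proof (Rabs_pos (u (x, y))). lra. }
  set (g := fun x y => mkposreal _ (Hpos x y)).
  destruct (compactness_value_2d a b c d g) as [e He].
  exists (/ e + 1). intros z Hz. apply Rnot_lt_le. intros Hlt.
  apply (proj1 (box_le a b c d z Hab Hcd)) in Hz.
  apply (He (Re z) (Im z)); [apply Hz..|].
  intros (x & y & Hx & Hy & H1 & H2 & H3).
  assert (B1 : g x y <= dl (x, y) / 2) by apply Rmin_l.
  assert (B2 : g x y <= / (Rabs (u (x, y)) + 1)) by apply Rmin_r.
  destruct (Hdl (x, y)) as [Hd0 Hd]. 
  specialize (Hd (proj2 (box_le a b c d (x, y) Hab Hcd) (conj Hx Hy)) z).
  assert (Hzz : Cmod (z - (x, y)) < dl (x, y)).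
  { eapply Rle_lt_trans; [apply Cmod_le_Re_Im|].
    change (Rabs (Re z - x) + Rabs (Im z - y) < dl (x, y)). lra. }
  specialize (Hd Hzz). apply Rabs_lt_between in Hd.
  pose proof (Rle_abs (u (x, y))). pose proof (Rabs_pos (u (x, y))).
  assert (Rabs (u (x, y)) + 1 <= / e).
  { rewrite <- (Rinv_inv (Rabs (u (x, y)) + 1)). apply Rinv_le_contravar; [apply cond_pos|lra]. }
  lra.
Qed.

(** If the supremum S were not attained, 1 / (S - u) would be continuous, hence bounded by some N,
    and S - 1 / N would be a smaller upper bound. *)
Lemma CRcont_max (u : C -> R) (a b c d : R) :
  a <= b -> c <= d -> (forall z, box a b c d z -> CRcont u z) ->
  exists z0, box a b c d z0 /\ forall z, box a b c d z -> u z <= u z0.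
Proof.
  intros Hab Hcd Hu.
  destruct (CRcont_bounded u a b c d Hab Hcd Hu) as [M HM].
  assert (Hne : box a b c d (a, c)) by (apply box_le; simpl; lra).
  destruct (completeness (fun x => exists z, box a b c d z /\ x = u z)) as [S [HS1 HS2]].
  { exists M. intros x [z [Hz ->]]. auto. }
  { exists (u (a, c)). exists (a, c). auto. }
  destruct (classic (exists z, box a b c d z /\ u z = S)) as [[z0 [H0 E]]|Hn].
  { exists z0. split; [exact H0|]. intros z Hz. rewrite E. apply HS1. exists z. auto. }
  exfalso.
  assert (Hlt : forall z, box a b c d z -> u z < S).
  { intros z Hz. destruct (Rle_lt_or_eq_dec (u z) S) as [H|H]; [|exact H|].
    - apply HS1. exists z. auto.
    - exfalso. apply Hn. exists z. auto. }
  destruct (CRcont_bounded (fun z => / (S - u z)) a b c d Hab Hcd) as [N HN].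
  { intros z Hz eps He. specialize (Hlt z Hz).
    set (g := S - u z). assert (Hg : 0 < g) by (unfold g; lra).
    destruct (Hu z Hz (Rmin (g / 2) (eps * (g * g / 2)))) as [dl [Hd H1]].
    { apply Rmin_case; [lra|]. apply Rmult_lt_0_compat; nra. }
    exists dl. split; [exact Hd|]. intros w Hw. specialize (H1 w Hw).
    assert (A1 : Rabs (u w - u z) < g / 2) by (eapply Rlt_le_trans; [exact H1|apply Rmin_l]).
    assert (A2 : Rabs (u w - u z) < eps * (g * g / 2)) by (eapply Rlt_le_trans; [exact H1|apply Rmin_r]).
    apply Rabs_lt_between in A1.
    cbv beta. fold g. replace (/ (S - u w) - / g) with ((u w - u z) * / ((S - u w) * g))
      by (unfold g in *; field; lra).
    rewrite Rabs_mult, (Rabs_right (/ _)).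
    2:{ left. apply Rinv_0_lt_compat. unfold g in *. nra. }
    apply Rmult_lt_reg_r with ((S - u w) * g); [unfold g in *; nra|].
    rewrite Rmult_assoc, Rinv_l by (unfold g in *; nra). rewrite Rmult_1_r.
    eapply Rlt_le_trans; [exact A2|]. apply Rmult_le_compat_l; [lra|].
    assert (g / 2 <= S - u w) by (unfold g in *; lra). nra. }
  assert (HN0 : 0 < N).
  { specialize (Hlt _ Hne). specialize (HN _ Hne). eapply Rlt_le_trans; [|exact HN].
    apply Rinv_0_lt_compat. lra. }
  assert (Hub : S <= S - / N).
  { apply HS2. intros x [z [Hz ->]]. specialize (Hlt z Hz). specialize (HN z Hz).
    apply Rinv_le_contravar in HN; [|apply Rinv_0_lt_compat; lra].
    rewrite Rinv_inv in HN. lra. }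
  pose proof (Rinv_0_lt_compat N HN0). lra.
Qed.

Lemma Ccont_CRcont_Cmod (f : C -> C) (z : C) : Ccont f z -> CRcont (fun w => Cmod (f w)) z.
Proof.
  intros H eps He. destruct (H eps He) as [d [Hd H1]]. exists d. split; [exact Hd|].
  intros w Hw. specialize (H1 w Hw).
  pose proof (Cmod_triangle_inv (f w) (f z)). pose proof (Cmod_triangle_inv (f z) (f w)).
  rewrite Cmod_minus_sym in H0. apply Rabs_lt_between.
  rewrite (Cmod_minus_sym (f z) (f w)) in *. lra.
Qed.

Lemma Ccont_bounded_disc (f : C -> C) (p : C) (r : R) :
  0 <= r -> (forall z, Ccont f z) -> exists M, 0 <= M /\ forall z, Cmod (z - p) <= r -> Cmod (f z) <= M.
Proof.
  intros Hr Hf.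
  destruct (CRcont_bounded (fun z => Cmod (f z)) (Re p - r) (Re p + r) (Im p - r) (Im p + r))
    as [M HM]; [lra|lra|intros; apply Ccont_CRcont_Cmod, Hf|].
  assert (H : forall z, Cmod (z - p) <= r -> Cmod (f z) <= M).
  { intros z Hz. apply HM. apply box_le; [lra..|].
    pose proof (re_le_Cmod (z - p)) as H1. pose proof (im_le_Cmod (z - p)) as H2.
    apply (fun h => Rle_trans _ _ _ h Hz) in H1. apply (fun h => Rle_trans _ _ _ h Hz) in H2.
    apply Rabs_le_between in H1. apply Rabs_le_between in H2.
    unfold Re, Im in *; simpl in *. lra. }
  exists M. split; [|exact H]. eapply Rle_trans; [apply Cmod_ge_0|apply (H p)].
  replace (p - p)%C with (RtoC 0) by ring. rewrite Cmod_0. exact Hr.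
Qed.

Lemma CInt_swap (g : R -> C) (a b : R) : ex_CInt g a b -> CInt g b a = (- CInt g a b)%C.
Proof.
  intros H. symmetry. apply (opp_RInt_swap (V := C_R_CompleteNormedModule)). exact H.
Qed.

Lemma box_swap_re (a b c d : R) (z : C) : box b a c d z <-> box a b c d z.
Proof. unfold box. rewrite (Rmin_comm b), (Rmax_comm b). tauto. Qed.

Lemma box_swap_im (a b c d : R) (z : C) : box a b d c z <-> box a b c d z.
Proof. unfold box. rewrite (Rmin_comm d), (Rmax_comm d). tauto. Qed.

Lemma boundary_int_swap_re (f : C -> C) (a b c d : R) :
  cont_box f a b c d -> boundary_int f b a c d = (- boundary_int f a b c d)%C.
Proof.
  intros Hf. unfold boundary_int.
  rewrite (CInt_swap (fun x => f (x, c)) a b), (CInt_swap (fun x => f (x, d)) a b); [ring|..];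
   apply ex_CInt_horizontal; intros; apply Hf, box_intro; trivial;
   apply Rmin_max_l || apply Rmin_max_r.
Qed.

Lemma boundary_int_swap_im (f : C -> C) (a b c d : R) :
  cont_box f a b c d -> boundary_int f a b d c = (- boundary_int f a b c d)%C.
Proof.
  intros Hf. unfold boundary_int.
  rewrite (CInt_swap (fun y => Ci * f (a, y))%C c d), (CInt_swap (fun y => Ci * f (b, y))%C c d);
   [ring|..];
   apply ex_CInt_vertical; intros; apply Hf, box_intro; trivial;
   apply Rmin_max_l || apply Rmin_max_r.
Qed.

Lemma goursat (f : C -> C) (a b c d : R) :
  (forall z, box a b c d z -> exists l, Cderiv f z l) -> boundary_int f a b c d = 0.
Proof.
  assert (K : forall a b c d, a <= b ->
    (forall z, box a b c d z -> exists l, Cderiv f z l) -> boundary_int f a b c d = 0).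
  { clear. intros a b c d Hab Hf. destruct (Rle_dec c d) as [Hcd|Hcd].
    - apply goursat_le; assumption.
    - assert (Hf' : forall z, box a b d c z -> exists l, Cderiv f z l)
        by (intros z Hz; apply Hf, box_swap_im; exact Hz).
      rewrite boundary_int_swap_im.
      + rewrite goursat_le; [ring|lra|lra|exact Hf'].
      + intros z Hz. destruct (Hf' z Hz) as [l Hl]. eapply Cderiv_Ccont; exact Hl. }
  intros Hf. destruct (Rle_dec a b) as [Hab|Hab]; [apply K; assumption|].
  assert (Hf' : forall z, box b a c d z -> exists l, Cderiv f z l)
    by (intros z Hz; apply Hf, box_swap_re; exact Hz).
  rewrite boundary_int_swap_re.
  - rewrite K; [ring|lra|exact Hf'].
  - intros z Hz. destruct (Hf' z Hz) as [l Hl]. eapply Cderiv_Ccont; exact Hl.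
Qed.

(** * Primitives of holomorphic functions *)

Definition Copen (D : C -> Prop) : Prop :=
  forall z, D z -> exists r, 0 < r /\ forall w, Cmod (w - z) < r -> D w.

(** With two points D contains the rectangle having them as opposite corners, so L-shaped paths and
    the rectangles between them stay inside. Half planes, half strips and their intersections
    qualify. *)
Definition box_convex (D : C -> Prop) : Prop :=
  forall z w u, D z -> D w -> box (Re z) (Re w) (Im z) (Im w) u -> D u.

Lemma CInt_const_horizontal (p : C) (a b : R) : CInt (fun _ => p) a b = (p * RtoC (b - a))%C.
Proof.
  rewrite (CInt_derive_horizontal (fun z => p * z)%C (fun _ => p) a b 0).
  - replace (RtoC (b - a)) with ((b, 0) - (a, 0))%C by (apply C_ext; simpl; ring). cring.
  - intros x _. split.
    + eapply Cderiv_eq; [apply Cderiv_scal, Cderiv_id|ring].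
    + eapply Cderiv_Ccont, Cderiv_const.
Qed.

Lemma primitive_exists (D : C -> Prop) (f : C -> C) (z0 : C) :
  Copen D -> box_convex D -> D z0 -> (forall z, D z -> exists l, Cderiv f z l) ->
  exists F, forall z, D z -> Cderiv F z (f z).
Proof.
  intros HO HB H0 Hf.
  assert (Hc : forall z, D z -> Ccont f z).
  { intros z Hz. destruct (Hf z Hz) as [l Hl]. eapply Cderiv_Ccont; exact Hl. }
  (* The integral along the path that leaves z0 horizontally and reaches z vertically. *)
  exists (fun z => CInt (fun x => f (x, Im z0)) (Re z0) (Re z)
                   + CInt (fun y => Ci * f (Re z, y)) (Im z0) (Im z))%C.
  intros z Hz eps He.
  destruct (HO z Hz) as [r [Hr HrD]].
  destruct (Hc z Hz (eps / 2) ltac:(lra)) as [dl [Hdl Hfz]].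
  exists (Rmin r (dl / 2)). split; [apply Rmin_case; lra|]. intros w Hw.
  assert (Hwr : Cmod (w - z) < r) by (eapply Rlt_le_trans; [exact Hw|apply Rmin_l]).
  assert (Hwd : Cmod (w - z) < dl / 2) by (eapply Rlt_le_trans; [exact Hw|apply Rmin_r]).
  assert (HwD : D w) by (apply HrD; exact Hwr).
  pose proof (re_le_Cmod (w - z)) as Hre. pose proof (im_le_Cmod (w - z)) as Him.
  replace (Re (w - z)) with (Re w - Re z) in Hre by reflexivity.
  replace (Im (w - z)) with (Im w - Im z) in Him by reflexivity.
  assert (Hbz : forall u v, box (Re z) (Re w) (Im z) (Im w) (u, v) -> D (u, v))
    by (intros u v; apply HB; assumption).
  assert (Hz0 : forall p q x y, D p -> D q -> Rmin (Re p) (Re q) <= x <= Rmax (Re p) (Re q) ->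
     Rmin (Im p) (Im q) <= y <= Rmax (Im p) (Im q) -> D (x, y))
    by (intros p q x y Hp Hq Hx Hy; apply (HB p q); [assumption..|split; assumption]).
  assert (Hclose : forall u, box (Re z) (Re w) (Im z) (Im w) u -> Cmod (f u - f z) <= eps / 2).
  { intros u [Hu1 Hu2]. left. apply Hfz. eapply Rle_lt_trans; [apply Cmod_le_Re_Im|].
    assert (Rabs (Re u - Re z) <= Rabs (Re w - Re z)).
    { destruct (Rle_dec (Re z) (Re w)); [rewrite Rmin_left, Rmax_right in Hu1 by lra; rewrite !Rabs_right; lra|
      rewrite Rmin_right, Rmax_left in Hu1 by lra; rewrite !Rabs_left1; lra]. }
    assert (Rabs (Im u - Im z) <= Rabs (Im w - Im z)).
    { destruct (Rle_dec (Im z) (Im w)); [rewrite Rmin_left, Rmax_right in Hu2 by lra; rewrite !Rabs_right; lra|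
      rewrite Rmin_right, Rmax_left in Hu2 by lra; rewrite !Rabs_left1; lra]. }
    change (Re (u - z)) with (Re u - Re z). change (Im (u - z)) with (Im u - Im z). lra. }
  set (a := Re z) in *. set (b := Re w) in *. set (c := Im z0) in *. set (d := Im z) in *.
  set (e := Im w) in *.
  assert (Hex1 : ex_CInt (fun x => f (x, c)) (Re z0) a).
  { apply ex_CInt_horizontal. intros x Hx. apply Hc. apply (Hz0 z0 z); trivial.
    unfold c. apply Rmin_max_l. }
  assert (Hex2 : ex_CInt (fun x => f (x, c)) a b).
  { apply ex_CInt_horizontal. intros x Hx. apply Hc.
    apply (Hz0 (a, c) (b, c)); simpl; [| |exact Hx|apply Rmin_max_l].
    - apply (Hz0 z0 z); [exact H0|exact Hz|apply Rmin_max_r|apply Rmin_max_l].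
    - apply (Hz0 z0 w); [exact H0|exact HwD|apply Rmin_max_r|apply Rmin_max_l]. }
  assert (HDb : D (b, d)) by (apply Hbz, box_intro; [apply Rmin_max_r|apply Rmin_max_l]).
  assert (Hex3 : ex_CInt (fun y => Ci * f (b, y))%C c d).
  { apply ex_CInt_vertical. intros y Hy. apply Hc.
    apply (Hz0 z0 (b, d)); trivial. simpl. apply Rmin_max_r. }
  assert (Hex4 : ex_CInt (fun y => Ci * f (b, y))%C d e).
  { apply ex_CInt_vertical. intros y Hy. apply Hc.
    apply Hbz, box_intro; [apply Rmin_max_r|exact Hy]. }
  assert (Hex5 : ex_CInt (fun x => f (x, d)) a b).
  { apply ex_CInt_horizontal. intros x Hx. apply Hc.
    apply Hbz, box_intro; [exact Hx|apply Rmin_max_l]. }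
  (* Goursat lifts the horizontal piece from a to b from height Im z0 to height Im z, so that F w -
     F z becomes an integral over a short path from z to w. *)
  assert (HG : boundary_int f a b c d = 0).
  { apply goursat. intros [x y] [Hx Hy]. apply Hf. simpl in Hx, Hy.
    apply (Hz0 (x, c) (x, d)); simpl; [| |apply Rmin_max_l|exact Hy].
    - apply (Hz0 (a, c) (b, c)); simpl; [| |exact Hx|apply Rmin_max_l].
      + apply (Hz0 z0 z); [exact H0|exact Hz|apply Rmin_max_r|apply Rmin_max_l].
      + apply (Hz0 z0 w); [exact H0|exact HwD|apply Rmin_max_r|apply Rmin_max_l].
    - apply Hbz, box_intro; [exact Hx|apply Rmin_max_l]. }
  unfold boundary_int in HG.
  rewrite <- (CInt_Chasles (fun x => f (x, c)) (Re z0) a b Hex1 Hex2).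
  rewrite <- (CInt_Chasles (fun y => Ci * f (b, y))%C c d e Hex3 Hex4).
  set (I1 := CInt (fun x => f (x, c)) (Re z0) a) in *.
  set (I2 := CInt (fun x => f (x, c)) a b) in *.
  set (I3 := CInt (fun y => Ci * f (b, y))%C c d) in *.
  set (I4 := CInt (fun y => Ci * f (b, y))%C d e) in *.
  set (I5 := CInt (fun x => f (x, d)) a b) in *.
  set (I6 := CInt (fun y => Ci * f (a, y))%C c d) in *.
  assert (E : (I1 + I2 + (I3 + I4) - (I1 + I6) - f z * (w - z)
     = (I5 - f z * RtoC (b - a)) + (I4 - Ci * f z * RtoC (e - d)))%C).
  { replace (w - z)%C with (RtoC (b - a) + Ci * RtoC (e - d))%C
      by (apply C_ext; unfold a, b, d, e, Re, Im; simpl; ring).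
    replace I2 with (I5 - I3 + I6)%C; [ring|].
    replace I2 with ((I2 - I5 + I3 - I6) + (I5 - I3 + I6))%C by ring. rewrite HG. ring. }
  rewrite E. unfold I5, I4.
  rewrite <- !CInt_const_horizontal.
  assert (Hk : forall p u v, ex_CInt (fun _ : R => p) u v).
  { intros p u v. apply ex_RInt_continuous. intros y _. apply continuous_const. }
  rewrite <- (CInt_minus (fun x => f (x, d)) (fun _ => f z)) by (exact Hex5 || apply Hk).
  rewrite <- (CInt_minus (fun y => Ci * f (b, y))%C (fun _ => Ci * f z)%C) by (exact Hex4 || apply Hk).
  assert (B1 : Cmod (CInt (fun x => f (x, d) - f z)%C a b) <= Rabs (b - a) * (eps / 2)).
  { apply Cmod_CInt_le.
    - apply (ex_RInt_minus (V := C_R_NormedModule)); [exact Hex5|apply Hk].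
    - intros x Hx. apply Hclose, box_intro; [exact Hx|apply Rmin_max_l]. }
  assert (B2 : Cmod (CInt (fun y => Ci * f (b, y) - Ci * f z)%C d e) <= Rabs (e - d) * (eps / 2)).
  { apply Cmod_CInt_le.
    - apply (ex_RInt_minus (V := C_R_NormedModule)); [exact Hex4|apply Hk].
    - intros y Hy. replace (Ci * f (b, y) - Ci * f z)%C with (Ci * (f (b, y) - f z))%C by ring.
      rewrite Cmod_mult, Cmod_Ci, Rmult_1_l.
      apply Hclose, box_intro; [apply Rmin_max_r|exact Hy]. }
  eapply Rle_trans; [apply Cmod_triangle|].
  pose proof (Rabs_pos (b - a)). pose proof (Rabs_pos (e - d)). nra.
Qed.

(** * Derivatives of entire functions *)

Lemma cexp_2PI (x y : R) : cexp (x, y + 2 * PI) = cexp (x, y).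
Proof. unfold cexp. simpl. rewrite cos_plus, sin_plus, cos_2PI, sin_2PI. f_equal; ring. Qed.

Lemma Cderiv_cexp_opp (z : C) : Cderiv (fun w => cexp (- w)) z (- cexp (- z)).
Proof.
  eapply Cderiv_eq.
  - apply (Cderiv_cexp_comp (fun w => - w)%C).
    apply (Cderiv_ext (fun w => 0 - w)%C); [intros; ring|].
    apply Cderiv_minus; [apply Cderiv_const|apply Cderiv_id].
  - ring.
Qed.

Lemma Cmod_cexp_Im (y : R) : Cmod (cexp (0, y)) = 1.
Proof. rewrite Cmod_cexp. apply exp_0. Qed.

Lemma Cmod_cexp_opp_Im (y : R) : Cmod (cexp (- (0, y))) = 1.
Proof. rewrite Cmod_cexp. simpl. rewrite Ropp_0. apply exp_0. Qed.

Lemma PI_pos2 : 0 < 2 * PI.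
Proof. pose proof PI_RGT_0. lra. Qed.

(** The integral of G(z) / (z - s)^2 dz over the unit circle around s, with z = s + e^(iy). *)
Definition circle_int (G : C -> C) (s : C) : C :=
  CInt (fun y => Ci * (G (s + cexp (0, y)) * cexp (- (0, y))))%C 0 (2 * PI).

Lemma Ccont_mult (f g : C -> C) (z : C) : Ccont f z -> Ccont g z -> Ccont (fun w => f w * g w)%C z.
Proof.
  intros Hf Hg eps He.
  pose proof (Cmod_ge_0 (f z)) as Pf. pose proof (Cmod_ge_0 (g z)) as Pg.
  set (A := Cmod (f z) + 1). set (B := Cmod (g z) + 1).
  destruct (Hf (Rmin 1 (eps / (2 * B)))) as [d1 [Hd1 H1]].
  { apply Rmin_case; [lra|apply Rdiv_lt_0_compat; unfold B; lra]. }
  destruct (Hg (eps / (2 * A))) as [d2 [Hd2 H2]].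
  { apply Rdiv_lt_0_compat; unfold A; lra. }
  exists (Rmin d1 d2). split; [apply Rmin_case; assumption|]. intros w Hw.
  specialize (H1 w (Rlt_le_trans _ _ _ Hw (Rmin_l _ _))).
  specialize (H2 w (Rlt_le_trans _ _ _ Hw (Rmin_r _ _))).
  assert (H1a : Cmod (f w - f z) < 1) by (eapply Rlt_le_trans; [exact H1|apply Rmin_l]).
  assert (H1b : Cmod (f w - f z) < eps / (2 * B)) by (eapply Rlt_le_trans; [exact H1|apply Rmin_r]).
  replace (f w * g w - f z * g z)%C
    with (f w * (g w - g z) + (f w - f z) * g z)%C by ring.
  eapply Rle_lt_trans; [apply Cmod_triangle|]. rewrite !Cmod_mult.
  assert (Hfw : Cmod (f w) <= A) by (unfold A; pose proof (Cmod_triangle_inv (f w) (f z)); lra).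
  assert (Cmod (f w) * Cmod (g w - g z) <= A * Cmod (g w - g z))
    by (apply Rmult_le_compat_r; [apply Cmod_ge_0|exact Hfw]).
  assert (A * Cmod (g w - g z) < A * (eps / (2 * A))) by (apply Rmult_lt_compat_l; [unfold A; lra|exact H2]).
  assert (EA : A * (eps / (2 * A)) = eps / 2) by (field; unfold A; lra).
  assert (Cmod (f w - f z) * Cmod (g z) <= Cmod (f w - f z) * B)
    by (apply Rmult_le_compat_l; [apply Cmod_ge_0|unfold B; lra]).
  assert (Cmod (f w - f z) * B < eps / (2 * B) * B) by (apply Rmult_lt_compat_r; [unfold B; lra|exact H1b]).
  assert (EB : eps / (2 * B) * B = eps / 2) by (field; unfold B; lra).
  lra.
Qed.

Lemma Ccont_comp (f g : C -> C) (z : C) : Ccont f (g z) -> Ccont g z -> Ccont (fun w => f (g w)) z.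
Proof.
  intros Hf Hg eps He. destruct (Hf eps He) as [d [Hd H]].
  destruct (Hg d Hd) as [e [Hep H']]. exists e. auto.
Qed.

Lemma ex_circle_int (G : C -> C) (s : C) :
  (forall z, Ccont G z) ->
  ex_CInt (fun y => Ci * (G (s + cexp (0, y)) * cexp (- (0, y))))%C 0 (2 * PI).
Proof.
  intros HG. apply (ex_CInt_vertical (fun w => G (s + cexp w) * cexp (- w))%C 0).
  intros y _. apply Ccont_mult.
  - apply (Ccont_comp G (fun w => s + cexp w)%C); [apply HG|]. eapply Cderiv_Ccont.
    apply Cderiv_plus; [apply Cderiv_const|apply Cderiv_cexp].
  - eapply Cderiv_Ccont, Cderiv_cexp_opp.
Qed.

Lemma circle_int_minus (G H : C -> C) (s q : C) :
  (forall z, Ccont G z) -> (forall z, Ccont H z) ->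
  (circle_int G s - circle_int H q)%C =
  CInt (fun y => Ci * ((G (s + cexp (0, y)) - H (q + cexp (0, y))) * cexp (- (0, y))))%C 0 (2 * PI).
Proof.
  intros HG HH. unfold circle_int.
  rewrite <- CInt_minus by (apply ex_circle_int; assumption).
  f_equal. apply functional_extensionality. intros y. ring.
Qed.

Lemma Cmod_circle_int_minus_le (G H : C -> C) (s q : C) (M : R) :
  (forall z, Ccont G z) -> (forall z, Ccont H z) ->
  (forall e, Cmod e = 1 -> Cmod (G (s + e)%C - H (q + e)%C) <= M) ->
  Cmod (circle_int G s - circle_int H q) <= 2 * PI * M.
Proof.
  intros HG HH HM. rewrite circle_int_minus by assumption.
  eapply Rle_trans; [apply (Cmod_CInt_le _ _ _ M)|].
  - apply (ex_RInt_ext (V := C_R_NormedModule)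
      (fun y => (Ci * (G (s + cexp (0, y)) * cexp (- (0, y)))) -
                (Ci * (H (q + cexp (0, y)) * cexp (- (0, y)))))%C).
    + intros y _. cring.
    + apply (ex_RInt_minus (V := C_R_NormedModule)); apply ex_circle_int; assumption.
  - intros y _. rewrite !Cmod_mult, Cmod_Ci, Cmod_cexp_opp_Im, Rmult_1_l, Rmult_1_r.
    apply HM, Cmod_cexp_Im.
  - rewrite Rminus_0_r, Rabs_right by (pose proof PI_pos2; lra). lra.
Qed.

(* In the coordinate w with z = s + e^w, the horizontal sides of [a, 0] x [0, 2 PI] cancel by
   periodicity, so the integral over the circle of radius e^a does not depend on a; let a -> -oo. *)
Lemma circle_int_derive (F F' : C -> C) (s : C) :
  (forall z, Cderiv F z (F' z)) -> circle_int F s = (RtoC (2 * PI) * (Ci * F' s))%C.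
Proof.
  intros HF. pose proof PI_pos2 as HP.
  set (h := fun w => (F (s + cexp w) * cexp (- w))%C).
  assert (Hh : forall z, exists l, Cderiv h z l).
  { intros z. eexists. apply Cderiv_mult.
    - apply (Cderiv_comp F (fun w => s + cexp w)%C); [apply HF|].
      apply Cderiv_plus; [apply Cderiv_const|apply Cderiv_cexp].
    - apply Cderiv_cexp_opp. }
  assert (Hhc : forall z, Ccont h z) by (intros z; destruct (Hh z) as [l Hl]; eapply Cderiv_Ccont; exact Hl).
  assert (Ha : forall a, circle_int F s = CInt (fun y => Ci * h (a, y))%C 0 (2 * PI)).
  { intros a. pose proof (goursat h a 0 0 (2 * PI) (fun z _ => Hh z)) as HG.
    unfold boundary_int in HG.
    assert (E : (fun x => h (x, 2 * PI)) = (fun x => h (x, 0))).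
    { apply functional_extensionality. intros x. unfold h. rewrite !cexp_opp.
      rewrite <- (cexp_2PI x 0), Rplus_0_l. reflexivity. }
    rewrite E in HG. unfold circle_int. 
    change (fun y => (Ci * (F (s + cexp (0, y)) * cexp (- (0, y))))%C) with (fun y => (Ci * h (0%R, y))%C).
    assert (K : forall u x y : C, (u - u + x - y)%C = 0 -> x = y).
    { intros u x y E1. replace x with (u - u + x - y + y)%C by ring. rewrite E1. ring. }
    exact (K _ _ _ HG). }
  assert (Hb : forall eps, 0 < eps ->
    Cmod (circle_int F s - RtoC (2 * PI) * (Ci * F' s)) <= 2 * PI * eps).
  { intros eps He. destruct (HF s eps He) as [d [Hd H1]].
    (* The radius e^a = d / 2 places the circle where the derivative at s controls F. *)
    set (a := ln (d / 2)). assert (Hea : exp a = d / 2) by (apply exp_ln; lra).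
    rewrite (Ha a).
    (* g is h with F replaced by its first order expansion at s; the term in e^(-w) integrates to 0
       over a period and the constant gives 2 pi i F'(s). *)
    set (g := fun w => (F s * cexp (- w) + F' s)%C).
    assert (Hg : forall z, Ccont g z).
    { intros z. eapply Cderiv_Ccont. apply Cderiv_plus; [|apply Cderiv_const].
      apply Cderiv_scal. apply Cderiv_cexp_opp. }
    assert (Eg : CInt (fun y => Ci * g (a, y))%C 0 (2 * PI) = (RtoC (2 * PI) * (Ci * F' s))%C).
    { rewrite (CInt_derive_vertical (fun w => - F s * cexp (- w) + F' s * w)%C).
      - rewrite !cexp_opp, <- (cexp_2PI a 0), Rplus_0_l.
        replace (RtoC (2 * PI) * (Ci * F' s))%C with (F' s * ((a, (2 * PI)%R) - (a, 0%R)))%C.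
        + cring.
        + replace ((a, (2 * PI)%R) - (a, 0%R))%C with (Ci * RtoC (2 * PI))%C; [ring|].
          apply C_ext; simpl; ring.
      - intros y _. split; [|apply Hg]. eapply Cderiv_eq.
        + apply Cderiv_plus; apply Cderiv_scal; [apply Cderiv_cexp_opp|apply Cderiv_id].
        + unfold g. ring. }
    rewrite <- Eg.
    assert (Hex : forall k, (forall z, Ccont k z) -> ex_CInt (fun y => Ci * k (a, y))%C 0 (2 * PI))
      by (intros k Hk; apply ex_CInt_vertical; auto).
    rewrite <- CInt_minus by (apply Hex; assumption).
    eapply Rle_trans; [apply (Cmod_CInt_le _ _ _ eps)|].
    - apply (ex_RInt_minus (V := C_R_NormedModule)); apply Hex; assumption.
    - intros y _.
      assert (Hw : Cmod (cexp (a, y)) = d / 2) by (rewrite Cmod_cexp; exact Hea).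
      replace (Ci * h (a, y) - Ci * g (a, y))%C
        with (Ci * ((F (s + cexp (a, y)) - F s - F' s * (s + cexp (a, y) - s)) * / cexp (a, y)))%C.
      + rewrite !Cmod_mult, Cmod_Ci, Cmod_inv, Hw by apply cexp_neq_0. rewrite Rmult_1_l.
        specialize (H1 (s + cexp (a, y))%C).
        replace (s + cexp (a, y) - s)%C with (cexp (a, y)) in * by ring.
        rewrite Hw in H1. specialize (H1 ltac:(lra)).
        apply Rmult_le_reg_r with (d / 2); [lra|].
        rewrite Rmult_assoc, Rinv_l by lra. lra.
      + unfold h, g. rewrite cexp_opp. field. apply cexp_neq_0.
    - rewrite Rminus_0_r, Rabs_right by lra. lra. }
  assert (H0 : Cmod (circle_int F s - RtoC (2 * PI) * (Ci * F' s)) = 0).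
  { apply Rle_antisym; [|apply Cmod_ge_0]. apply le_epsilon. intros eps He.
    rewrite Rplus_0_l. eapply Rle_trans; [apply (Hb (eps / (2 * PI)))|].
    - apply Rdiv_lt_0_compat; lra.
    - right. field. pose proof PI_RGT_0. lra. }
  apply Cmod_eq_0 in H0.
  transitivity (circle_int F s - RtoC (2 * PI) * (Ci * F' s) + RtoC (2 * PI) * (Ci * F' s))%C; [ring|].
  rewrite H0. ring.
Qed.

Lemma Cmod_2PI_Ci (z : C) : Cmod (RtoC (2 * PI) * (Ci * z)) = 2 * PI * Cmod z.
Proof.
  rewrite !Cmod_mult, Cmod_Ci, Cmod_R, Rabs_right by (pose proof PI_pos2; lra). ring.
Qed.

(** Cauchy's estimate on unit circles, applied to a difference: continuity of F' follows from that
    of F. *)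
Lemma entire_derive_minus_le (F F' : C -> C) (HF : forall z, Cderiv F z (F' z)) (s q : C) (M : R) :
  (forall e, Cmod e = 1 -> Cmod (F (s + e)%C - F (q + e)%C) <= M) -> Cmod (F' s - F' q) <= M.
Proof.
  intros HM. pose proof PI_pos2 as HP.
  pose proof (Cmod_circle_int_minus_le F F s q M (fun z => Cderiv_Ccont F z _ (HF z)) (fun z => Cderiv_Ccont F z _ (HF z)) HM) as H.
  rewrite !(circle_int_derive F F') in H by exact HF.
  replace (RtoC (2 * PI) * (Ci * F' s) - RtoC (2 * PI) * (Ci * F' q))%C
    with (RtoC (2 * PI) * (Ci * (F' s - F' q)))%C in H by ring.
  rewrite Cmod_2PI_Ci in H. apply Rmult_le_reg_l in H; lra.
Qed.

Lemma entire_derive_le (F F' : C -> C) (HF : forall z, Cderiv F z (F' z)) (s : C) (M : R) :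
  (forall e, Cmod e = 1 -> Cmod (F (s + e)%C) <= M) -> Cmod (F' s) <= M.
Proof.
  intros HM. pose proof PI_pos2 as HP.
  pose proof (Cmod_circle_int_minus_le F (fun _ => 0) s s M (fun z => Cderiv_Ccont F z _ (HF z))
    (fun z => Cderiv_Ccont _ z _ (Cderiv_const 0 z))) as H.
  rewrite (circle_int_derive (fun _ => 0) (fun _ => 0) s (Cderiv_const 0)) in H.
  rewrite (circle_int_derive F F') in H by exact HF.
  replace (RtoC (2 * PI) * (Ci * F' s) - RtoC (2 * PI) * (Ci * 0))%C
    with (RtoC (2 * PI) * (Ci * F' s))%C in H by ring.
  rewrite Cmod_2PI_Ci in H. apply Rmult_le_reg_l in H; [exact H|lra|].
  intros e He. replace (F (s + e)%C - 0)%C with (F (s + e)%C) by ring. auto.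
Qed.

(** The radius 3 is 1 for z, 1 for the circle expressing F' by F, and 1 for the circle bounding F'
    on the segments in between. *)
Lemma entire_derive_lipschitz (F F' : C -> C) (HF : forall z, Cderiv F z (F' z)) (p : C) (M : R) :
  (forall z, Cmod (z - p) <= 3 -> Cmod (F z) <= M) ->
  forall z, Cmod (z - p) <= 1 -> Cmod (F' z - F' p) <= M * Cmod (z - p).
Proof.
  intros HM z Hz. apply (entire_derive_minus_le F F' HF). intros e He.
  replace (z - p)%C with ((z + e) - (p + e))%C by ring.
  apply (Cderiv_increment_bound F F'); intros t Ht; [apply HF|].
  apply (entire_derive_le F F' HF). intros e' He'. apply HM.
  replace (p + e + t * (z + e - (p + e)) + e' - p)%C with (e + e' + t * (z - p))%C by ring.
  eapply Rle_trans; [apply Cmod_triangle|].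
  pose proof (Cmod_triangle e e') as HT.
  rewrite Cmod_mult, Cmod_R, (Rabs_right t) by lra.
  pose proof (Cmod_ge_0 (z - p)). nra.
Qed.

Lemma entire_derive_cont (F F' : C -> C) (HF : forall z, Cderiv F z (F' z)) (p : C) : Ccont F' p.
Proof.
  destruct (Ccont_bounded_disc F p 3 ltac:(lra) (fun z => Cderiv_Ccont F z _ (HF z))) as [M [HM0 HM]].
  intros eps He. exists (Rmin 1 (eps / (M + 1))).
  split; [apply Rmin_case; [lra|apply Rdiv_lt_0_compat; lra]|]. intros w Hw.
  assert (H1 : Cmod (w - p) < 1) by (eapply Rlt_le_trans; [exact Hw|apply Rmin_l]).
  assert (H2 : Cmod (w - p) < eps / (M + 1)) by (eapply Rlt_le_trans; [exact Hw|apply Rmin_r]).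
  eapply Rle_lt_trans; [apply (entire_derive_lipschitz F F' HF p M HM); lra|].
  apply (Rmult_lt_compat_l (M + 1)) in H2; [|lra].
  replace ((M + 1) * (eps / (M + 1))) with eps in H2 by (field; lra).
  pose proof (Cmod_ge_0 (w - p)). lra.
Qed.

(** Differentiation of F' = [circle_int] F / (2 pi i) under the integral sign: the difference
    quotients of F converge to F' uniformly on the unit circle around p. *)
Lemma entire_derive_derive (F F' : C -> C) (HF : forall z, Cderiv F z (F' z)) (p : C) : exists l, Cderiv F' p l.
Proof.
  pose proof PI_pos2 as HP.
  destruct (Ccont_bounded_disc F p 4 ltac:(lra) (fun z => Cderiv_Ccont F z _ (HF z))) as [M [HM0 HM]].
  set (c := (RtoC (2 * PI) * Ci)%C).
  assert (Hc : c <> 0).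
  { apply Cmod_gt_0. unfold c. replace Ci with (Ci * 1)%C by ring.
    rewrite Cmod_2PI_Ci, Cmod_1. lra. }
  exists (circle_int F' p / c)%C.
  intros eps He. exists (Rmin 1 (eps / (M + 1))).
  split; [apply Rmin_case; [lra|apply Rdiv_lt_0_compat; lra]|]. intros w Hw.
  assert (H1 : Cmod (w - p) < 1) by (eapply Rlt_le_trans; [exact Hw|apply Rmin_l]).
  assert (H2 : Cmod (w - p) < eps / (M + 1)) by (eapply Rlt_le_trans; [exact Hw|apply Rmin_r]).
  assert (HFs : forall z, Cderiv (fun z => F (z + (w - p)))%C z (F' (z + (w - p))%C)).
  { intros z. eapply Cderiv_eq; [apply (Cderiv_comp F (fun z => z + (w - p))%C); [apply HF|]|].
    - apply Cderiv_plus; [apply Cderiv_id|apply Cderiv_const].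
    - ring. }
  assert (E : circle_int (fun z => F' z * (w - p))%C p = (circle_int F' p * (w - p))%C).
  { assert (Hk : forall k, circle_int (fun z => F' z * k)%C p = (circle_int F' p * k)%C).
    { intros k. unfold circle_int. rewrite <- CInt_scal by (apply ex_circle_int, (entire_derive_cont F F' HF)).
      f_equal. apply functional_extensionality. intros y. ring. }
    apply Hk. }
  assert (E1 : (F' w - F' p - circle_int F' p / c * (w - p))%C
     = ((circle_int (fun z => F (z + (w - p)) - F z)%C p
        - circle_int (fun z => F' z * (w - p))%C p) / c)%C).
  { rewrite E.
    rewrite (circle_int_derive (fun z => F (z + (w - p)) - F z)%C
       (fun z => F' (z + (w - p)) - F' z)%C)
      by (intros z; apply Cderiv_minus; [apply HFs|apply HF]).
    replace (p + (w - p))%C with w by ring. unfold c. field.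
    split; [|intros H; apply RtoC_inj in H; lra].
    intros H. apply (f_equal Im) in H. simpl in H. lra. }
  rewrite E1, Cmod_div by exact Hc.
  replace (Cmod c) with (2 * PI)
    by (unfold c; replace Ci with (Ci * 1)%C by ring; rewrite Cmod_2PI_Ci, Cmod_1; ring).
  apply Rmult_le_reg_r with (2 * PI); [lra|]. unfold Rdiv. rewrite Rmult_assoc, Rinv_l by lra.
  rewrite Rmult_1_r, (Rmult_comm _ (2 * PI)).
  apply Cmod_circle_int_minus_le.
  - intros z. eapply Cderiv_Ccont. apply Cderiv_minus; [apply HFs|apply HF].
  - intros z. apply Ccont_mult; [apply (entire_derive_cont F F' HF)|]. eapply Cderiv_Ccont, Cderiv_const.
  - intros e He1. set (q := (p + e)%C). set (h := (w - p)%C) in *.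
    (* The remainder is the increment of F z - F' q * z, whose derivative F' z - F' q is at most M
       |h| on the segment; this makes it quadratic in h. *)
    replace (F (q + h) - F q - F' q * h)%C with ((F (q + h) - F' q * (q + h)) - (F q - F' q * q))%C by ring.
    eapply Rle_trans.
    + apply (Cderiv_increment_bound (fun z => F z - F' q * z)%C (fun z => F' z - F' q * 1)%C
        q (q + h) (M * Cmod h)).
      * intros t Ht. apply Cderiv_minus; [apply HF|]. apply Cderiv_scal, Cderiv_id.
      * intros t Ht. rewrite Cmult_1_r.
        replace (q + h - q)%C with h by ring.
        assert (Hth : Cmod (q + t * h - q) <= Cmod h).
        { replace (q + t * h - q)%C with (t * h)%C by ring.
          rewrite Cmod_mult, Cmod_R, (Rabs_right t) by lra. pose proof (Cmod_ge_0 h). nra. }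
        eapply Rle_trans; [apply (entire_derive_lipschitz F F' HF q M)|].
        { intros z Hz. apply HM. replace (z - p)%C with ((z - q) + e)%C by (unfold q; ring).
          eapply Rle_trans; [apply Cmod_triangle|]. lra. }
        { lra. }
        apply Rmult_le_compat_l; assumption.
    + replace (q + h - q)%C with h by ring.
      pose proof (Cmod_ge_0 h). apply Rmult_le_compat_r; [assumption|].
      apply (Rmult_lt_compat_l (M + 1)) in H2; [|lra].
      replace ((M + 1) * (eps / (M + 1))) with eps in H2 by (field; lra). lra.
Qed.

(** * Maximum principle, three circles, Borel-Caratheodory *)

Lemma second_derivative_test (f f1 : R -> R) (t0 l r : R) :
  0 < r -> (forall t, Rabs (t - t0) < r -> is_derive f t (f1 t)) -> is_derive f1 t0 l ->
  (forall t, Rabs (t - t0) < r -> f t <= f t0) -> l <= 0.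
Proof.
  intros Hr Hf Hf1 Hmax. apply Rnot_lt_le. intros Hl.
  destruct Hf1 as [_ Hf1].
  destruct (Hf1 t0 (fun P HP => HP) (mkposreal (l / 2) ltac:(lra))) as [d Hd].
  assert (Hd' : forall t, Rabs (t - t0) < d -> Rabs (f1 t - f1 t0 - (t - t0) * l) <= l / 2 * Rabs (t - t0))
    by (intros t Ht; exact (Hd t Ht)).
  set (e := Rmin r d / 2).
  assert (He : 0 < e) by (unfold e; pose proof (Rmin_case r d (fun x => 0 < x) Hr (cond_pos d)); lra).
  assert (He1 : e < r) by (unfold e in *; pose proof (Rmin_l r d); lra).
  assert (He2 : e < d) by (unfold e in *; pose proof (Rmin_r r d); lra).
  (* If l > 0, then f1 increases through t0. Depending on the sign of f1 t0, f exceeds f t0 just to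
     the right or just to the left. *)
  destruct (Rle_dec 0 (f1 t0)) as [H0|H0].
  - destruct (MVT_cor2 f f1 t0 (t0 + e)) as [c [E Hc]]; [lra| |].
    + intros c Hc. apply is_derive_Reals, Hf. rewrite Rabs_right; lra.
    + specialize (Hd' c). rewrite Rabs_right in Hd' by lra. specialize (Hd' ltac:(lra)).
      specialize (Hmax (t0 + e)). rewrite Rabs_right in Hmax by lra. specialize (Hmax ltac:(lra)).
      apply Rabs_le_between in Hd'.
      assert (0 < l * (c - t0)) by (apply Rmult_lt_0_compat; lra).
      assert (0 < f1 c) by lra. nra.
  - destruct (MVT_cor2 f f1 (t0 - e) t0) as [c [E Hc]]; [lra| |].
    + intros c Hc. apply is_derive_Reals, Hf. rewrite Rabs_left1; lra.
    + specialize (Hd' c). rewrite Rabs_left in Hd' by lra. specialize (Hd' ltac:(lra)).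
      specialize (Hmax (t0 - e)). rewrite Rabs_left in Hmax by lra. specialize (Hmax ltac:(lra)).
      apply Rabs_le_between in Hd'.
      assert (0 < l * (t0 - c)) by (apply Rmult_lt_0_compat; lra).
      assert (f1 c < 0) by lra. nra.
Qed.

Lemma is_derive_sqr (g : R -> R) (t l : R) :
  is_derive g t l -> is_derive (fun u => g u * g u) t (2 * (g t * l)).
Proof.
  intros H. evar_last; [apply (is_derive_mult g g t l l H H); intros; apply Rmult_comm|].
  unfold plus, mult; simpl; unfold plus, mult; simpl. ring.
Qed.

Lemma is_derive_prod (g h : R -> R) (t l m : R) :
  is_derive g t l -> is_derive h t m -> is_derive (fun u => g u * h u) t (l * h t + g t * m).
Proof. intros H H'. exact (is_derive_mult g h t l m H H' Rmult_comm). Qed.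

(* The Laplacian of |G|^2 is 4|G'|^2 >= 0, so |G|^2 + eps x^2 has no interior maximum. *)
Lemma no_interior_max (G G1 G2 : C -> C) (z0 : C) (eps r : R) :
  0 < eps -> 0 < r ->
  (forall w, Cmod (w - z0) < r -> Cderiv G w (G1 w) /\ Cderiv G1 w (G2 w)) ->
  ~ (forall w, Cmod (w - z0) < r ->
       Cmod (G w) ^ 2 + eps * (Re w * Re w) <= Cmod (G z0) ^ 2 + eps * (Re z0 * Re z0)).
Proof.
  intros He Hr HG Hmax.
  set (U := fun (b : C) (t : R) => let w := (z0 + RtoC t * b)%C in
     Re (G w) * Re (G w) + Im (G w) * Im (G w) + eps * (Re w * Re w)).
  set (U1 := fun (b : C) (t : R) => let w := (z0 + RtoC t * b)%C in
     2 * (Re (G w) * Re (G1 w * b)%C) + 2 * (Im (G w) * Im (G1 w * b)%C) + eps * (2 * (Re w * Re b))).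
  assert (Hd0 : forall b, Cmod b = 1 -> forall t, Rabs (t - 0) < r ->
     Cmod (z0 + RtoC t * b - z0) < r).
  { intros b Hb t Ht. replace (z0 + RtoC t * b - z0)%C with (RtoC t * b)%C by ring.
    rewrite Cmod_mult, Hb, Cmod_R. rewrite Rminus_0_r in Ht. lra. }
  assert (Hre : forall b t, is_derive (fun t => Re (z0 + RtoC t * b)%C) t (Re b)).
  { intros b t. evar_last; [apply (Cderiv_line_Re (fun w => w) z0 b t 1), Cderiv_id|].
    f_equal. ring. }
  assert (H2 : forall b, Cmod b = 1 ->
     2 * (Re (G1 z0 * b)%C * Re (G1 z0 * b)%C + Re (G z0) * Re (G2 z0 * b * b)%C)
     + 2 * (Im (G1 z0 * b)%C * Im (G1 z0 * b)%C + Im (G z0) * Im (G2 z0 * b * b)%C)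
     + eps * (2 * (Re b * Re b)) <= 0).
  { intros b Hb. 
    assert (E0 : (z0 + 0 * b)%C = z0) by ring.
    apply (second_derivative_test (U b) (U1 b) 0 _ r Hr).
    - intros t Ht. destruct (HG _ (Hd0 b Hb t Ht)) as [A _]. unfold U, U1.
      apply (is_derive_plus (K := R_AbsRing) (V := R_NormedModule)).
      + apply (is_derive_plus (K := R_AbsRing) (V := R_NormedModule)).
        * apply (is_derive_sqr (fun t => Re (G (z0 + RtoC t * b)%C))). apply Cderiv_line_Re. exact A.
        * apply (is_derive_sqr (fun t => Im (G (z0 + RtoC t * b)%C))). apply Cderiv_line_Im. exact A.
      + apply is_derive_scal. apply (is_derive_sqr (fun t => Re (z0 + RtoC t * b)%C)). apply Hre.
    - destruct (HG z0) as [A B].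
      { replace (z0 - z0)%C with (RtoC 0) by ring. rewrite Cmod_0. exact Hr. }
      assert (A' : Cderiv G (z0 + RtoC 0 * b)%C (G1 z0)) by (rewrite E0; exact A).
      assert (B' : Cderiv (fun w => G1 w * b)%C (z0 + RtoC 0 * b)%C (G2 z0 * b)%C).
      { rewrite E0. apply (Cderiv_ext (fun w => b * G1 w)%C); [intros; ring|].
        eapply Cderiv_eq; [apply Cderiv_scal; exact B|ring]. }
      unfold U1.
      apply (is_derive_plus (K := R_AbsRing) (V := R_NormedModule)).
      + apply (is_derive_plus (K := R_AbsRing) (V := R_NormedModule)).
        * apply is_derive_scal. evar_last.
          { apply (is_derive_prod (fun t => Re (G (z0 + RtoC t * b)%C)) (fun t => Re (G1 (z0 + RtoC t * b)%C * b)%C)).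
            - apply Cderiv_line_Re. exact A'.
            - apply (Cderiv_line_Re (fun w => G1 w * b)%C). exact B'. }
          cbv beta. rewrite E0. reflexivity.
        * apply is_derive_scal. evar_last.
          { apply (is_derive_prod (fun t => Im (G (z0 + RtoC t * b)%C)) (fun t => Im (G1 (z0 + RtoC t * b)%C * b)%C)).
            - apply Cderiv_line_Im. exact A'.
            - apply (Cderiv_line_Im (fun w => G1 w * b)%C). exact B'. }
          cbv beta. rewrite E0. reflexivity.
      + apply is_derive_scal, is_derive_scal. evar_last.
        { apply (is_derive_prod (fun t => Re (z0 + RtoC t * b)%C) (fun _ => Re b)).
          - apply Hre.
          - apply (is_derive_const (K := R_AbsRing) (V := R_NormedModule)). }
        unfold zero; simpl. ring.
    - intros t Ht. unfold U. rewrite E0. specialize (Hmax _ (Hd0 b Hb t Ht)).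
      rewrite !Cmod2_alt in Hmax. lra. }
  (* The second derivatives in the directions 1 and i are added: the terms with [G2] cancel as 1 +
     i^2 = 0, and 4 |G1 z0|^2 + 2 eps <= 0 is absurd. *)
  pose proof (H2 1 Cmod_1) as X. pose proof (H2 Ci Cmod_Ci) as Y.
  destruct (G z0) as [g g'], (G1 z0) as [h h'], (G2 z0) as [k k']. simpl in X, Y. nra.
Qed.

Lemma polar_form (z : C) : z <> 0 ->
  exists y, 0 <= y <= 2 * PI /\ z = cexp (ln (Cmod z), y).
Proof.
  intros Hz. pose proof (proj1 (Cmod_gt_0 z) Hz) as Hm. pose proof PI_RGT_0 as HP.
  set (m := Cmod z) in *. set (x := Re z / m). set (v := Im z / m).
  assert (Hxv : x * x + v * v = 1).
  { pose proof (Cmod2_alt z) as E. fold m in E. unfold x, v. field_simplify; [|lra].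
    replace (Re z ^ 2 + Im z ^ 2) with (m ^ 2). field. lra. }
  assert (Hx : -1 <= x <= 1) by (pose proof (Rle_0_sqr v); unfold Rsqr in *; split; apply Rnot_lt_le; intros Hn; nra).
  assert (Hs : sin (acos x) = Rabs v).
  { rewrite sin_acos by exact Hx. rewrite <- sqrt_Rsqr_abs. f_equal. unfold Rsqr. lra. }
  pose proof (acos_bound x) as Hb. pose proof (cos_acos x Hx) as Hc.
  assert (Hex : exists y, 0 <= y <= 2 * PI /\ cos y = x /\ sin y = v).
  { destruct (Rle_dec 0 v) as [H0|H0].
    - exists (acos x). rewrite Hs, Rabs_right by lra. repeat split; lra.
    - exists (- acos x + 2 * PI).
      rewrite cos_plus, sin_plus, cos_2PI, sin_2PI, cos_neg, sin_neg, Hs, Hc, Rabs_left by lra.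
      repeat split; lra. }
  destruct Hex as [y [Hy [Ec Es]]]. exists y. split; [exact Hy|].
  unfold cexp. simpl. rewrite exp_ln, Ec, Es by exact Hm.
  apply C_ext; simpl; unfold x, v; field; lra.
Qed.

(** Periodicity of |G| makes the strip compact in effect and removes its horizontal boundary. The
    perturbation eps x^2 that excludes interior maxima costs at most eps K and disappears with
    eps. *)
Lemma strip_max_principle (G G1 G2 : C -> C) (a b M : R) :
  a <= b -> 0 <= M ->
  (forall w, a <= Re w <= b -> Cderiv G w (G1 w) /\ Cderiv G1 w (G2 w)) ->
  (forall x y, Cmod (G (x, y + 2 * PI)) = Cmod (G (x, y))) ->
  (forall y, Cmod (G (a, y)) <= M) -> (forall y, Cmod (G (b, y)) <= M) ->
  forall x y, a <= x <= b -> 0 <= y <= 2 * PI -> Cmod (G (x, y)) <= M.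
Proof.
  intros Hab HM HG Hper Ha Hb x y Hx Hy. pose proof PI_RGT_0 as HP.
  set (K := a * a + b * b).
  assert (HK : 0 <= K) by (unfold K; nra).
  assert (Hx2 : forall u, a <= u <= b -> u * u <= K) by (intros u Hu; unfold K; destruct (Rle_dec 0 u); nra).
  assert (Heps : forall eps, 0 < eps -> Cmod (G (x, y)) ^ 2 <= M ^ 2 + eps * K).
  { intros eps He.
    set (u := fun w : C => Cmod (G w) ^ 2 + eps * (Re w * Re w)).
    (* Two periods, so that a maximum on a horizontal edge has a translate of the same height in the
       interior. *)
    destruct (CRcont_max u a b 0 (4 * PI)) as [z0 [Hz0 Hmax]]; [lra|lra| |].
    - intros w Hw. apply (proj1 (box_le a b 0 (4 * PI) w Hab ltac:(lra))) in Hw.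
      destruct (HG w) as [A _]; [lra|].
      assert (HC : Ccont (fun w => RtoC (u w)) w).
      { assert (E : forall w, RtoC (u w) = (RtoC (Cmod (G w)) * RtoC (Cmod (G w)) + RtoC eps * (RtoC (Re w) * RtoC (Re w)))%C).
        { intros v. unfold u. rewrite <- !RtoC_mult, <- RtoC_plus. f_equal. ring. }
        assert (Hplus : forall f g v, Ccont f v -> Ccont g v -> Ccont (fun w => f w + g w)%C v).
        { intros f g v Hf Hg e Hep. destruct (Hf (e / 2) ltac:(lra)) as [d1 [Hd1 H1]].
          destruct (Hg (e / 2) ltac:(lra)) as [d2 [Hd2 H2]].
          exists (Rmin d1 d2). split; [apply Rmin_case; assumption|]. intros t Ht.
          specialize (H1 t (Rlt_le_trans _ _ _ Ht (Rmin_l _ _))).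
          specialize (H2 t (Rlt_le_trans _ _ _ Ht (Rmin_r _ _))).
          replace (f t + g t - (f v + g v))%C with ((f t - f v) + (g t - g v))%C by ring.
          eapply Rle_lt_trans; [apply Cmod_triangle|]. lra. }
        assert (HR : forall v, Ccont (fun w => RtoC (Re w)) v).
        { intros v e Hep. exists e. split; [exact Hep|]. intros t Ht.
          rewrite <- RtoC_minus, Cmod_R. eapply Rle_lt_trans; [|exact Ht].
          apply (re_le_Cmod (t - v)). }
        assert (HN : Ccont (fun w => RtoC (Cmod (G w))) w).
        { intros e Hep. destruct (Ccont_CRcont_Cmod G w (Cderiv_Ccont _ _ _ A) e Hep) as [d [Hd H1]].
          exists d. split; [exact Hd|]. intros t Ht. rewrite <- RtoC_minus, Cmod_R. auto. }
        intros e Hep.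
        destruct (Hplus _ _ w (Ccont_mult _ _ w HN HN)
          (Ccont_mult (fun _ => RtoC eps) _ w (Cderiv_Ccont _ _ _ (Cderiv_const _ _))
             (Ccont_mult _ _ w (HR w) (HR w))) e Hep) as [d [Hd H1]].
        exists d. split; [exact Hd|]. intros t Ht. rewrite !E. apply H1, Ht. }
      intros e Hep. destruct (HC e Hep) as [d [Hd H1]]. exists d. split; [exact Hd|].
      intros t Ht. specialize (H1 t Ht). rewrite <- RtoC_minus, Cmod_R in H1. exact H1.
    - apply (proj1 (box_le a b 0 (4 * PI) z0 Hab ltac:(lra))) in Hz0.
      assert (Hxy : u (x, y) <= u z0) by (apply Hmax, box_le; simpl; lra).
      assert (Hux : Cmod (G (x, y)) ^ 2 <= u (x, y)) by (unfold u; nra).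
      enough (u z0 <= M ^ 2 + eps * K) by lra.
      (* shift the maximum point by a period to make its ordinate interior *)
      assert (Hsh : exists y1, 0 < y1 < 4 * PI /\ u (Re z0, y1) = u z0).
      { destruct z0 as [x0 y0]. simpl in Hz0. unfold u. simpl.
        destruct (Rlt_dec y0 PI).
        - exists (y0 + 2 * PI). rewrite Hper. split; [lra|reflexivity].
        - destruct (Rlt_dec (3 * PI) y0).
          + exists (y0 - 2 * PI). split; [lra|].
            rewrite <- (Hper x0 (y0 - 2 * PI)). replace (y0 - 2 * PI + 2 * PI) with y0 by ring. reflexivity.
          + exists y0. split; [lra|reflexivity]. }
      destruct Hsh as [y1 [Hy1 E1]]. rewrite <- E1. set (x0 := Re z0) in *.
      assert (Hbd : forall v, v = a \/ v = b -> u (v, y1) <= M ^ 2 + eps * K).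
      { intros v Hv. unfold u. simpl Re.
        assert (Cmod (G (v, y1)) <= M) by (destruct Hv; subst v; auto).
        pose proof (Cmod_ge_0 (G (v, y1))).
        assert (v * v <= K) by (apply Hx2; destruct Hv; subst v; lra).
        assert (Cmod (G (v, y1)) ^ 2 <= M ^ 2) by (apply pow_incr; lra).
        apply Rplus_le_compat; [assumption|]. apply Rmult_le_compat_l; lra. }
      destruct (Req_dec x0 a) as [Ea|Ea]; [rewrite Ea; auto|].
      destruct (Req_dec x0 b) as [Eb|Eb]; [rewrite Eb; auto|].
      exfalso.
      set (r := Rmin (Rmin (x0 - a) (b - x0)) (Rmin y1 (4 * PI - y1))).
      assert (Hr : 0 < r) by (unfold r; repeat apply Rmin_case; lra).
      assert (Hin : forall w, Cmod (w - (x0, y1)) < r -> a <= Re w <= b /\ 0 <= Im w <= 4 * PI).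
      { intros w Hw. pose proof (re_le_Cmod (w - (x0, y1))) as A1.
        pose proof (im_le_Cmod (w - (x0, y1))) as A2.
        change (Re (w - (x0, y1))) with (Re w - x0) in A1.
        change (Im (w - (x0, y1))) with (Im w - y1) in A2.
        assert (A3 : Rabs (Re w - x0) < r) by lra. assert (A4 : Rabs (Im w - y1) < r) by lra.
        apply Rabs_lt_between in A3. apply Rabs_lt_between in A4.
        assert (r <= x0 - a) by (unfold r; eapply Rle_trans; [apply Rmin_l|apply Rmin_l]).
        assert (r <= b - x0) by (unfold r; eapply Rle_trans; [apply Rmin_l|apply Rmin_r]).
        assert (r <= y1) by (unfold r; eapply Rle_trans; [apply Rmin_r|apply Rmin_l]).
        assert (r <= 4 * PI - y1) by (unfold r; eapply Rle_trans; [apply Rmin_r|apply Rmin_r]).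
        lra. }
      apply (no_interior_max G G1 G2 (x0, y1) eps r He Hr).
      + intros w Hw. apply HG. apply (Hin w Hw).
      + intros w Hw. destruct (Hin w Hw) as [B1 B2].
        change (u w <= u (x0, y1)). rewrite E1. apply Hmax, box_le; lra. }
  apply Rnot_lt_le. intros Hlt.
  assert (Hsq : M ^ 2 < Cmod (G (x, y)) ^ 2) by nra.
  set (D := Cmod (G (x, y)) ^ 2 - M ^ 2).
  specialize (Heps (D / (2 * (K + 1))) ltac:(apply Rdiv_lt_0_compat; unfold D; lra)).
  assert (D / (2 * (K + 1)) * K <= D / 2).
  { apply Rmult_le_reg_r with (2 * (K + 1)); [lra|].
    replace (D / (2 * (K + 1)) * K * (2 * (K + 1))) with (D * K) by (field; lra).
    unfold D in *. nra. }
  unfold D in *. lra.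
Qed.

(** The regularity that the second derivative test consumes, in a form stable under the operations
    used below; it spares a proof that holomorphic functions on a domain are infinitely
    differentiable. *)
Definition twice_diff (D : C -> Prop) (f : C -> C) : Prop :=
  exists f1 f2, forall z, D z -> Cderiv f z (f1 z) /\ Cderiv f1 z (f2 z).

Lemma twice_diff_sub (D D' : C -> Prop) (f : C -> C) :
  (forall z, D' z -> D z) -> twice_diff D f -> twice_diff D' f.
Proof. intros H (f1 & f2 & Hf). exists f1, f2. auto. Qed.

Lemma twice_diff_const (D : C -> Prop) (c : C) : twice_diff D (fun _ => c).
Proof. exists (fun _ => RtoC 0), (fun _ => RtoC 0). intros z _. split; apply Cderiv_const. Qed.

Lemma twice_diff_affine (D : C -> Prop) (p q : C) : twice_diff D (fun z => p + q * z)%C.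
Proof.
  exists (fun _ => q), (fun _ => RtoC 0). intros z _. split; [|apply Cderiv_const].
  eapply Cderiv_eq.
  - apply Cderiv_plus; [apply Cderiv_const|apply Cderiv_scal, Cderiv_id].
  - ring.
Qed.

Lemma twice_diff_cexp (D : C -> Prop) : twice_diff D cexp.
Proof. exists cexp, cexp. intros z _. split; apply Cderiv_cexp. Qed.

Lemma twice_diff_minus (D : C -> Prop) (f g : C -> C) :
  twice_diff D f -> twice_diff D g -> twice_diff D (fun z => f z - g z)%C.
Proof.
  intros (f1 & f2 & Hf) (g1 & g2 & Hg).
  exists (fun z => f1 z - g1 z)%C, (fun z => f2 z - g2 z)%C. intros z Hz.
  destruct (Hf z Hz), (Hg z Hz). split; apply Cderiv_minus; assumption.
Qed.

Lemma twice_diff_mult (D : C -> Prop) (f g : C -> C) :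
  twice_diff D f -> twice_diff D g -> twice_diff D (fun z => f z * g z)%C.
Proof.
  intros (f1 & f2 & Hf) (g1 & g2 & Hg).
  exists (fun z => f1 z * g z + f z * g1 z)%C,
    (fun z => (f2 z * g z + f1 z * g1 z) + (f1 z * g1 z + f z * g2 z))%C. intros z Hz.
  destruct (Hf z Hz), (Hg z Hz).
  split; [apply Cderiv_mult; assumption|apply Cderiv_plus; apply Cderiv_mult; assumption].
Qed.

Lemma twice_diff_comp (D D' : C -> Prop) (f g : C -> C) :
  twice_diff D' f -> twice_diff D g -> (forall z, D z -> D' (g z)) ->
  twice_diff D (fun z => f (g z)).
Proof.
  intros (f1 & f2 & Hf) (g1 & g2 & Hg) HD.
  exists (fun z => f1 (g z) * g1 z)%C,
    (fun z => (f2 (g z) * g1 z) * g1 z + f1 (g z) * g2 z)%C. intros z Hz.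
  destruct (Hf (g z) (HD z Hz)), (Hg z Hz).
  split; [apply Cderiv_comp; assumption|].
  apply (Cderiv_mult (fun z => f1 (g z)) g1); [apply (Cderiv_comp f1 g); assumption|assumption].
Qed.

Lemma twice_diff_Cinv : twice_diff (fun z => z <> 0) Cinv.
Proof.
  exists (fun z => - / (z * z))%C, (fun z => 2 * / (z * z * z))%C. intros z Hz.
  split; [apply Cderiv_Cinv; exact Hz|].
  apply (Cderiv_ext (fun z => 0 - / (z * z))%C); [intros; ring|].
  eapply Cderiv_eq.
  - apply Cderiv_minus; [apply Cderiv_const|].
    apply (Cderiv_inv (fun z => z * z)%C); [apply Cmult_neq_0; exact Hz|apply Cderiv_sqr].
  - field. exact Hz.
Qed.

(** In the coordinate z = z0 + e^w the function |f(z)| |z - z0|^(-al) is the modulus of f(z) e^(-al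
    w). That modulus is 2 pi i-periodic even for non-integral al, which is why the strip principle
    asks for periodicity of |G| only. *)
Lemma annulus_max_principle (f : C -> C) (D : C -> Prop) (z0 : C) (r1 r3 al M : R) :
  0 < r1 -> 0 <= M -> twice_diff D f ->
  (forall z, r1 <= Cmod (z - z0) <= r3 -> D z) ->
  (forall z, Cmod (z - z0) = r1 -> Cmod (f z) <= M * exp (al * ln r1)) ->
  (forall z, Cmod (z - z0) = r3 -> Cmod (f z) <= M * exp (al * ln r3)) ->
  forall z, r1 <= Cmod (z - z0) <= r3 -> Cmod (f z) <= M * exp (al * ln (Cmod (z - z0))).
Proof.
  intros Hr1 HM Hf HD H1 H3 z Hz.
  assert (Hr3 : 0 < r3) by lra.
  set (G := fun w => (f (z0 + cexp w) * cexp (0 + - RtoC al * w))%C).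
  assert (Hmod : forall x y, Cmod (z0 + cexp (x, y) - z0) = exp x).
  { intros x y. replace (z0 + cexp (x, y) - z0)%C with (cexp (x, y)) by ring. apply Cmod_cexp. }
  assert (HGmod : forall x y, Cmod (G (x, y)) = Cmod (f (z0 + cexp (x, y))%C) * exp (- (al * x))).
  { intros x y. unfold G. rewrite Cmod_mult, Cmod_cexp. f_equal. f_equal. simpl. ring. }
  assert (HG : twice_diff (fun w => ln r1 <= Re w <= ln r3) G).
  { apply twice_diff_mult.
    - apply (twice_diff_comp _ D f (fun w => z0 + cexp w)%C); [exact Hf| |].
        destruct (twice_diff_comp (fun w => ln r1 <= Re w <= ln r3) (fun _ => True)
          (fun u => z0 + 1 * u)%C cexp (twice_diff_affine _ _ _) (twice_diff_cexp _) (fun _ _ => I))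
          as (g1 & g2 & Hg).
        exists g1, g2. intros w Hw. destruct (Hg w Hw) as [A B]. split; [|exact B].
        eapply Cderiv_ext; [|exact A]. intros v; cbv beta; ring.
      + intros [x y] Hw. simpl in Hw. apply HD. rewrite Hmod. split.
        * rewrite <- (exp_ln r1) by exact Hr1.
          destruct (Rle_lt_or_eq_dec _ _ (proj1 Hw)) as [h|h]; [left; apply exp_increasing; exact h|right; rewrite h; reflexivity].
        * rewrite <- (exp_ln r3) by exact Hr3.
          destruct (Rle_lt_or_eq_dec _ _ (proj2 Hw)) as [h|h]; [left; apply exp_increasing; exact h|right; rewrite h; reflexivity].
    - apply (twice_diff_comp _ (fun _ => True) cexp (fun w => 0 + - RtoC al * w)%C);
        [apply twice_diff_cexp|apply twice_diff_affine|trivial]. }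
  destruct HG as (G1 & G2 & HG).
  assert (Hln : ln r1 <= ln (Cmod (z - z0)) <= ln r3).
  { split; apply ln_le; lra. }
  assert (Hbd : forall r, 0 < r -> (forall z, Cmod (z - z0) = r -> Cmod (f z) <= M * exp (al * ln r)) ->
     forall y, Cmod (G (ln r, y)) <= M).
  { intros r Hr Hfr y. rewrite HGmod.
    specialize (Hfr (z0 + cexp (ln r, y))%C).
    rewrite Hmod, exp_ln in Hfr by exact Hr. specialize (Hfr eq_refl).
    apply (Rmult_le_compat_r (exp (- (al * ln r)))) in Hfr; [|left; apply exp_pos].
    rewrite Rmult_assoc, <- exp_plus, Rplus_opp_r, exp_0, Rmult_1_r in Hfr. exact Hfr. }
  assert (Hz0 : (z - z0)%C <> 0) by (apply Cmod_gt_0; lra).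
  destruct (polar_form (z - z0) Hz0) as [y [Hy E]].
  pose proof (strip_max_principle G G1 G2 (ln r1) (ln r3) M ltac:(lra) HM HG) as HS.
  specialize (HS ltac:(intros x' y'; rewrite !HGmod, cexp_2PI; reflexivity)
    (Hbd r1 Hr1 H1) (Hbd r3 Hr3 H3) (ln (Cmod (z - z0))) y Hln Hy).
  rewrite HGmod, <- E in HS. replace (z0 + (z - z0))%C with z in HS by ring.
  apply (Rmult_le_compat_r (exp (al * ln (Cmod (z - z0))))) in HS; [|left; apply exp_pos].
  rewrite Rmult_assoc, <- exp_plus, Rplus_opp_l, exp_0, Rmult_1_r in HS. exact HS.
Qed.

Lemma exp_le_compat (x y : R) : x <= y -> exp x <= exp y.
Proof. intros [H| ->]; [left; apply exp_increasing; exact H|right; reflexivity]. Qed.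

Lemma three_circles (f : C -> C) (D : C -> Prop) (z0 : C) (r1 r3 M X : R) :
  0 < r1 < r3 -> 0 < M -> 0 < X -> twice_diff D f ->
  (forall z, r1 <= Cmod (z - z0) <= r3 -> D z) ->
  (forall z, Cmod (z - z0) = r1 -> Cmod (f z) <= M) ->
  (forall z, Cmod (z - z0) = r3 -> Cmod (f z) <= M * X) ->
  forall z, r1 <= Cmod (z - z0) <= r3 ->
    Cmod (f z) <= M * exp (ln (Cmod (z - z0) / r1) / ln (r3 / r1) * ln X).
Proof.
  intros Hr HM HX Hf HD H1 H3 z Hz.
  (* The exponent for which r^al grows by exactly X from r1 to r3, so that both boundary bounds take
     the same form. *)
  set (al := ln X / ln (r3 / r1)).
  assert (Hl : 0 < ln (r3 / r1)).
  { rewrite <- ln_1. apply ln_increasing; [lra|]. apply Rmult_lt_reg_r with r1; [lra|].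
    unfold Rdiv. rewrite Rmult_assoc, Rinv_l; lra. }
  assert (Hdiv : forall r, 0 < r -> ln (r / r1) = ln r - ln r1).
  { intros r Hr'. unfold Rdiv. rewrite ln_mult, ln_Rinv by (try apply Rinv_0_lt_compat; lra). ring. }
  pose proof (annulus_max_principle f D z0 r1 r3 al (M * exp (- (al * ln r1)))) as HA.
  specialize (HA ltac:(lra)).
  assert (HM' : 0 <= M * exp (- (al * ln r1))) by (apply Rmult_le_pos; [lra|left; apply exp_pos]).
  specialize (HA HM' Hf HD).
  assert (E1 : M * exp (- (al * ln r1)) * exp (al * ln r1) = M)
    by (rewrite Rmult_assoc, <- exp_plus, Rplus_opp_l, exp_0; ring).
  assert (E3 : M * exp (- (al * ln r1)) * exp (al * ln r3) = M * X).
  { rewrite Rmult_assoc, <- exp_plus. f_equal. rewrite <- (exp_ln X) at 1 by exact HX. f_equal.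
    unfold al. rewrite Hdiv in * by lra. field. lra. }
  rewrite E1, E3 in HA. specialize (HA H1 H3 z Hz).
  eapply Rle_trans; [exact HA|]. right. rewrite Rmult_assoc, <- exp_plus. f_equal. f_equal.
  unfold al. rewrite (Hdiv (Cmod (z - z0))) by lra. field. lra.
Qed.

(** Division by z - z0 would require a removable singularity. Instead the annulus principle is used
    with exponent 1 - eps: near z0 the bound |f| <= L r beats a multiple of r^(1 - eps) on a small
    enough inner circle. Then eps tends to 0. *)
Lemma schwarz (f : C -> C) (z0 : C) (R0 M : R) :
  0 < R0 -> 0 < M -> twice_diff (fun z => Cmod (z - z0) < R0) f -> f z0 = 0 ->
  (forall z, Cmod (z - z0) < R0 -> Cmod (f z) <= M) ->
  forall z, Cmod (z - z0) < R0 -> Cmod (f z) <= M * (Cmod (z - z0) / R0).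
Proof.
  intros HR HM Hf Hf0 HfM z Hz.
  destruct (Req_dec (Cmod (z - z0)) 0) as [E|E].
  { assert (Ez : z = z0).
    { apply Cmod_eq_0 in E. replace z with (z - z0 + z0)%C by ring. rewrite E. ring. }
    rewrite E, Ez, Hf0, Cmod_0. unfold Rdiv. rewrite Rmult_0_l. lra. }
  set (rho := Cmod (z - z0)) in *.
  assert (Hrho : 0 < rho) by (pose proof (Cmod_ge_0 (z - z0)); unfold rho in *; lra).
  set (X := ln R0 - ln rho).
  assert (HX : 0 < X) by (unfold X; pose proof (ln_increasing rho R0 Hrho Hz); lra).
  assert (Hlip : exists L d, 0 < L /\ 0 < d /\ forall w, Cmod (w - z0) < d -> Cmod (f w) <= L * Cmod (w - z0)).
  { destruct Hf as (f1 & f2 & Hf). destruct (Hf z0) as [A _].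
    { replace (z0 - z0)%C with (RtoC 0) by ring. rewrite Cmod_0. exact HR. }
    destruct (Cderiv_lipschitz f z0 _ A) as [d [Hd H]].
    exists (Cmod (f1 z0) + 1), d. pose proof (Cmod_ge_0 (f1 z0)).
    split; [lra|]. split; [exact Hd|]. intros w Hw. specialize (H w Hw).
    rewrite Hf0 in H. replace (f w - 0)%C with (f w) in H by ring. exact H. }
  destruct Hlip as (L & d & HL & Hd & Hlip).
  assert (Heps : forall eps, 0 < eps < 1 -> Cmod (f z) <= M * exp (- ((1 - eps) * ((1 - eps) * X)))).
  { intros eps He.
    (* The outer radius stays below R0, since f is only known on the open disc. *)
    set (x3 := ln rho + (1 - eps) * X). set (r3 := exp x3).
    assert (Hx3 : ln rho < x3 < ln R0).
    { split; [unfold x3; pose proof (Rmult_lt_0_compat (1 - eps) X); lra|].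
      replace (ln R0) with (ln rho + X) by (unfold X; ring). unfold x3. nra. }
    assert (Hr3a : rho < r3) by (rewrite <- (exp_ln rho) by exact Hrho; apply exp_increasing; lra).
    assert (Hr3b : r3 < R0) by (rewrite <- (exp_ln R0) by exact HR; apply exp_increasing; lra).
    set (M1 := M * exp (- ((1 - eps) * x3))).
    assert (HM1 : 0 < M1) by (apply Rmult_lt_0_compat; [exact HM|apply exp_pos]).
    (* In order: the inner circle must not enclose z, must lie where the Lipschitz bound holds, and
       must satisfy r1^eps <= M1 / L. *)
    set (x1 := Rmin (ln rho) (Rmin (ln d - 1) (ln (M1 / L) / eps))).
    assert (A1 : x1 <= ln rho) by apply Rmin_l.
    assert (A2 : x1 <= ln d - 1) by (unfold x1; eapply Rle_trans; [apply Rmin_r|apply Rmin_l]).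
    assert (A3 : x1 <= ln (M1 / L) / eps) by (unfold x1; eapply Rle_trans; [apply Rmin_r|apply Rmin_r]).
    set (r1 := exp x1).
    assert (Hr1 : 0 < r1) by apply exp_pos.
    assert (Hr1a : r1 <= rho) by (rewrite <- (exp_ln rho) by exact Hrho; apply exp_le_compat; lra).
    assert (Hr1d : r1 < d) by (rewrite <- (exp_ln d) by exact Hd; apply exp_increasing; lra).
    assert (Hr1e : L * r1 <= M1 * exp ((1 - eps) * ln r1)).
    { unfold r1. rewrite ln_exp.
      assert (A4 : eps * x1 <= ln (M1 / L)).
      { apply (Rmult_le_compat_l eps) in A3; [|lra].
        replace (eps * (ln (M1 / L) / eps)) with (ln (M1 / L)) in A3 by (field; lra). exact A3. }
      apply exp_le_compat in A4. rewrite exp_ln in A4 by (apply Rdiv_lt_0_compat; assumption).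
      replace x1 with (eps * x1 + (1 - eps) * x1) at 1 by ring. rewrite exp_plus, <- Rmult_assoc.
      apply Rmult_le_compat_r; [left; apply exp_pos|].
      apply (Rmult_le_compat_l L) in A4; [|lra].
      replace (L * (M1 / L)) with M1 in A4 by (field; lra). exact A4. }
    pose proof (annulus_max_principle f (fun z => Cmod (z - z0) < R0) z0 r1 r3 (1 - eps) M1
      Hr1 (Rlt_le _ _ HM1) Hf) as HA.
    specialize (HA ltac:(intros w Hw; cbv beta; lra)).
    specialize (HA ltac:(intros w Hw; eapply Rle_trans; [apply Hlip; lra|]; rewrite Hw; exact Hr1e)).
    assert (H3 : forall w, Cmod (w - z0) = r3 -> Cmod (f w) <= M1 * exp ((1 - eps) * ln r3)).
    { intros w Hw. unfold M1, r3. rewrite ln_exp, Rmult_assoc, <- exp_plus, Rplus_opp_l, exp_0, Rmult_1_r.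
      apply HfM. lra. }
    specialize (HA H3 z ltac:(fold rho; lra)). fold rho in HA.
    eapply Rle_trans; [exact HA|]. unfold M1. rewrite Rmult_assoc, <- exp_plus.
    right. f_equal. f_equal. unfold x3. ring. }
  assert (EX : rho / R0 = exp (- X)).
  { unfold X. rewrite Ropp_minus_distr. unfold Rminus. rewrite exp_plus, exp_Ropp, !exp_ln by assumption. reflexivity. }
  rewrite EX. apply Rnot_lt_le. intros Hlt.
  assert (HME : 0 < M * exp (- X)) by (apply Rmult_lt_0_compat; [exact HM|apply exp_pos]).
  set (k := ln (Cmod (f z)) - ln (M * exp (- X))).
  assert (Hk : 0 < k) by (unfold k; pose proof (ln_increasing _ _ HME Hlt); lra).
  assert (Hlnm : ln (M * exp (- X)) = ln M - X) by (rewrite ln_mult, ln_exp by (try apply exp_pos; lra); ring).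
  (* k is the logarithmic excess over the claim; the loss X - (1 - eps)^2 X is at most 2 eps X <= k
     / 2. *)
  set (eps := Rmin (1 / 2) (k / (4 * X))).
  assert (He : 0 < eps) by (unfold eps; apply Rmin_case; [lra|apply Rdiv_lt_0_compat; lra]).
  assert (He1 : eps <= 1 / 2) by apply Rmin_l.
  assert (He2 : eps * (4 * X) <= k).
  { apply Rle_trans with (k / (4 * X) * (4 * X)).
    - apply Rmult_le_compat_r; [lra|apply Rmin_r].
    - right. field. lra. }
  specialize (Heps eps ltac:(lra)).
  apply ln_le in Heps; [|lra].
  rewrite ln_mult, ln_exp in Heps by (try apply exp_pos; lra).
  unfold k in *. rewrite Hlnm in *. nra.
Qed.

Lemma borel_caratheodory (f : C -> C) (z0 : C) (R0 r A : R) :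
  0 <= r < R0 -> 0 < A -> twice_diff (fun z => Cmod (z - z0) < R0) f ->
  (forall z, Cmod (z - z0) < R0 -> Re (f z) <= A) ->
  forall z, Cmod (z - z0) <= r -> Cmod (f z) <= 2 * R0 / (R0 - r) * (A + Cmod (f z0)).
Proof.
  intros Hr HA Hf HfA z Hz.
  set (S := A + Cmod (f z0)).
  pose proof (Cmod_ge_0 (f z0)) as Hf0.
  assert (HS : 0 < S) by (unfold S; lra).
  set (g := fun z => (f z - f z0)%C).
  assert (Hg : forall w, Cmod (w - z0) < R0 -> Re (g w) <= S).
  { intros w Hw. specialize (HfA w Hw). pose proof (re_le_Cmod (f z0)) as H.
    apply Rabs_le_between in H. unfold g, S. change (Re (f w - f z0)) with (Re (f w) - Re (f z0)). lra. }
  assert (Hden : forall w, Cmod (w - z0) < R0 -> (2 * RtoC S - g w)%C <> 0).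
  { intros w Hw E. specialize (Hg w Hw). apply (f_equal Re) in E.
    destruct (g w) as [g1 g2]. simpl in E, Hg. lra. }
  (* The map u -> u / (2 S - u) sends the half plane Re u <= S into the closed unit disc and fixes
     0, so Schwarz's lemma applies. *)
  set (phi := fun w => (g w * / (2 * RtoC S - g w))%C).
  assert (Hgt : twice_diff (fun z => Cmod (z - z0) < R0) g)
    by (apply twice_diff_minus; [exact Hf|apply twice_diff_const]).
  assert (Hphi : twice_diff (fun z => Cmod (z - z0) < R0) phi).
  { apply twice_diff_mult; [exact Hgt|].
    apply (twice_diff_comp _ (fun z => z <> 0) Cinv (fun w => 2 * RtoC S - g w)%C);
      [apply twice_diff_Cinv| |exact Hden].
    apply twice_diff_minus; [apply twice_diff_const|exact Hgt]. }
  assert (HR : 0 < R0) by lra.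
  assert (Hz' : Cmod (z - z0) < R0) by lra.
  pose proof (schwarz phi z0 R0 1 HR Rlt_0_1 Hphi) as HSch.
  assert (E0 : phi z0 = 0) by (unfold phi, g; ring).
  assert (H1 : forall w, Cmod (w - z0) < R0 -> Cmod (phi w) <= 1).
  { intros w Hw. unfold phi. rewrite Cmod_mult, Cmod_inv by (apply Hden; exact Hw).
    assert (Hp : 0 < Cmod (2 * RtoC S - g w)) by (apply Cmod_gt_0, Hden; exact Hw).
    apply Rmult_le_reg_r with (Cmod (2 * RtoC S - g w)); [exact Hp|].
    rewrite Rmult_assoc, Rinv_l, Rmult_1_r, Rmult_1_l by lra.
    apply Rsqr_incr_0_var; [|lra].
    rewrite !Rsqr_pow2, !Cmod2_alt. specialize (Hg w Hw).
    destruct (g w) as [g1 g2]. simpl in *. nra. }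
  specialize (HSch E0 H1 z Hz'). rewrite Rmult_1_l in HSch.
  set (q := Cmod (z - z0) / R0) in *.
  assert (Hq0 : 0 <= q) by (apply Rdiv_le_0_compat; [apply Cmod_ge_0|exact HR]).
  assert (Hqr : q <= r / R0) by (apply Rmult_le_compat_r; [left; apply Rinv_0_lt_compat; exact HR|exact Hz]).
  assert (Hr1 : r / R0 < 1) by (apply Rmult_lt_reg_r with R0; [exact HR|]; unfold Rdiv; rewrite Rmult_assoc, Rinv_l; lra).
  assert (Eg : (g z * (1 + phi z))%C = (2 * RtoC S * phi z)%C).
  { unfold phi. field. apply Hden. exact Hz'. }
  assert (Hgz : Cmod (g z) * (1 - q) <= 2 * S * q).
  { apply (f_equal Cmod) in Eg. rewrite !Cmod_mult, !Cmod_R, !Rabs_right in Eg by lra.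
    assert (H1q : 1 - q <= Cmod (1 + phi z)).
    { pose proof (Cmod_triangle_inv 1 (- phi z)) as H. rewrite Cmod_1, Cmod_opp in H.
      replace (1 - - phi z)%C with (1 + phi z)%C in H by ring. lra. }
    apply Rle_trans with (Cmod (g z) * Cmod (1 + phi z)).
    - apply Rmult_le_compat_l; [apply Cmod_ge_0|exact H1q].
    - rewrite Eg. apply Rmult_le_compat_l; lra. }
  assert (Hfz : Cmod (f z) <= S + Cmod (g z)).
  { replace (f z) with (f z0 + g z)%C by (unfold g; ring).
    eapply Rle_trans; [apply Cmod_triangle|]. unfold S. lra. }
  (* |f z| (1 - q) <= S (1 - q) + 2 S q = S (1 + q), and q < 1. *)
  assert (Hfq : Cmod (f z) * (1 - q) <= 2 * S) by nra.
  replace (2 * R0 / (R0 - r) * S) with (2 * S / (1 - r / R0)) by (field; split; lra).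
  apply Rmult_le_reg_r with (1 - r / R0); [lra|].
  replace (2 * S / (1 - r / R0) * (1 - r / R0)) with (2 * S) by (field; lra).
  pose proof (Cmod_ge_0 (f z)). nra.
Qed.

(* Schwarz's lemma for the odd part (f (z0 + z) - f (z0 - z)) / 2, which vanishes at 0 and has
   derivative l there, gives the sharp constant. *)
Lemma cauchy_estimate (f : C -> C) (z0 l : C) (R0 M : R) :
  0 < R0 -> 0 < M -> twice_diff (fun z => Cmod (z - z0) < R0) f ->
  (forall z, Cmod (z - z0) < R0 -> Cmod (f z) <= M) -> Cderiv f z0 l -> Cmod l <= M / R0.
Proof.
  intros HR HM Hf HfM Hl.
  set (h := fun z => (/ 2 * (f (z0 + 1 * z) - f (z0 + - (1) * z)))%C).
  assert (Hm1 : forall z, Cmod (z0 + 1 * z - z0) = Cmod (z - 0)).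
  { intros z. f_equal. ring. }
  assert (Hm2 : forall z, Cmod (z0 + - (1) * z - z0) = Cmod (z - 0)).
  { intros z. rewrite <- Cmod_opp. f_equal. ring. }
  assert (Hh : twice_diff (fun z => Cmod (z - 0) < R0) h).
  { apply twice_diff_mult; [apply twice_diff_const|]. apply twice_diff_minus.
    - apply (twice_diff_comp _ _ f (fun z => z0 + 1 * z)%C Hf); [apply twice_diff_affine|].
      intros z Hz. rewrite Hm1. exact Hz.
    - apply (twice_diff_comp _ _ f (fun z => z0 + - (1) * z)%C Hf); [apply twice_diff_affine|].
      intros z Hz. rewrite Hm2. exact Hz. }
  assert (Hh0 : h 0 = 0).
  { unfold h. replace (z0 + 1 * 0)%C with z0 by ring. replace (z0 + - (1) * 0)%C with z0 by ring. ring. }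
  assert (HhM : forall z, Cmod (z - 0) < R0 -> Cmod (h z) <= M).
  { intros z Hz. unfold h. rewrite Cmod_mult, Cmod_inv by (intros E; apply RtoC_inj in E; lra).
    rewrite Cmod_R, Rabs_right by lra.
    pose proof (Cmod_triangle_minus (f (z0 + 1 * z)%C) (f (z0 + - (1) * z)%C)).
    pose proof (HfM (z0 + 1 * z)%C ltac:(rewrite Hm1; exact Hz)).
    pose proof (HfM (z0 + - (1) * z)%C ltac:(rewrite Hm2; exact Hz)). lra. }
  pose proof (schwarz h 0 R0 M HR HM Hh Hh0 HhM) as HS.
  assert (Hd : Cderiv h 0 l).
  { eapply Cderiv_eq.
    - unfold h. apply Cderiv_scal. apply Cderiv_minus.
      + apply (Cderiv_comp f (fun z => z0 + 1 * z)%C 0 l).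
        * replace (z0 + 1 * 0)%C with z0 by ring. exact Hl.
        * apply Cderiv_plus; [apply Cderiv_const|apply Cderiv_scal, Cderiv_id].
      + apply (Cderiv_comp f (fun z => z0 + - (1) * z)%C 0 l).
        * replace (z0 + - (1) * 0)%C with z0 by ring. exact Hl.
        * apply Cderiv_plus; [apply Cderiv_const|apply Cderiv_scal, Cderiv_id].
    - field. }
  apply le_epsilon. intros eps He.
  destruct (Hd eps He) as [d [Hd0 H]].
  set (t := Rmin d R0 / 2).
  assert (Ht : 0 < t) by (unfold t; pose proof (Rmin_case d R0 (fun x => 0 < x) Hd0 HR); lra).
  assert (Ht1 : t < d) by (unfold t in *; pose proof (Rmin_l d R0); lra).
  assert (Ht2 : t < R0) by (unfold t in *; pose proof (Rmin_r d R0); lra).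
  assert (Em : Cmod (RtoC t - 0) = t).
  { replace (RtoC t - 0)%C with (RtoC t) by ring. rewrite Cmod_R, Rabs_right; lra. }
  specialize (H (RtoC t)). rewrite Em in H. specialize (H Ht1).
  specialize (HS (RtoC t)). rewrite Em in HS. specialize (HS Ht2).
  rewrite Hh0 in H.
  assert (E : (l * RtoC t)%C = (h (RtoC t) - (h (RtoC t) - 0 - l * (RtoC t - 0)))%C) by ring.
  apply (f_equal Cmod) in E. rewrite Cmod_mult, Cmod_R, (Rabs_right t) in E by lra.
  pose proof (Cmod_triangle_minus (h (RtoC t)) (h (RtoC t) - 0 - l * (RtoC t - 0))).
  apply Rmult_le_reg_r with t; [exact Ht|].
  replace ((M / R0 + eps) * t) with (M * (t / R0) + eps * t) by (field; lra). lra.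
Qed.

(** * Dirichlet series and the Euler product *)

Definition climit (u : nat -> C) (l : C) : Prop :=
  forall eps, 0 < eps -> exists N, forall n, (N <= n)%nat -> Cmod (u n - l) < eps.

Lemma climit_unique (u : nat -> C) (l l' : C) : climit u l -> climit u l' -> l = l'.
Proof.
  intros H H'.
  assert (E : Cmod (l - l') = 0).
  { apply Rle_antisym; [|apply Cmod_ge_0]. apply le_epsilon. intros eps He.
    destruct (H (eps / 2) ltac:(lra)) as [N HN]. destruct (H' (eps / 2) ltac:(lra)) as [N' HN'].
    specialize (HN (N + N')%nat ltac:(lia)). specialize (HN' (N + N')%nat ltac:(lia)).
    rewrite Cmod_minus_sym in HN.
    replace (l - l')%C with ((l - u (N + N')%nat) + (u (N + N')%nat - l'))%C by ring.
    eapply Rle_trans; [apply Cmod_triangle|]. lra. }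
  apply Cmod_eq_0 in E. replace l with (l - l' + l')%C by ring. rewrite E. ring.
Qed.

Lemma climit_ext (u v : nat -> C) (l : C) : (forall n, u n = v n) -> climit u l -> climit v l.
Proof. intros E H eps He. destruct (H eps He) as [N HN]. exists N. intros n Hn. rewrite <- E. auto. Qed.

Lemma climit_const (c : C) : climit (fun _ => c) c.
Proof.
  intros eps He. exists 0%nat. intros n _. replace (c - c)%C with (RtoC 0) by ring. rewrite Cmod_0. exact He.
Qed.

Lemma climit_scal (c : C) (u : nat -> C) (l : C) : climit u l -> climit (fun n => c * u n)%C (c * l).
Proof.
  intros H eps He. pose proof (Cmod_ge_0 c) as Hc.
  destruct (H (eps / (Cmod c + 1))) as [N HN]; [apply Rdiv_lt_0_compat; lra|].
  exists N. intros n Hn. specialize (HN n Hn).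
  replace (c * u n - c * l)%C with (c * (u n - l))%C by ring. rewrite Cmod_mult.
  apply (Rmult_lt_compat_l (Cmod c + 1)) in HN; [|lra].
  replace ((Cmod c + 1) * (eps / (Cmod c + 1))) with eps in HN by (field; lra).
  pose proof (Cmod_ge_0 (u n - l)). lra.
Qed.

Lemma climit_minus (u v : nat -> C) (l l' : C) :
  climit u l -> climit v l' -> climit (fun n => u n - v n)%C (l - l').
Proof.
  intros H H' eps He.
  destruct (H (eps / 2) ltac:(lra)) as [N HN]. destruct (H' (eps / 2) ltac:(lra)) as [N' HN'].
  exists (N + N')%nat. intros n Hn. specialize (HN n ltac:(lia)). specialize (HN' n ltac:(lia)).
  replace (u n - v n - (l - l'))%C with ((u n - l) - (v n - l'))%C by ring.
  eapply Rle_lt_trans; [apply Cmod_triangle_minus|]. lra.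
Qed.

Lemma climit_subseq (u : nat -> C) (l : C) (k : nat -> nat) :
  (forall N, exists M, forall n, (M <= n)%nat -> (N <= k n)%nat) -> climit u l -> climit (fun n => u (k n)) l.
Proof.
  intros Hk H eps He. destruct (H eps He) as [N HN]. destruct (Hk N) as [M HM].
  exists M. intros n Hn. apply HN, HM, Hn.
Qed.

Lemma climit_Cmod_le (u : nat -> C) (l : C) (B : R) (N : nat) :
  climit u l -> (forall n, (N <= n)%nat -> Cmod (u n) <= B) -> Cmod l <= B.
Proof.
  intros H HB. apply le_epsilon. intros eps He. destruct (H eps He) as [N' HN].
  specialize (HN (N + N')%nat ltac:(lia)). specialize (HB (N + N')%nat ltac:(lia)).
  pose proof (Cmod_triangle_inv l (u (N + N')%nat)) as T. rewrite Cmod_minus_sym in T. lra.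
Qed.

Fixpoint csum (f : nat -> C) (n : nat) : C :=
  match n with O => 0 | S k => (csum f k + f (S k))%C end.

Fixpoint rsum (f : nat -> R) (n : nat) : R :=
  match n with O => 0 | S k => rsum f k + f (S k) end.

Lemma csum_ext (f g : nat -> C) (n : nat) :
  (forall k, (1 <= k <= n)%nat -> f k = g k) -> csum f n = csum g n.
Proof.
  induction n as [|n IH]; intros H; simpl; [reflexivity|].
  rewrite IH, H; [reflexivity|lia|]. intros k Hk. apply H. lia.
Qed.

Lemma csum_minus (f g : nat -> C) (n : nat) : csum (fun k => f k - g k)%C n = (csum f n - csum g n)%C.
Proof. induction n as [|n IH]; simpl; [ring|]. rewrite IH. ring. Qed.

Lemma Cmod_csum_diff_le (f : nat -> C) (g : nat -> R) (n k : nat) :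
  (forall i, (n < i)%nat -> Cmod (f i) <= g i) ->
  Cmod (csum f (n + k) - csum f n) <= rsum g (n + k) - rsum g n.
Proof.
  intros H. induction k as [|k IH].
  - rewrite Nat.add_0_r. replace (csum f n - csum f n)%C with (RtoC 0) by ring. rewrite Cmod_0. lra.
  - rewrite Nat.add_succ_r. simpl.
    replace (csum f (n + k) + f (S (n + k)) - csum f n)%C
      with ((csum f (n + k) - csum f n) + f (S (n + k)))%C by ring.
    eapply Rle_trans; [apply Cmod_triangle|]. specialize (H (S (n + k)) ltac:(lia)). lra.
Qed.

Lemma climit_csum_exists (f : nat -> C) (g : nat -> R) (B : R) :
  (forall n, (1 <= n)%nat -> Cmod (f n) <= g n) -> (forall n, rsum g n <= B) ->
  exists l, climit (csum f) l.
Proof.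
  intros Hf HB.
  assert (Hg : forall n, 0 <= g (S n)) by (intros n; eapply Rle_trans; [apply Cmod_ge_0|apply Hf; lia]).
  assert (Hex : ex_finite_lim_seq (rsum g)).
  { apply (ex_finite_lim_seq_incr _ B); [|exact HB]. intros n. simpl. specialize (Hg n). lra. }
  destruct Hex as [S0 HS].
  assert (HC : forall eps, 0 < eps -> exists N, forall n k, (N <= n)%nat -> Cmod (csum f (n + k) - csum f n) < eps).
  { intros eps He. apply is_lim_seq_spec in HS.
    destruct (HS (mkposreal (eps / 2) ltac:(lra))) as [N HN]. exists N. intros n k Hn.
    eapply Rle_lt_trans; [apply (Cmod_csum_diff_le f g); intros i Hi; apply Hf; lia|].
    pose proof (HN n Hn) as A1. pose proof (HN (n + k)%nat ltac:(lia)) as A2. simpl in A1, A2.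
    apply Rabs_lt_between in A1. apply Rabs_lt_between in A2. lra. }
  assert (HR : forall h : C -> R, (forall z, Rabs (h z) <= Cmod z) -> (forall z w, h (z - w)%C = h z - h w) ->
     exists l, is_lim_seq (fun n => h (csum f n)) (Finite l)).
  { intros h Hh1 Hh2. assert (Hc : ex_finite_lim_seq (fun n => h (csum f n))).
    { apply ex_lim_seq_cauchy_corr. intros eps. destruct (HC (eps / 2) ltac:(pose proof (cond_pos eps); lra)) as [N HN].
      exists N. intros n k Hn Hk.
      assert (X : forall i, (N <= i)%nat -> Rabs (h (csum f i) - h (csum f N)) < eps / 2).
      { intros i Hi. rewrite <- Hh2. eapply Rle_lt_trans; [apply Hh1|].
        replace i with (N + (i - N))%nat by lia. apply HN. lia. }
      pose proof (X n Hn) as A1. pose proof (X k Hk) as A2.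
      apply Rabs_lt_between in A1. apply Rabs_lt_between in A2. apply Rabs_lt_between. lra. }
    destruct Hc as [l Hl]. exists l. exact Hl. }
  destruct (HR Re re_le_Cmod ltac:(reflexivity)) as [a Ha].
  destruct (HR Im im_le_Cmod ltac:(reflexivity)) as [b Hb].
  exists (a, b). intros eps He.
  apply is_lim_seq_spec in Ha. apply is_lim_seq_spec in Hb.
  destruct (Ha (mkposreal (eps / 2) ltac:(lra))) as [N1 HN1].
  destruct (Hb (mkposreal (eps / 2) ltac:(lra))) as [N2 HN2].
  exists (N1 + N2)%nat. intros n Hn. specialize (HN1 n ltac:(lia)). specialize (HN2 n ltac:(lia)).
  simpl in HN1, HN2. eapply Rle_lt_trans; [apply Cmod_le_Re_Im|].
  change (Re (csum f n - (a, b))) with (Re (csum f n) - a).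
  change (Im (csum f n - (a, b))) with (Im (csum f n) - b). lra.
Qed.

(* n^(-s) *)
Definition nps (n : nat) (s : C) : C := cpow (INR n) (- s).

Lemma nps_mult (q k : nat) (s : C) : (1 <= q)%nat -> (1 <= k)%nat -> nps (q * k) s = (nps q s * nps k s)%C.
Proof.
  intros Hq Hk. unfold nps, cpow. rewrite <- cexp_plus. f_equal.
  rewrite mult_INR, ln_mult by (apply lt_0_INR; lia). rewrite RtoC_plus. ring.
Qed.

Lemma Cmod_nps (n : nat) (s : C) : (1 <= n)%nat -> Cmod (nps n s) = exp (- (Re s * ln (INR n))).
Proof. intros Hn. unfold nps, cpow. rewrite Cmod_cexp. f_equal. unfold Re; simpl. ring. Qed.

Lemma cexp_RtoC (x : R) : cexp (RtoC x) = RtoC (exp x).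
Proof. unfold cexp. simpl. rewrite cos_0, sin_0. apply C_ext; simpl; ring. Qed.

Lemma nps_pos (n : nat) (k : nat) : (1 <= n)%nat -> nps n (RtoC (INR k)) = RtoC (/ INR n ^ k).
Proof.
  intros Hn. unfold nps, cpow.
  rewrite <- RtoC_opp, <- RtoC_mult, cexp_RtoC, Ropp_mult_distr_l_reverse, exp_Ropp. do 2 f_equal.
  rewrite <- Rpower_pow by (apply lt_0_INR; lia). reflexivity.
Qed.

Definition dsum (a : nat -> C) (s l : C) : Prop :=
  climit (csum (fun n => a n * nps n s)%C) l.

Lemma is_Dirichlet_series_dsum (a : nat -> C) (L : C -> C) (s : C) :
  is_Dirichlet_series a L -> 1 < Re s -> dsum a s (L s).
Proof.
  intros H Hs eps He. specialize (H s Hs).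
  assert (E : forall n, csum (fun n => a n * nps n s)%C (S n)
     = sum_n (G := C_AbelianMonoid) (fun n => (a (S n) * cpow (INR (S n)) (- s))%C) n).
  { induction n as [|n IH].
    - rewrite sum_O. simpl csum. unfold nps. ring.
    - rewrite sum_Sn. rewrite <- IH. reflexivity. }
  unfold is_series in H.
  destruct (H (fun y => Cmod (y - L s) < eps)) as [N HN].
  { exists (mkposreal (eps / 2) ltac:(lra)). intros y [Hy1 Hy2].
    eapply Rle_lt_trans; [apply Cmod_le_Re_Im|].
    assert (Rabs (Re (y - L s)) < eps / 2) by exact Hy1.
    assert (Rabs (Im (y - L s)) < eps / 2) by exact Hy2. lra. }
  exists (S N). intros n Hn. destruct n as [|n]; [lia|]. rewrite E. apply HN. lia.
Qed.

(* Coefficients of (1 - al q^(-s)) * sum a(n) n^(-s). *)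
Definition coef_mul (q : nat) (al : C) (a : nat -> C) (n : nat) : C :=
  (a n - (if Nat.eqb (n mod q) 0 then al * a (n / q)%nat else 0))%C.

(** The multiples q k <= N are those with k <= N / q, so the product formula holds for partial sums
    and needs no rearrangement. *)
Lemma csum_multiples (q : nat) (al : C) (a : nat -> C) (s : C) (N : nat) :
  (2 <= q)%nat ->
  csum (fun n => (if Nat.eqb (n mod q) 0 then al * a (n / q)%nat else 0) * nps n s)%C N
  = (al * nps q s * csum (fun k => a k * nps k s) (N / q))%C.
Proof.
  intros Hq. induction N as [|N IH].
  - rewrite Nat.Div0.div_0_l. simpl. ring.
  - simpl csum. rewrite IH.
    pose proof (Nat.div_mod (S N) q ltac:(lia)) as E.
    pose proof (Nat.mod_upper_bound (S N) q ltac:(lia)) as Hm.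
    destruct (Nat.eqb_spec (S N mod q) 0) as [H0|H0].
    + set (k := (S N / q)%nat) in *. rewrite H0, Nat.add_0_r in E.
      destruct k as [|k]; [lia|].
      assert (Ek : (N / q)%nat = k).
      { symmetry. apply (Nat.div_unique N q k (q - 1)); lia. }
      rewrite Ek, E, nps_mult by lia. simpl csum. ring.
    + assert (Ek : (N / q)%nat = (S N / q)%nat).
      { symmetry. apply (Nat.div_unique N q (S N / q) (S N mod q - 1)); lia. }
      rewrite Ek. ring.
Qed.

Lemma dsum_coef_mul (q : nat) (al : C) (a : nat -> C) (s l : C) :
  (2 <= q)%nat -> dsum a s l -> dsum (coef_mul q al a) s ((1 - al * nps q s) * l).
Proof.
  intros Hq H. unfold dsum.
  replace ((1 - al * nps q s) * l)%C with (l - al * nps q s * l)%C by ring.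
  eapply climit_ext; [|apply climit_minus; [exact H|apply (climit_scal (al * nps q s))]].
  2:{ apply (climit_subseq (csum (fun n => a n * nps n s)%C) _ (fun N => (N / q)%nat)); [|exact H].
      intros N. exists (N * q)%nat. intros n Hn. apply Nat.div_le_lower_bound; nia. }
  intros N. cbv beta. rewrite <- csum_multiples by exact Hq. rewrite <- csum_minus.
  apply csum_ext. intros k _. unfold coef_mul. ring.
Qed.

Fixpoint coef_prod (alpha : nat -> nat -> C) (js : list nat) (p : nat) (a : nat -> C) : nat -> C :=
  match js with nil => a | (j :: js)%list => coef_mul p (alpha j p) (coef_prod alpha js p a) end.

(** Coefficients of the series multiplied by the reciprocal Euler factors at all primes up to N: the
    sieve of Eratosthenes with weights. *)
Fixpoint coef_sieve (m : nat) (alpha : nat -> nat -> C) (N : nat) (a : nat -> C) : nat -> C :=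
  match N with
  | O => a
  | S n => if prime_dec (Z.of_nat (S n)) then coef_prod alpha (seq 1 m) (S n) (coef_sieve m alpha n a)
           else coef_sieve m alpha n a
  end.

Fixpoint eprod (g : nat -> C) (N : nat) : C :=
  match N with
  | O => 1
  | S n => (eprod g n * (if prime_dec (Z.of_nat (S n)) then g (S n) else 1))%C
  end.

Lemma Cprod_nil {A : Type} (f : A -> C) : Cprod f nil = 1.
Proof. reflexivity. Qed.

Lemma Cprod_cons {A : Type} (f : A -> C) (x : A) (l : list A) : Cprod f (x :: l) = (f x * Cprod f l)%C.
Proof. reflexivity. Qed.

Lemma Cprod_app {A : Type} (f : A -> C) (l l' : list A) : Cprod f (l ++ l') = (Cprod f l * Cprod f l')%C.
Proof. induction l as [|x l IH]; [rewrite Cprod_nil; simpl; ring|]. simpl app. rewrite !Cprod_cons, IH. ring. Qed.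

Lemma not_prime_0 : ~ prime (Z.of_nat 0).
Proof. intros H. apply prime_ge_2 in H. simpl in H. lia. Qed.

Lemma Cprod_primes_upto (g : nat -> C) (N : nat) : Cprod g (primes_upto N) = eprod g N.
Proof.
  unfold primes_upto. induction N as [|N IH].
  - simpl seq. cbn [filter]. destruct (prime_dec (Z.of_nat 0)) as [H|H]; [destruct (not_prime_0 H)|reflexivity].
  - rewrite seq_S, filter_app, Cprod_app, IH, Nat.add_0_l. cbn [filter eprod].
    destruct (prime_dec (Z.of_nat (S N))); [rewrite Cprod_cons, Cprod_nil|rewrite Cprod_nil]; ring.
Qed.

Lemma prime_ge_2_nat (p : nat) : prime (Z.of_nat p) -> (2 <= p)%nat.
Proof. intros H. apply prime_ge_2 in H. lia. Qed.

(** The reciprocal of the Euler factor at p; the Euler factor itself is [einv]. *)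
Definition efactor (alpha : nat -> nat -> C) (m : nat) (s : C) (p : nat) : C :=
  Cprod (fun j => 1 - alpha j p * nps p s)%C (seq 1 m).

Lemma dsum_coef_prod (alpha : nat -> nat -> C) (js : list nat) (p : nat) (a : nat -> C) (s l : C) :
  (2 <= p)%nat -> dsum a s l ->
  dsum (coef_prod alpha js p a) s (l * Cprod (fun j => 1 - alpha j p * nps p s)%C js).
Proof.
  intros Hp H. induction js as [|j js IH]; simpl coef_prod.
  - rewrite Cprod_nil, Cmult_1_r. exact H.
  - rewrite Cprod_cons.
    replace (l * ((1 - alpha j p * nps p s) * Cprod (fun j0 => 1 - alpha j0 p * nps p s) js))%C
      with ((1 - alpha j p * nps p s) * (l * Cprod (fun j0 => 1 - alpha j0 p * nps p s) js))%C by ring.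
    apply dsum_coef_mul; assumption.
Qed.

Lemma dsum_coef_sieve (alpha : nat -> nat -> C) (m N : nat) (a : nat -> C) (s l : C) :
  dsum a s l -> dsum (coef_sieve m alpha N a) s (l * eprod (efactor alpha m s) N).
Proof.
  intros H. induction N as [|N IH]; cbn [coef_sieve eprod].
  - rewrite Cmult_1_r. exact H.
  - destruct (prime_dec (Z.of_nat (S N))) as [Hp|Hp].
    + rewrite Cmult_assoc. apply dsum_coef_prod; [apply prime_ge_2_nat; exact Hp|exact IH].
    + rewrite Cmult_1_r. exact IH.
Qed.

Definition alpha_le_p (alpha : nat -> nat -> C) (m : nat) : Prop :=
  forall p j, prime (Z.of_nat p) -> (1 <= j <= m)%nat -> Cmod (alpha j p) <= INR p.

(** If |alpha_j(p)| > p, the point s = log alpha_j(p) / log p has Re s > 1 and annihilates the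
    factor. *)
Lemma alpha_le_p_of_nonzero (alpha : nat -> nat -> C) (m : nat) :
  (forall s, 1 < Re s -> forall p j, prime (Z.of_nat p) -> (1 <= j <= m)%nat ->
     (1 - alpha j p * nps p s)%C <> 0) -> alpha_le_p alpha m.
Proof.
  intros H p j Hp Hj. apply Rnot_lt_le. intros Hlt.
  pose proof (prime_ge_2_nat p Hp) as Hp2.
  assert (HpR : 2 <= INR p) by (apply (le_INR 2) in Hp2; simpl in Hp2; lra).
  set (al := alpha j p) in *.
  assert (Hal : al <> 0) by (apply Cmod_gt_0; lra).
  assert (Hal' : Cmod al <> 0) by (intros E; lra).
  destruct (polar_form al Hal) as [y [_ E]].
  assert (Hln : 0 < ln (INR p)) by (rewrite <- ln_1; apply ln_increasing; lra).
  set (s := (ln (Cmod al) / ln (INR p), y / ln (INR p)) : C).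
  apply (H s) with (p := p) (j := j); [|exact Hp|exact Hj|].
  - simpl. apply Rmult_lt_reg_r with (ln (INR p)); [exact Hln|].
    unfold Rdiv. rewrite Rmult_assoc, Rinv_l, Rmult_1_l, Rmult_1_r by lra. apply ln_increasing; lra.
  - fold al. unfold nps, cpow.
    replace (- s * RtoC (ln (INR p)))%C with (- ((ln (Cmod al), y) : C))%C.
    + rewrite cexp_opp, <- E. field. exact Hal.
    + apply C_ext; unfold s; simpl; field; lra.
Qed.

Lemma is_Clim_seq_climit (u : nat -> C) (l : C) : is_Clim_seq u l -> climit u l.
Proof.
  intros H eps He. destruct (H (fun y => Cmod (y - l) < eps)) as [N HN].
  { exists (mkposreal (eps / 2) ltac:(lra)). intros y [Hy1 Hy2].
    eapply Rle_lt_trans; [apply Cmod_le_Re_Im|].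
    assert (Rabs (Re (y - l)) < eps / 2) by exact Hy1.
    assert (Rabs (Im (y - l)) < eps / 2) by exact Hy2. lra. }
  exists N. exact HN.
Qed.

(** Distance from 1 in the form e^A - 1 is additive in A under products, which turns tails of
    products into tails of sums. *)
Lemma Cmod_mult_sub_1_le (a b : C) (A B : R) :
  Cmod (a - 1) <= exp A - 1 -> Cmod (b - 1) <= exp B - 1 -> Cmod (a * b - 1) <= exp (A + B) - 1.
Proof.
  intros Ha Hb. rewrite exp_plus.
  replace (a * b - 1)%C with ((a - 1) * (b - 1) + (a - 1) + (b - 1))%C by ring.
  eapply Rle_trans; [apply Cmod_triangle|].
  eapply Rle_trans; [apply Rplus_le_compat_r, Cmod_triangle|]. rewrite Cmod_mult.
  pose proof (Cmod_ge_0 (a - 1)). pose proof (Cmod_ge_0 (b - 1)). nra.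
Qed.

Lemma Cmod_inv_sub_1_le (x : C) (c : R) :
  Cmod x <= 1 / 2 -> 2 * Cmod x <= c -> Cmod (/ (1 - x) - 1) <= exp c - 1.
Proof.
  intros Hx Hc. pose proof (Cmod_triangle_inv 1 x) as H. rewrite Cmod_1 in H.
  assert (H0 : (1 - x)%C <> 0) by (apply Cmod_gt_0; lra).
  replace (/ (1 - x) - 1)%C with (x * / (1 - x))%C by (field; exact H0).
  rewrite Cmod_mult, Cmod_inv by exact H0.
  pose proof (exp_ineq1_le c). pose proof (Cmod_ge_0 x) as Hx0.
  apply Rle_trans with (Cmod x * 2); [|lra].
  apply Rmult_le_compat_l; [exact Hx0|].
  rewrite <- (Rinv_inv 2). apply Rinv_le_contravar; lra.
Qed.

Lemma Cprod_sub_1_le {A : Type} (f : A -> C) (l : list A) (c : R) :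
  (forall x, In x l -> Cmod (f x - 1) <= exp c - 1) ->
  Cmod (Cprod f l - 1) <= exp (INR (length l) * c) - 1.
Proof.
  induction l as [|x l IH]; intros H.
  - rewrite Cprod_nil. simpl. replace (1 - 1)%C with (RtoC 0) by ring.
    rewrite Cmod_0, Rmult_0_l, exp_0. lra.
  - rewrite Cprod_cons. simpl length. rewrite S_INR.
    replace ((INR (length l) + 1) * c) with (c + INR (length l) * c) by ring.
    apply Cmod_mult_sub_1_le; [apply H; left; reflexivity|].
    apply IH. intros y Hy. apply H. right. exact Hy.
Qed.

Lemma Cprod_inv {A : Type} (f : A -> C) (l : list A) :
  (forall x, In x l -> f x <> 0) -> (Cprod (fun x => / f x) l * Cprod f l)%C = 1.
Proof.
  induction l as [|x l IH]; intros H.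
  - rewrite !Cprod_nil. ring.
  - rewrite !Cprod_cons. 
    transitivity ((/ f x * f x) * (Cprod (fun x => / f x) l * Cprod f l))%C; [ring|].
    rewrite IH, Cinv_l; [ring|apply H; left; reflexivity|].
    intros y Hy. apply H. right. exact Hy.
Qed.

Lemma rsum_inv_sqr_le (N i : nat) : (1 <= N)%nat ->
  rsum (fun n => / INR n ^ 2) (N + i) - rsum (fun n => / INR n ^ 2) N <= 1.
Proof.
  intros HN.
  assert (H : rsum (fun n => / INR n ^ 2) (N + i) - rsum (fun n => / INR n ^ 2) N <= / INR N - / INR (N + i)).
  { induction i as [|i IH]; [rewrite Nat.add_0_r; lra|].
    rewrite Nat.add_succ_r. cbn [rsum].
    assert (Hn : 1 <= INR (N + i)) by (apply (le_INR 1); lia).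
    rewrite S_INR. set (x := INR (N + i)) in *.
    assert (/ (x + 1) ^ 2 <= / x - / (x + 1)); [|lra].
    replace (/ x - / (x + 1)) with (/ (x * (x + 1))) by (field; lra).
    apply Rinv_le_contravar; nra. }
  assert (/ INR N <= / 1) by (apply Rinv_le_contravar; [lra|apply (le_INR 1); lia]).
  assert (0 < / INR (N + i)) by (apply Rinv_0_lt_compat, lt_0_INR; lia).
  rewrite Rinv_1 in *. lra.
Qed.

Lemma rsum_diff_le (f g : nat -> R) (c : R) (N i : nat) :
  (forall n, (N < n)%nat -> f n <= c * g n) ->
  rsum f (N + i) - rsum f N <= c * (rsum g (N + i) - rsum g N).
Proof.
  intros H. induction i as [|i IH]; [rewrite Nat.add_0_r; lra|].
  rewrite Nat.add_succ_r. cbn [rsum]. specialize (H (S (N + i)) ltac:(lia)). lra.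
Qed.

Lemma inv_pow_tail_le (N n k : nat) : (N < n)%nat ->
  / INR n ^ (k + 2) <= / INR (S N) ^ k * / INR n ^ 2.
Proof.
  intros Hn. rewrite pow_add, Rinv_mult.
  assert (0 < INR n) by (apply lt_0_INR; lia).
  apply Rmult_le_compat_r; [left; apply Rinv_0_lt_compat, pow_lt; assumption|].
  apply Rinv_le_contravar; [apply pow_lt, lt_0_INR; lia|].
  apply pow_incr. split; [apply pos_INR|apply le_INR; lia].
Qed.

Definition einv (alpha : nat -> nat -> C) (m : nat) (s : C) (p : nat) : C :=
  Cprod (fun j => / (1 - alpha j p * nps p s))%C (seq 1 m).

Lemma einv_efactor (alpha : nat -> nat -> C) (m : nat) (s : C) (p : nat) :
  (forall j, (1 <= j <= m)%nat -> (1 - alpha j p * nps p s)%C <> 0) ->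
  (einv alpha m s p * efactor alpha m s p)%C = 1.
Proof. intros H. apply Cprod_inv. intros j Hj. apply in_seq in Hj. apply H. lia. Qed.

Lemma nps_pos_Cmod (n k : nat) : (1 <= n)%nat -> Cmod (nps n (RtoC (INR k))) = / INR n ^ k.
Proof.
  intros Hn. rewrite nps_pos, Cmod_R by exact Hn. apply Rabs_right. left.
  apply Rinv_0_lt_compat, pow_lt, lt_0_INR. lia.
Qed.

(** The left side is the product over the primes p > N, where |alpha_j(p) p^(-k-3)| <= p^(-k-2). Two
    powers of p pay for summability and the other k give the decay (N + 1)^(-k). *)
Lemma euler_tail (alpha : nat -> nat -> C) (m : nat) (l : C) (N k : nat) :
  (1 <= N)%nat -> alpha_le_p alpha m ->
  (forall p j, prime (Z.of_nat p) -> (1 <= j <= m)%nat ->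
     (1 - alpha j p * nps p (RtoC (INR (k + 3))))%C <> 0) ->
  climit (eprod (einv alpha m (RtoC (INR (k + 3))))) l ->
  Cmod (l * eprod (efactor alpha m (RtoC (INR (k + 3)))) N - 1)
    <= exp (2 * INR m * / INR (S N) ^ k) - 1.
Proof.
  intros HN Hal Hnz Hl. set (s := RtoC (INR (k + 3))) in *.
  (* e^(h n) - 1 bounds the distance of the factor at n from 1; the 2 comes from 1 / |1 - x| <= 2
     for |x| <= 1/2. *)
  set (h := fun n : nat => INR m * (2 * (INR n * / INR n ^ (k + 3)))).
  assert (Hone : forall n, (2 <= n)%nat -> prime (Z.of_nat n) -> Cmod (einv alpha m s n - 1) <= exp (h n) - 1).
  { intros n Hn Hp. unfold einv, h.
    replace (INR m) with (INR (length (seq 1 m))) by (rewrite length_seq; reflexivity).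
    apply Cprod_sub_1_le. intros j Hj. apply in_seq in Hj.
    assert (Hn2 : 2 <= INR n) by (apply (le_INR 2) in Hn; simpl in Hn; lra).
    assert (Hx : Cmod (alpha j n * nps n s) <= INR n * / INR n ^ (k + 3)).
    { rewrite Cmod_mult. unfold s. rewrite nps_pos_Cmod by lia.
      apply Rmult_le_compat_r; [left; apply Rinv_0_lt_compat, pow_lt; lra|].
      apply Hal; [exact Hp|lia]. }
    apply Cmod_inv_sub_1_le; [|lra].
    eapply Rle_trans; [exact Hx|].
    replace (k + 3)%nat with (S (S (S k))) by lia. simpl.
    assert (1 <= INR n ^ k) by (apply pow_R1_Rle; lra).
    rewrite Rinv_mult, <- Rmult_assoc, Rinv_r, Rmult_1_l by lra.
    unfold Rdiv. rewrite Rmult_1_l. apply Rinv_le_contravar; [lra|]. nra. }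
  assert (Htail : forall i, Cmod (eprod (einv alpha m s) (N + i) * eprod (efactor alpha m s) N - 1)
     <= exp (rsum h (N + i) - rsum h N) - 1).
  { induction i as [|i IH].
    - rewrite Nat.add_0_r, Rminus_diag, exp_0.
      assert (E : (eprod (einv alpha m s) N * eprod (efactor alpha m s) N)%C = 1).
      { clear -Hnz. induction N as [|N IH]; cbn [eprod]; [ring|].
        destruct (prime_dec (Z.of_nat (S N))) as [Hp|Hp].
        - transitivity ((eprod (einv alpha m s) N * eprod (efactor alpha m s) N)
            * (einv alpha m s (S N) * efactor alpha m s (S N)))%C; [ring|].
          rewrite IH, einv_efactor; [ring|]. intros j Hj. apply Hnz; assumption.
        - rewrite !Cmult_1_r. exact IH. }
      rewrite E. replace (1 - 1)%C with (RtoC 0) by ring. rewrite Cmod_0. lra.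
    - rewrite Nat.add_succ_r. cbn [eprod rsum].
      replace (rsum h (N + i) + h (S (N + i)) - rsum h N) with ((rsum h (N + i) - rsum h N) + h (S (N + i))) by ring.
      set (e := if prime_dec (Z.of_nat (S (N + i))) then einv alpha m s (S (N + i)) else 1).
      replace (eprod (einv alpha m s) (N + i) * e * eprod (efactor alpha m s) N)%C
        with (eprod (einv alpha m s) (N + i) * eprod (efactor alpha m s) N * e)%C by ring.
      apply Cmod_mult_sub_1_le; [exact IH|]. unfold e.
      destruct (prime_dec (Z.of_nat (S (N + i)))) as [Hp|Hp].
      + apply Hone; [lia|exact Hp].
      + replace (1 - 1)%C with (RtoC 0) by ring. rewrite Cmod_0.
        assert (0 <= h (S (N + i))).
        { unfold h. apply Rmult_le_pos; [apply pos_INR|]. apply Rmult_le_pos; [lra|].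
          apply Rmult_le_pos; [apply pos_INR|]. left. apply Rinv_0_lt_compat, pow_lt, lt_0_INR. lia. }
        pose proof (exp_ineq1_le (h (S (N + i)))). lra. }
  apply (climit_Cmod_le (fun n => eprod (efactor alpha m s) N * eprod (einv alpha m s) n - 1)%C _ _ N).
  - replace (l * eprod (efactor alpha m s) N - 1)%C with (eprod (efactor alpha m s) N * l - 1)%C by ring.
    apply climit_minus; [apply climit_scal; exact Hl|apply climit_const].
  - intros n Hn. replace n with (N + (n - N))%nat by lia. set (i := (n - N)%nat).
    rewrite Cmult_comm. eapply Rle_trans; [apply Htail|].
    apply Rplus_le_compat_r. assert (rsum h (N + i) - rsum h N <= 2 * INR m * / INR (S N) ^ k).
    { eapply Rle_trans; [apply (rsum_diff_le h (fun n => / INR n ^ 2) (2 * INR m * / INR (S N) ^ k))|].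
      - intros q Hq. unfold h.
        replace (INR q * / INR q ^ (k + 3)) with (/ INR q ^ (k + 2)).
        + pose proof (inv_pow_tail_le N q k Hq). pose proof (pos_INR m). nra.
        + replace (k + 3)%nat with (S (k + 2)) by lia. simpl. field.
          assert (INR q <> 0) by (apply not_0_INR; lia). split; [apply pow_nonzero|]; assumption.
      - pose proof (rsum_inv_sqr_le N i HN).
        assert (0 <= 2 * INR m * / INR (S N) ^ k).
        { apply Rmult_le_pos; [pose proof (pos_INR m); lra|]. left. apply Rinv_0_lt_compat, pow_lt, lt_0_INR. lia. }
        nra. }
    destruct H as [H|H]; [left; apply exp_increasing; exact H|right; rewrite H; reflexivity].
Qed.

(** The factor |al| <= q is offset by the smaller index n / q, so linear growth survives the
    sieve. *)
Lemma coef_mul_bound (q : nat) (al : C) (a : nat -> C) (B : R) :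
  (2 <= q)%nat -> Cmod al <= INR q -> 0 <= B ->
  (forall n, (1 <= n)%nat -> Cmod (a n) <= B * INR n) ->
  forall n, (1 <= n)%nat -> Cmod (coef_mul q al a n) <= 2 * B * INR n.
Proof.
  intros Hq Hal HB H n Hn. unfold coef_mul. pose proof (H n Hn) as H1. pose proof (pos_INR n) as Pn.
  eapply Rle_trans; [apply Cmod_triangle_minus|].
  destruct (Nat.eqb_spec (n mod q) 0) as [E|E]; [|rewrite Cmod_0; nra].
  rewrite Cmod_mult. pose proof (Nat.div_mod n q ltac:(lia)) as D. rewrite E, Nat.add_0_r in D.
  assert (Hk : (1 <= n / q)%nat) by (destruct (n / q)%nat; lia).
  specialize (H (n / q)%nat Hk).
  assert (EI : INR n = INR q * INR (n / q)) by (rewrite <- mult_INR; f_equal; exact D).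
  pose proof (pos_INR q). pose proof (pos_INR (n / q)).
  assert (Cmod al * Cmod (a (n / q)%nat) <= INR q * (B * INR (n / q)))
    by (apply Rmult_le_compat; try apply Cmod_ge_0; assumption).
  nra.
Qed.

Lemma coef_prod_bound (alpha : nat -> nat -> C) (js : list nat) (p : nat) (a : nat -> C) (B : R) :
  (2 <= p)%nat -> (forall j, In j js -> Cmod (alpha j p) <= INR p) -> 0 <= B ->
  (forall n, (1 <= n)%nat -> Cmod (a n) <= B * INR n) ->
  exists B', 0 <= B' /\ forall n, (1 <= n)%nat -> Cmod (coef_prod alpha js p a n) <= B' * INR n.
Proof.
  intros Hp. induction js as [|j js IH]; intros Hal HB H.
  - exists B. auto.
  - destruct IH as [B' [HB' H']]; [intros i Hi; apply Hal; right; exact Hi|assumption..|].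
    exists (2 * B'). split; [lra|]. apply coef_mul_bound; [assumption| |assumption..].
    apply Hal. left. reflexivity.
Qed.

Lemma coef_sieve_bound (alpha : nat -> nat -> C) (m N : nat) (a : nat -> C) (B : R) :
  alpha_le_p alpha m -> 0 <= B ->
  (forall n, (1 <= n)%nat -> Cmod (a n) <= B * INR n) ->
  exists B', 0 <= B' /\ forall n, (1 <= n)%nat -> Cmod (coef_sieve m alpha N a n) <= B' * INR n.
Proof.
  intros Hal HB H. induction N as [|N IH]; cbn [coef_sieve]; [exists B; auto|].
  destruct IH as [B' [HB' H']].
  destruct (prime_dec (Z.of_nat (S N))) as [Hp|Hp]; [|exists B'; auto].
  apply (coef_prod_bound alpha _ _ _ B'); [apply prime_ge_2_nat; exact Hp| |assumption..].
  intros j Hj. apply in_seq in Hj. apply Hal; [exact Hp|lia].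
Qed.

(* Letting the argument tend to infinity isolates the first nonzero coefficient. *)
Lemma coef_sieve_eq_delta (a : nat -> C) (L : C -> C) (alpha : nat -> nat -> C) (m : nat) (B : R) :
  alpha_le_p alpha m -> 0 <= B -> (forall n, (1 <= n)%nat -> Cmod (a n) <= B * INR n) ->
  (forall k : nat, dsum a (RtoC (INR (k + 3))) (L (RtoC (INR (k + 3))))) ->
  (forall k p j, prime (Z.of_nat p) -> (1 <= j <= m)%nat ->
     (1 - alpha j p * nps p (RtoC (INR (k + 3))))%C <> 0) ->
  (forall k, climit (eprod (einv alpha m (RtoC (INR (k + 3))))) (L (RtoC (INR (k + 3))))) ->
  forall N n, (1 <= n <= N)%nat -> coef_sieve m alpha N a n = (if Nat.eqb n 1 then 1 else 0).
Proof.
  intros Hal HB Ha Hd Hnz Hl N.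
  destruct (coef_sieve_bound alpha m N a B Hal HB Ha) as [B' [HB' Hb']].
  set (dl := fun n : nat => if Nat.eqb n 1 then RtoC 1 else RtoC 0).
  set (b := fun n => (coef_sieve m alpha N a n - dl n)%C).
  assert (Hb : forall n, (1 <= n)%nat -> Cmod (b n) <= (B' + 1) * INR n).
  { intros n Hn. unfold b. eapply Rle_trans; [apply Cmod_triangle_minus|]. specialize (Hb' n Hn).
    assert (Cmod (dl n) <= INR n).
    { unfold dl. pose proof (le_INR 1 n Hn) as H1. simpl in H1.
      destruct (Nat.eqb n 1); rewrite ?Cmod_1, ?Cmod_0; lra. }
    lra. }
  assert (Hdl : forall s, dsum dl s 1).
  { intros s eps He. exists 1%nat. intros n Hn.
    assert (E : csum (fun n => dl n * nps n s)%C n = 1).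
    { destruct n as [|n]; [lia|]. clear Hn. induction n as [|n IH].
      - simpl. unfold nps, cpow. simpl. rewrite ln_1.
        replace (- s * 0)%C with (RtoC 0) by ring. rewrite cexp_0. unfold dl. simpl. ring.
      - cbn [csum] in *. rewrite IH. unfold dl. simpl. ring. }
    rewrite E. replace (1 - 1)%C with (RtoC 0) by ring. rewrite Cmod_0. exact He. }
  assert (Hbd : forall k, dsum b (RtoC (INR (k + 3)))
     (L (RtoC (INR (k + 3))) * eprod (efactor alpha m (RtoC (INR (k + 3)))) N - 1)%C).
  { intros k. eapply climit_ext; [|apply climit_minus; [apply (dsum_coef_sieve alpha m N a), Hd|apply (Hdl (RtoC (INR (k + 3))))]].
    intros n. cbv beta. rewrite <- csum_minus. apply csum_ext. intros i _. unfold b. ring. }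
  assert (Hz : forall n, (1 <= n <= N)%nat -> b n = 0).
  { intros n. induction n as [n IH] using (well_founded_induction Wf_nat.lt_wf). intros Hn.
    set (Q := 6 * INR m + (B' + 1)).
    assert (HQ : 0 < Q) by (unfold Q; pose proof (pos_INR m); lra).
    assert (Hn1 : 1 <= INR n) by (apply (le_INR 1); lia).
    (* By induction n is the first index where b may be nonzero. Its term is the value of the series
       minus the tail beyond n, and both are O((n + 1)^(-k)). *)
    assert (Hkey : forall k, 2 * INR m * / INR (S N) ^ k <= 1 ->
       Cmod (b n) * / INR n ^ (k + 3) <= Q * / INR (S n) ^ k).
    { intros k Hk. set (s := RtoC (INR (k + 3))).
      assert (E : csum (fun i => b i * nps i s)%C n = (b n * nps n s)%C).
      { destruct n as [|n]; [lia|]. cbn [csum].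
        replace (csum (fun i => b i * nps i s)%C n) with (csum (fun _ => RtoC 0) n).
        - replace (csum (fun _ => RtoC 0) n) with (RtoC 0); [ring|].
          clear. induction n as [|n IH]; simpl; [reflexivity|]. rewrite <- IH. ring.
        - apply csum_ext. intros i Hi. rewrite IH by lia. ring. }
      set (g := (L s * eprod (efactor alpha m s) N - 1)%C).
      assert (Hg : Cmod g <= 6 * INR m * / INR (S n) ^ k).
      { eapply Rle_trans; [apply (euler_tail alpha m (L s) N k); [lia|exact Hal|apply Hnz|apply Hl]|].
        set (x := 2 * INR m * / INR (S N) ^ k) in *.
        assert (Hx0 : 0 <= x).
        { unfold x. apply Rmult_le_pos; [pose proof (pos_INR m); lra|]. left. apply Rinv_0_lt_compat, pow_lt, lt_0_INR. lia. }
        pose proof (exp_sub_1_abs_le x) as He. rewrite (Rabs_right x) in He by lra. specialize (He Hk).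
        eapply Rle_trans; [apply Rle_abs|]. eapply Rle_trans; [exact He|].
        unfold x. pose proof (pos_INR m).
        assert (/ INR (S N) ^ k <= / INR (S n) ^ k).
        { apply Rinv_le_contravar; [apply pow_lt, lt_0_INR; lia|]. apply pow_incr.
          split; [apply pos_INR|apply le_INR; lia]. }
        nra. }
      assert (Ht : Cmod (g - b n * nps n s) <= (B' + 1) * / INR (S n) ^ k).
      { rewrite <- E.
        apply (climit_Cmod_le (fun M => csum (fun i => b i * nps i s)%C M - csum (fun i => b i * nps i s)%C n)%C _ _ n).
        - apply climit_minus; [apply Hbd|apply climit_const].
        - intros M HM. replace M with (n + (M - n))%nat by lia. set (i := (M - n)%nat).
          eapply Rle_trans; [apply (Cmod_csum_diff_le _ (fun q => (B' + 1) * / INR q ^ (k + 2)))|].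
          + intros q Hq. rewrite Cmod_mult. unfold s. rewrite nps_pos_Cmod by lia.
            assert (Hq0 : 0 < INR q) by (apply lt_0_INR; lia).
            apply Rle_trans with ((B' + 1) * INR q * / INR q ^ (k + 3)).
            * apply Rmult_le_compat_r; [left; apply Rinv_0_lt_compat, pow_lt; exact Hq0|apply Hb; lia].
            * right. replace (k + 3)%nat with (S (k + 2)) by lia. simpl. field.
              split; [apply pow_nonzero|]; lra.
          + eapply Rle_trans; [apply (rsum_diff_le _ (fun n => / INR n ^ 2) ((B' + 1) * / INR (S n) ^ k))|].
            * intros q Hq. pose proof (inv_pow_tail_le n q k Hq). nra.
            * pose proof (rsum_inv_sqr_le n i ltac:(lia)).
              assert (0 <= (B' + 1) * / INR (S n) ^ k).
              { apply Rmult_le_pos; [lra|]. left. apply Rinv_0_lt_compat, pow_lt, lt_0_INR. lia. }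
              nra. }
      replace (Cmod (b n) * / INR n ^ (k + 3)) with (Cmod (b n * nps n s)).
      - replace (b n * nps n s)%C with (g - (g - b n * nps n s))%C by ring.
        eapply Rle_trans; [apply Cmod_triangle_minus|]. unfold Q. lra.
      - rewrite Cmod_mult. unfold s. rewrite nps_pos_Cmod by lia. reflexivity. }
    destruct (Req_dec (Cmod (b n)) 0) as [E|E]; [apply Cmod_eq_0; exact E|]. exfalso.
    assert (Hbn : 0 < Cmod (b n)) by (pose proof (Cmod_ge_0 (b n)); lra).
    (* [Hkey] amounts to |b n| <= Q n^3 r^k with r < 1, which is impossible for large k. *)
    set (r := INR n * / INR (S n)).
    assert (HSn : INR (S n) = INR n + 1) by apply S_INR.
    assert (Hr : 0 < r < 1).
    { unfold r. rewrite HSn. split; [apply Rmult_lt_0_compat; [lra|apply Rinv_0_lt_compat; lra]|].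
      apply Rmult_lt_reg_r with (INR n + 1); [lra|]. rewrite Rmult_assoc, Rinv_l; lra. }
    assert (Hn3 : 0 < INR n ^ 3) by (apply pow_lt; lra).
    destruct (pow_lt_1_zero r ltac:(rewrite Rabs_right; lra) (Cmod (b n) / (Q * INR n ^ 3))) as [K1 HK1].
    { apply Rdiv_lt_0_compat; [exact Hbn|apply Rmult_lt_0_compat; lra]. }
    destruct (pow_lt_1_zero (/ INR (S N))
      ltac:(rewrite Rabs_right; [|left; apply Rinv_0_lt_compat, lt_0_INR; lia];
            rewrite <- Rinv_1; apply Rinv_lt_contravar; [rewrite Rmult_1_l; apply lt_0_INR; lia|apply (lt_INR 1); lia])
      (/ (2 * INR m + 1))) as [K2 HK2].
    { apply Rinv_0_lt_compat. pose proof (pos_INR m). lra. }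
    (* [K1] makes r^k small enough for the contradiction; [K2] makes the exponent in [euler_tail] at
       most 1, where e^x - 1 <= 3 x. *)
    set (k := (K1 + K2)%nat).
    specialize (HK1 k ltac:(unfold k; lia)). specialize (HK2 k ltac:(unfold k; lia)).
    pose proof (pos_INR m) as Hm.
    rewrite Rabs_right in HK1 by (left; apply pow_lt; lra).
    rewrite pow_inv, Rabs_right in HK2 by (left; apply Rinv_0_lt_compat, pow_lt, lt_0_INR; lia).
    assert (Hk : 2 * INR m * / INR (S N) ^ k <= 1).
    { apply (Rmult_lt_compat_l (2 * INR m + 1)) in HK2; [|lra]. rewrite Rinv_r in HK2 by lra.
      assert (0 < / INR (S N) ^ k) by (apply Rinv_0_lt_compat, pow_lt, lt_0_INR; lia). lra. }
    specialize (Hkey k Hk).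
    assert (Hpn : 0 < INR n ^ k) by (apply pow_lt; lra).
    rewrite pow_add in Hkey.
    apply (Rmult_le_compat_r (INR n ^ k * INR n ^ 3)) in Hkey; [|left; apply Rmult_lt_0_compat; assumption].
    rewrite Rmult_assoc, Rinv_l, Rmult_1_r in Hkey by (apply Rmult_integral_contrapositive_currified; lra).
    assert (E2 : Q * / INR (S n) ^ k * (INR n ^ k * INR n ^ 3) = (Q * INR n ^ 3) * r ^ k).
    { unfold r. rewrite Rpow_mult_distr, pow_inv. ring. }
    rewrite E2 in Hkey.
    apply (Rmult_lt_compat_l (Q * INR n ^ 3)) in HK1; [|apply Rmult_lt_0_compat; lra].
    replace (Q * INR n ^ 3 * (Cmod (b n) / (Q * INR n ^ 3))) with (Cmod (b n)) in HK1 by (field; lra).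
    lra. }
  intros n Hn. specialize (Hz n Hn). unfold b in Hz. change (coef_sieve m alpha N a n = dl n).
  replace (coef_sieve m alpha N a n) with ((coef_sieve m alpha N a n - dl n) + dl n)%C by ring.
  rewrite Hz. ring.
Qed.

(* Coefficients of (1 - al z) * sum x_k z^k. *)
Definition shift_mul (al : C) (x : nat -> C) (k : nat) : C :=
  (x k - (match k with O => 0 | S i => al * x i end))%C.

Fixpoint shift_prod (alpha : nat -> nat -> C) (js : list nat) (p : nat) (x : nat -> C) : nat -> C :=
  match js with nil => x | (j :: js)%list => shift_mul (alpha j p) (shift_prod alpha js p x) end.

Lemma coef_mul_pow_same (p : nat) (al : C) (a : nat -> C) (k : nat) :
  (2 <= p)%nat -> coef_mul p al a (p ^ k) = shift_mul al (fun i => a (p ^ i)%nat) k.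
Proof.
  intros Hp. unfold coef_mul, shift_mul. destruct k as [|k].
  - rewrite Nat.pow_0_r, Nat.mod_1_l by lia. reflexivity.
  - rewrite Nat.pow_succ_r', (Nat.mul_comm p), Nat.Div0.mod_mul, Nat.div_mul by lia. reflexivity.
Qed.

Lemma prime_pow_mod_neq (p q k : nat) :
  prime (Z.of_nat p) -> prime (Z.of_nat q) -> p <> q -> ((p ^ k) mod q <> 0)%nat.
Proof.
  intros Hp Hq Hne H. apply Hne. apply Nat2Z.inj. symmetry.
  apply (Zpow_facts.prime_power_prime (Z.of_nat q) (Z.of_nat p) (Z.of_nat k)); [lia|exact Hq|exact Hp|].
  rewrite <- Nat2Z.inj_pow. apply Nat.Lcm0.mod_divide in H. destruct H as [c Hc].
  exists (Z.of_nat c). rewrite Hc, Nat2Z.inj_mul. reflexivity.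
Qed.

Lemma coef_prod_pow_same (alpha : nat -> nat -> C) (js : list nat) (p : nat) (a : nat -> C) (k : nat) :
  (2 <= p)%nat -> coef_prod alpha js p a (p ^ k) = shift_prod alpha js p (fun i => a (p ^ i)%nat) k.
Proof.
  intros Hp. revert k. induction js as [|j js IH]; intros k; cbn [coef_prod shift_prod]; [reflexivity|].
  rewrite coef_mul_pow_same by exact Hp. unfold shift_mul. rewrite IH. destruct k as [|k]; [reflexivity|].
  rewrite IH. reflexivity.
Qed.

Lemma coef_prod_pow_other (alpha : nat -> nat -> C) (js : list nat) (p q : nat) (a : nat -> C) (k : nat) :
  prime (Z.of_nat p) -> prime (Z.of_nat q) -> p <> q -> coef_prod alpha js q a (p ^ k) = a (p ^ k)%nat.
Proof.
  intros Hp Hq Hne. induction js as [|j js IH]; cbn [coef_prod]; [reflexivity|].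
  unfold coef_mul. rewrite IH.
  destruct (Nat.eqb_spec (p ^ k mod q) 0) as [H|H]; [destruct (prime_pow_mod_neq p q k Hp Hq Hne H)|ring].
Qed.

(** No other prime divides p^k, so along the powers of p only the factor at p acts, and it acts as
    multiplication by a polynomial in one variable. *)
Lemma coef_sieve_pow (alpha : nat -> nat -> C) (m N p : nat) (a : nat -> C) (k : nat) :
  prime (Z.of_nat p) ->
  coef_sieve m alpha N a (p ^ k)
  = if Nat.leb p N then shift_prod alpha (seq 1 m) p (fun i => a (p ^ i)%nat) k else a (p ^ k)%nat.
Proof.
  intros Hp. pose proof (prime_ge_2_nat p Hp) as Hp2. revert k.
  induction N as [|N IH]; intros k; cbn [coef_sieve].
  - destruct (Nat.leb_spec p 0); [lia|reflexivity].
  - destruct (Nat.eq_dec p (S N)) as [E|E].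
    + subst p. destruct (prime_dec (Z.of_nat (S N))) as [H|H]; [|contradiction].
      rewrite coef_prod_pow_same by exact Hp2. rewrite Nat.leb_refl.
      replace (fun i => coef_sieve m alpha N a (S N ^ i)) with (fun i => a (S N ^ i)%nat); [reflexivity|].
      apply functional_extensionality. intros i. rewrite IH.
      destruct (Nat.leb_spec (S N) N); [lia|reflexivity].
    + replace (Nat.leb p (S N)) with (Nat.leb p N).
      * destruct (prime_dec (Z.of_nat (S N))) as [H|H]; [|apply IH].
        rewrite coef_prod_pow_other by assumption. apply IH.
      * destruct (Nat.leb_spec p N), (Nat.leb_spec p (S N)); reflexivity || lia.
Qed.

(** [csum] starts at index 1; [pred] makes the power series start at degree 0. *)
Definition psum (x : nat -> C) (z : C) (n : nat) : C := csum (fun i => x (pred i) * z ^ pred i)%C n.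

Lemma psum_shift_mul (al : C) (x : nat -> C) (z X : C) :
  climit (psum x z) X -> climit (psum (shift_mul al x) z) ((1 - al * z) * X).
Proof.
  intros H. replace ((1 - al * z) * X)%C with (X - al * z * X)%C by ring.
  eapply climit_ext; [|apply climit_minus; [exact H|apply (climit_scal (al * z)%C)]].
  2:{ apply (climit_subseq (psum x z) _ pred); [|exact H]. intros N. exists (S N). intros n Hn. lia. }
  intros n. cbv beta. induction n as [|n IH]; [simpl; unfold psum; simpl; ring|].
  unfold psum in *. cbn [csum pred] in *. rewrite <- IH. unfold shift_mul.
  destruct n as [|n]; [simpl; ring|]. cbn [csum pred].
  replace (z ^ S n)%C with (z * z ^ n)%C by reflexivity. ring.
Qed.

Lemma psum_shift_prod (alpha : nat -> nat -> C) (js : list nat) (p : nat) (x : nat -> C) (z X : C) :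
  climit (psum x z) X ->
  climit (psum (shift_prod alpha js p x) z) (Cprod (fun j => 1 - alpha j p * z)%C js * X).
Proof.
  intros H. induction js as [|j js IH]; cbn [shift_prod].
  - rewrite Cprod_nil, Cmult_1_l. exact H.
  - rewrite Cprod_cons, <- Cmult_assoc. apply psum_shift_mul. exact IH.
Qed.

Lemma Cprod_zero {A : Type} (f : A -> C) (l : list A) (x : A) : In x l -> f x = 0 -> Cprod f l = 0.
Proof.
  intros Hx H0. induction l as [|y l IH]; [destruct Hx|]. rewrite Cprod_cons.
  destruct Hx as [->|Hx]; [rewrite H0|rewrite IH by exact Hx]; ring.
Qed.

Lemma psum_exists (x : nat -> C) (z : C) (M r : R) :
  0 <= M -> 0 <= r < 1 -> (forall k, Cmod (x k) * Cmod z ^ k <= M * r ^ k) -> exists X, climit (psum x z) X.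
Proof.
  intros HM Hr H.
  apply (climit_csum_exists _ (fun i => M * r ^ pred i) (M / (1 - r))).
  - intros n Hn. rewrite Cmod_mult, Cmod_pow. apply H.
  - assert (E : forall n, rsum (fun i => M * r ^ pred i) n = M * (1 - r ^ n) / (1 - r)).
    { induction n as [|n IH]; [simpl; field; lra|]. cbn [rsum pred]. rewrite IH. simpl. field. lra. }
    intros n. rewrite E. unfold Rdiv. apply Rmult_le_compat_r; [left; apply Rinv_0_lt_compat; lra|].
    pose proof (pow_le r n ltac:(lra)). nra.
Qed.

(* Along the powers of p the sieve says prod_j (1 - alpha_j z) * sum a(p^k) z^k = 1; by Ramanujan's
   bound the series converges for |z| < 1, so no 1 / alpha_j lies in the open unit disc. *)
Lemma alpha_le_1 (a : nat -> C) (L : C -> C) (alpha : nat -> nat -> C) (m : nat) :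
  is_Dirichlet_series a L -> Ramanujan a ->
  (forall s, 1 < Re s -> forall p j, prime (Z.of_nat p) -> (1 <= j <= m)%nat ->
     (1 - alpha j p * nps p s)%C <> 0) ->
  (forall s, 1 < Re s -> climit (eprod (einv alpha m s)) (L s)) ->
  forall p j, prime (Z.of_nat p) -> (1 <= j <= m)%nat -> Cmod (alpha j p) <= 1.
Proof.
  intros Hser Hram Hnz Hl p j Hp Hj. apply Rnot_lt_le. intros Hlt.
  pose proof (prime_ge_2_nat p Hp) as Hp2.
  assert (Hk3 : forall k, 1 < Re (RtoC (INR (k + 3)))).
  { intros k. simpl. rewrite plus_INR. simpl. pose proof (pos_INR k). lra. }
  set (x := fun k => a (p ^ k)%nat).
  assert (Hdelta : forall k, shift_prod alpha (seq 1 m) p x k = (if Nat.eqb k 0 then 1 else 0)).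
  { intros k.
    destruct (Hram 1 Rlt_0_1) as [M HM].
    assert (Hpk : (1 <= p ^ k)%nat) by (apply Nat.neq_0_lt_0, Nat.pow_nonzero; lia).
    pose proof (coef_sieve_eq_delta a L alpha m (Rmax M 0) (alpha_le_p_of_nonzero alpha m Hnz) (Rmax_r _ _)) as HD.
    specialize (HD ltac:(intros n Hn; specialize (HM n Hn); rewrite Rpower_1 in HM by (apply lt_0_INR; lia);
      eapply Rle_trans; [exact HM|]; apply Rmult_le_compat_r; [apply pos_INR|apply Rmax_l])).
    specialize (HD ltac:(intros i; apply is_Dirichlet_series_dsum; [exact Hser|apply Hk3])).
    specialize (HD ltac:(intros i; apply Hnz, Hk3)). specialize (HD ltac:(intros i; apply Hl, Hk3)).
    (* The sieving limit must reach both p, for its factor to act, and the index p^k. *)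
    specialize (HD (p ^ k + p)%nat (p ^ k)%nat ltac:(lia)).
    rewrite coef_sieve_pow in HD by exact Hp.
    destruct (Nat.leb_spec p (p ^ k + p)) as [_|H]; [|lia].
    fold x in HD. rewrite HD. destruct k as [|k]; [reflexivity|].
    assert ((2 <= p ^ S k)%nat).
    { rewrite Nat.pow_succ_r'. assert ((1 <= p ^ k)%nat) by (apply Nat.neq_0_lt_0, Nat.pow_nonzero; lia). nia. }
    destruct (Nat.eqb_spec (p ^ S k) 1); [lia|reflexivity]. }
  set (al := alpha j p) in *.
  assert (Hal : al <> 0) by (apply Cmod_gt_0; lra).
  set (z := (/ al)%C). set (A := Cmod al) in *.
  assert (HpR : 2 <= INR p) by (apply (le_INR 2) in Hp2; simpl in Hp2; lra).
  assert (Hlnp : 0 < ln (INR p)) by (rewrite <- ln_1; apply ln_increasing; lra).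
  assert (HlnA : 0 < ln A) by (rewrite <- ln_1; apply ln_increasing; lra).
  (* p^eps is the square root of A = |alpha_j(p)|, so the ratio p^eps / A is below 1. *)
  set (eps := ln A / (2 * ln (INR p))).
  assert (Heps : 0 < eps) by (apply Rdiv_lt_0_compat; lra).
  destruct (Hram eps Heps) as [M HM].
  set (r := Rpower (INR p) eps * / A).
  assert (Hr : 0 <= r < 1).
  { unfold r, Rpower. split.
    - apply Rmult_le_pos; [left; apply exp_pos|left; apply Rinv_0_lt_compat; lra].
    - apply Rmult_lt_reg_r with A; [lra|]. rewrite Rmult_assoc, Rinv_l, Rmult_1_r, Rmult_1_l by lra.
      rewrite <- (exp_ln A) at 1 by lra. apply exp_increasing. unfold eps.
      replace (ln A / (2 * ln (INR p)) * ln (INR p)) with (ln A / 2) by (field; lra). lra. }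
  destruct (psum_exists x z (Rmax M 0) r (Rmax_r _ _) Hr) as [X HX].
  { intros k. unfold x, z. rewrite Cmod_inv by exact Hal. fold A.
    assert (Hpk : (1 <= p ^ k)%nat) by (apply Nat.neq_0_lt_0, Nat.pow_nonzero; lia).
    specialize (HM (p ^ k)%nat Hpk). unfold r. rewrite Rpow_mult_distr.
    replace (Rpower (INR p) eps ^ k) with (Rpower (INR (p ^ k)) eps).
    - rewrite <- Rmult_assoc. apply Rmult_le_compat_r; [apply pow_le; left; apply Rinv_0_lt_compat; lra|].
      eapply Rle_trans; [exact HM|]. apply Rmult_le_compat_r; [left; apply exp_pos|apply Rmax_l].
    - rewrite pow_INR, <- !Rpower_pow by (try apply exp_pos; lra).
      rewrite !Rpower_mult. f_equal. ring. }
  (* At z = 1 / alpha_j(p) the product has a zero factor, so this limit is 0, while the sieved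
     partial sums are all 1. *)
  pose proof (psum_shift_prod alpha (seq 1 m) p x z X HX) as H0.
  rewrite (Cprod_zero _ _ j) in H0.
  - assert (H1 : climit (psum (shift_prod alpha (seq 1 m) p x) z) 1).
    { intros e He. exists 1%nat. intros n Hn.
      assert (E : psum (shift_prod alpha (seq 1 m) p x) z n = 1).
      { destruct n as [|n]; [lia|]. clear Hn. unfold psum. induction n as [|n IH].
        - simpl. rewrite Hdelta. simpl. ring.
        - cbn [csum pred] in *. rewrite IH, Hdelta. simpl. ring. }
      rewrite E. replace (1 - 1)%C with (RtoC 0) by ring. rewrite Cmod_0. exact He. }
    pose proof (climit_unique _ _ _ H0 H1) as E. rewrite Cmult_0_l in E.
    apply (f_equal Re) in E. simpl in E. lra.
  - apply in_seq. lia.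
  - fold al. unfold z. field. exact Hal.
Qed.

(** * Bounds for zeta to the right of 1 *)

Lemma nonneg_of_derive (f f' : R -> R) (b : R) :
  0 <= b -> (forall t, 0 <= t <= b -> is_derive f t (f' t)) -> (forall t, 0 <= t <= b -> 0 <= f' t) ->
  0 <= f 0 -> 0 <= f b.
Proof.
  intros Hb Hd Hf' H0. destruct (Rle_lt_or_eq_dec 0 b Hb) as [Hb'|<-]; [|exact H0].
  destruct (MVT_cor2 f f' 0 b Hb') as [c [E Hc]].
  - intros c Hc. apply is_derive_Reals, Hd, Hc.
  - specialize (Hf' c ltac:(lra)). nra.
Qed.

(* Both sides are errors of the trapezoid rule on [x, x + 1], for u^(-1-d) and for 1/u; the
   factor bounds the ratio (1+d)(2+d)u^(-d)/2 of the second derivatives. *)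
Lemma trapezoid_compare (x d : R) : 1 <= x -> 0 < d ->
  (exp (- d * ln x) / x + exp (- d * ln (x + 1)) / (x + 1)) / 2
    - (exp (- d * ln x) - exp (- d * ln (x + 1))) / d
  <= (1 + (3 * d + d * d) / 2) * ((/ x + / (x + 1)) / 2 - (ln (x + 1) - ln x)).
Proof.
  intros Hx Hd. set (k := 1 + (3 * d + d * d) / 2).
  set (p := exp (- d * ln x)).
  set (h := fun t => k * (t / 2 * (/ x + / (x + t)) - (ln (x + t) - ln x))
    - (t / 2 * (p / x + exp (- d * ln (x + t)) / (x + t)) - (p - exp (- d * ln (x + t))) / d)).
  set (h1 := fun t => k * ((/ x + / (x + t)) / 2 - t / (2 * (x + t) ^ 2) - / (x + t))
    - ((p / x + exp (- d * ln (x + t)) / (x + t)) / 2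
       - (1 + d) * t / 2 * exp (- d * ln (x + t)) / (x + t) ^ 2 - exp (- d * ln (x + t)) / (x + t))).
  set (h2 := fun t => t / (x + t) ^ 3 * (k - (1 + d) * (2 + d) / 2 * exp (- d * ln (x + t)))).
  enough (0 <= h 1) by (unfold h in H; unfold Rdiv in *; lra).
  apply (nonneg_of_derive h h1); [lra| | |].
  - intros t Ht. unfold h, h1. auto_derive; [repeat split; lra|]. field. lra.
  - intros t Ht. apply (nonneg_of_derive h1 h2); [lra| | |].
    + intros u Hu. unfold h1, h2. auto_derive; [repeat split; try lra; nra|]. field. lra.
    + intros u Hu. unfold h2. apply Rmult_le_pos.
      * apply Rdiv_le_0_compat; [lra|]. apply pow_lt. lra.
      * assert (exp (- d * ln (x + u)) <= 1).
        { rewrite <- exp_0. assert (0 <= ln (x + u)) by (rewrite <- ln_1; apply ln_le; lra).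
          destruct (Rle_lt_or_eq_dec (- d * ln (x + u)) 0 ltac:(nra)) as [H1|H1];
            [left; apply exp_increasing; exact H1|right; rewrite H1; reflexivity]. }
        unfold k. nra.
    + unfold h1. rewrite Rplus_0_r. fold p. right. field. lra.
  - unfold h. rewrite Rplus_0_r. fold p. right. field. lra.
Qed.

Definition harm (n : nat) : R := rsum (fun k => / INR k) n.

(** The partial sums of zeta(1 + d). *)
Definition zsum (d : R) (n : nat) : R := rsum (fun k => exp (- (1 + d) * ln (INR k))) n.

Lemma exp_split_ln (d x : R) : 0 < x -> exp (- (1 + d) * ln x) = exp (- d * ln x) / x.
Proof.
  intros Hx. replace (- (1 + d) * ln x) with (- d * ln x + - ln x) by ring.
  rewrite exp_plus, exp_Ropp, exp_ln by exact Hx. reflexivity.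
Qed.

(** [trapezoid_compare] summed over 1..n: the trapezoid error of zeta(1 + d) is majorized by that of
    the harmonic sum, which tends to gamma - 1/2. *)
Lemma zsum_le_harm (d : R) (n : nat) : 0 < d -> (1 <= n)%nat ->
  zsum d n <= / d + 1 / 2 + / INR n / 2
    + (1 + (3 * d + d * d) / 2) * (harm n - ln (INR n) - 1 / 2).
Proof.
  intros Hd Hn. set (k := 1 + (3 * d + d * d) / 2).
  assert (Hk : 1 <= k) by (unfold k; nra).
  assert (H : zsum d n - (1 - exp (- d * ln (INR n))) / d - 1 / 2 - exp (- d * ln (INR n)) / INR n / 2
     <= k * (harm n - ln (INR n) - 1 / 2 - / INR n / 2)).
  { destruct n as [|n]; [lia|]. clear Hn. induction n as [|n IH].
    - unfold zsum, harm. simpl. rewrite ln_1, !Rmult_0_r, exp_0. right. field. lra.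
    - unfold zsum, harm in *. cbn [rsum] in *.
      set (x := INR (S n)) in *.
      assert (Hx : 1 <= x) by (apply (le_INR 1); lia).
      rewrite (S_INR (S n)). fold x. rewrite (exp_split_ln d (x + 1)) by lra.
      pose proof (trapezoid_compare x d Hx Hd) as T. fold k in T.
      rewrite (exp_split_ln d x) in IH by lra.
      unfold Rdiv in *. rewrite (exp_split_ln d x) by lra. unfold Rdiv. lra. }
  assert (Hn0 : 1 <= INR n) by (apply (le_INR 1); exact Hn).
  set (e := exp (- d * ln (INR n))) in *.
  assert (He : 0 < e) by apply exp_pos.
  assert (He1 : e <= 1).
  { unfold e. rewrite <- exp_0. assert (0 <= ln (INR n)) by (rewrite <- ln_1; apply ln_le; lra).
    destruct (Rle_lt_or_eq_dec (- d * ln (INR n)) 0 ltac:(nra)) as [H1|H1];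
      [left; apply exp_increasing; exact H1|right; rewrite H1; reflexivity]. }
  assert (Hi : 0 < / INR n) by (apply Rinv_0_lt_compat; lra).
  assert (E1 : (1 - e) / d <= / d).
  { unfold Rdiv. rewrite <- (Rmult_1_l (/ d)) at 2. apply Rmult_le_compat_r; [left; apply Rinv_0_lt_compat; lra|lra]. }
  assert (E2 : e / INR n / 2 <= / INR n / 2) by (unfold Rdiv; nra).
  assert (0 <= k * (/ INR n / 2)) by (apply Rmult_le_pos; lra).
  lra.
Qed.

Lemma ln_ratio_ge (h : R) : 0 <= h < 1 -> 2 * h <= ln (1 + h) - ln (1 - h).
Proof.
  intros Hh. enough (0 <= ln (1 + h) - ln (1 - h) - 2 * h) by lra.
  apply (nonneg_of_derive (fun t => ln (1 + t) - ln (1 - t) - 2 * t)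
    (fun t => 2 * (t * t) / ((1 + t) * (1 - t)))); [lra| | |].
  - intros t Ht. auto_derive; [split; lra|]. field. lra.
  - intros t Ht. apply Rdiv_le_0_compat; nra.
  - rewrite Rplus_0_r, Rminus_0_r, ln_1. lra.
Qed.

Lemma ln_1_plus_le (x : R) : 0 <= x -> ln (1 + x) <= x.
Proof.
  intros Hx. rewrite <- (ln_exp x) at 2. apply ln_le; [lra|]. apply exp_ineq1_le.
Qed.

(** With ln (n + 1/2) in place of ln n the sequence decreases and converges faster: its first term 1
    - ln (3/2) is already at most 6/10, a bound that [zsum_le_exp] depends on. *)
Lemma harm_sub_ln_lim : exists l, is_lim_seq (fun n => harm n - ln (INR n)) (Finite l) /\ 0 <= l <= 6 / 10.
Proof.
  set (u := fun n => harm (S n) - ln (INR (S n) + 1 / 2)).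
  assert (Hpos : forall n, 1 <= INR (S n)) by (intros n; apply (le_INR 1); lia).
  assert (Hdec : forall n, u (S n) <= u n).
  { intros n. unfold u, harm. cbn [rsum]. rewrite (S_INR (S n)). specialize (Hpos n).
    set (x := INR (S n)) in *.
    pose proof (ln_ratio_ge (/ (2 * (x + 1)))) as H.
    assert (Hh : 0 <= / (2 * (x + 1)) < 1).
    { split; [left; apply Rinv_0_lt_compat; lra|]. rewrite <- Rinv_1. apply Rinv_lt_contravar; lra. }
    specialize (H Hh).
    replace (1 + / (2 * (x + 1))) with ((x + 1 + 1 / 2) / (x + 1)) in H by (field; lra).
    replace (1 - / (2 * (x + 1))) with ((x + 1 / 2) / (x + 1)) in H by (field; lra).
    unfold Rdiv in H. rewrite !ln_mult in H by (try apply Rinv_0_lt_compat; lra).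
    replace (2 * / (2 * (x + 1))) with (/ (x + 1)) in H by (field; lra). unfold Rdiv. lra. }
  assert (Hge : forall n, 0 <= u n).
  { intros n. unfold u. enough (ln (INR (S n) + 1) <= harm (S n)).
    { pose proof (ln_le (INR (S n) + 1 / 2) (INR (S n) + 1)). specialize (Hpos n). lra. }
    induction n as [|n IH].
    - unfold harm. simpl. rewrite Rplus_0_l, Rinv_1. replace (1 + 1) with (1 + 1) by ring.
      apply ln_1_plus_le. lra.
    - unfold harm in *. cbn [rsum] in *. rewrite (S_INR (S n)). specialize (Hpos n). set (x := INR (S n)) in *.
      replace (x + 1 + 1) with ((x + 1) * (1 + / (x + 1))) by (field; lra).
      assert (0 < / (x + 1)) by (apply Rinv_0_lt_compat; lra).
      rewrite ln_mult by lra. pose proof (ln_1_plus_le (/ (x + 1))). lra. }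
  destruct (ex_finite_lim_seq_decr u 0 Hdec Hge) as [l Hl].
  exists l. split; [|split].
  - apply is_lim_seq_incr_1.
    assert (Hz : is_lim_seq (fun n => ln (INR (S n) + 1 / 2) - ln (INR (S n))) 0).
    { apply (is_lim_seq_le_le (fun _ => 0) _ (fun n => / INR (S n))).
      - intros n. specialize (Hpos n). set (x := INR (S n)) in *. split.
        + pose proof (ln_le x (x + 1 / 2)). lra.
        + replace (x + 1 / 2) with (x * (1 + / (2 * x))) by (field; lra).
          assert (0 < / x) by (apply Rinv_0_lt_compat; lra).
          assert (E : / (2 * x) = / x / 2) by (field; lra).
          rewrite ln_mult by lra. pose proof (ln_1_plus_le (/ (2 * x)) ltac:(lra)). lra.
      - apply is_lim_seq_const.
      - apply -> (is_lim_seq_incr_1 (fun n => / INR n)).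
        replace (Finite 0) with (Rbar_inv p_infty) by reflexivity.
        apply is_lim_seq_inv; [apply is_lim_seq_INR|discriminate]. }
    apply (is_lim_seq_ext (fun n => u n + (ln (INR (S n) + 1 / 2) - ln (INR (S n))))).
    + intros n. unfold u. ring.
    + replace l with (l + 0) by ring. apply is_lim_seq_plus'; assumption.
  - apply (is_lim_seq_le (fun _ => 0) u 0 l Hge (is_lim_seq_const 0) Hl).
  - assert (H0 : u 0%nat <= 6 / 10).
    { unfold u, harm. simpl. pose proof (ln_ratio_ge (1 / 5) ltac:(lra)) as H.
      replace (0 + / 1) with 1 by field. 
      replace (1 + 1 / 2) with ((1 + 1 / 5) * / (1 - 1 / 5)) by field.
      rewrite ln_mult, ln_Rinv by lra. lra. }
    apply (is_lim_seq_le u (fun _ => 6 / 10) l (6 / 10)); [|exact Hl|apply is_lim_seq_const].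
    intros n. induction n as [|n IH]; [exact H0|]. specialize (Hdec n). lra.
Qed.

Lemma harm_sum_n_m (n : nat) : sum_n_m (fun k => / INR k) 1 n = harm n.
Proof.
  unfold harm. induction n as [|n IH].
  - rewrite sum_n_m_zero by lia. reflexivity.
  - rewrite sum_n_Sm by lia. rewrite IH. reflexivity.
Qed.

Lemma euler_gamma_lim : is_lim_seq (fun n => harm n - ln (INR n)) (Finite euler_gamma).
Proof.
  destruct harm_sub_ln_lim as [l [Hl _]]. unfold euler_gamma.
  rewrite (Lim_seq_ext _ (fun n => harm n - ln (INR n))) by (intros n; rewrite harm_sum_n_m; reflexivity).
  rewrite (is_lim_seq_unique _ _ Hl). exact Hl.
Qed.

Lemma euler_gamma_bounds : 0 <= euler_gamma <= 6 / 10.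
Proof.
  destruct harm_sub_ln_lim as [l [Hl Hb]]. pose proof euler_gamma_lim as Hg.
  apply is_lim_seq_unique in Hl. apply is_lim_seq_unique in Hg. rewrite Hl in Hg.
  injection Hg as <-. exact Hb.
Qed.

Lemma zsum_incr (d : R) (n k : nat) : zsum d n <= zsum d (n + k).
Proof.
  induction k as [|k IH]; [rewrite Nat.add_0_r; lra|]. rewrite Nat.add_succ_r.
  unfold zsum in *. cbn [rsum]. pose proof (exp_pos (- (1 + d) * ln (INR (S (n + k))))). lra.
Qed.

Lemma exp_ge_quadratic (x : R) : 0 <= x -> 1 + x + x * x / 2 <= exp x.
Proof.
  intros Hx. enough (0 <= exp x - 1 - x - x * x / 2) by lra.
  apply (nonneg_of_derive (fun t => exp t - 1 - t - t * t / 2) (fun t => exp t - 1 - t)); [exact Hx| | |].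
  - intros t _. auto_derive; [trivial|field].
  - intros t _. pose proof (exp_ineq1_le t). lra.
  - rewrite exp_0. lra.
Qed.

(** Multiplied by d and compared with 1 + g d + (g d)^2 / 2, the claim becomes (3 + d)(g - 1/2) <=
    g^2. For d <= 1/2 and g <= 6/10 this holds with little room: 0.35 against 0.36 at the
    extreme. *)
Lemma zsum_le_exp (d : R) (n : nat) : 0 < d <= 1 / 2 -> zsum d n <= exp (euler_gamma * d) / d.
Proof.
  intros Hd. pose proof euler_gamma_bounds as Hg. set (g := euler_gamma) in *.
  set (k := 1 + (3 * d + d * d) / 2).
  assert (H1 : zsum d n <= / d + 1 / 2 + k * (g - 1 / 2)).
  { apply (is_lim_seq_le (fun _ => zsum d n)
     (fun i => / d + 1 / 2 + / INR (n + S i) / 2 + k * (harm (n + S i) - ln (INR (n + S i)) - 1 / 2))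
     (zsum d n) (/ d + 1 / 2 + k * (g - 1 / 2))).
    - intros i. eapply Rle_trans; [apply (zsum_incr d n (S i))|]. apply zsum_le_harm; [lra|lia].
    - apply is_lim_seq_const.
    - assert (Hs : forall (v : nat -> R) (l : R), is_lim_seq v (Finite l) -> is_lim_seq (fun i => v (n + S i)%nat) (Finite l)).
      { intros v l Hv. apply (is_lim_seq_ext (fun i => v (i + (n + 1))%nat)); [intros i; f_equal; lia|].
        apply -> (is_lim_seq_incr_n v (n + 1)%nat). exact Hv. }
      apply is_lim_seq_plus'.
      + replace (Finite (/ d + 1 / 2)) with (Finite (/ d + 1 / 2 + 0 * / 2)) by (f_equal; ring).
        apply is_lim_seq_plus'; [apply is_lim_seq_const|].
        apply (is_lim_seq_mult' _ (fun _ => / 2)); [|apply is_lim_seq_const].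
        apply (Hs (fun i => / INR i)).
        replace (Finite 0) with (Rbar_inv p_infty) by reflexivity.
        apply is_lim_seq_inv; [apply is_lim_seq_INR|discriminate].
      + apply (is_lim_seq_mult' (fun _ => k)); [apply is_lim_seq_const|].
        apply is_lim_seq_minus'; [|apply is_lim_seq_const].
        apply (Hs (fun i => harm i - ln (INR i))). exact euler_gamma_lim. }
  eapply Rle_trans; [exact H1|].
  pose proof (exp_ge_quadratic (g * d) ltac:(nra)) as H2.
  apply Rmult_le_reg_r with d; [lra|].
  replace (exp (g * d) / d * d) with (exp (g * d)) by (field; lra).
  eapply Rle_trans; [|exact H2].
  replace ((/ d + 1 / 2 + k * (g - 1 / 2)) * d)
    with (1 + g * d + (d * d / 2) * ((3 + d) * (g - 1 / 2))) by (unfold k; field; lra).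
  replace (g * d * (g * d) / 2) with ((d * d / 2) * (g * g)) by field.
  assert ((3 + d) * (g - 1 / 2) <= g * g).
  { destruct (Rle_dec g (1 / 2)); nra. }
  assert (0 <= d * d / 2) by nra. nra.
Qed.

(** Comparison with the integral of u^(-1-d). It serves for convergence and, through log(1 + 1/d) <=
    1/d, for the bound m lam / C2 on f. *)
Lemma zsum_le_crude (d : R) (n : nat) : 0 < d -> zsum d n <= 1 + / d.
Proof.
  intros Hd. destruct n as [|n].
  { unfold zsum. simpl. pose proof (Rinv_0_lt_compat d Hd). lra. }
  enough (H : zsum d (S n) <= 1 + (1 - exp (- d * ln (INR (S n)))) / d).
  { eapply Rle_trans; [exact H|]. pose proof (exp_pos (- d * ln (INR (S n)))).
    pose proof (Rinv_0_lt_compat d Hd). unfold Rdiv. nra. }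
  induction n as [|n IH].
  - unfold zsum. simpl. rewrite ln_1, !Rmult_0_r, exp_0. right. field. lra.
  - unfold zsum in *. cbn [rsum] in *. rewrite (S_INR (S n)).
    assert (Hx : 1 <= INR (S n)) by (apply (le_INR 1); lia). set (x := INR (S n)) in *.
    assert (HM : exp (- (1 + d) * ln (x + 1)) <= (exp (- d * ln x) - exp (- d * ln (x + 1))) / d).
    { destruct (MVT_cor2 (fun t => - exp (- d * ln t) / d) (fun t => exp (- (1 + d) * ln t)) x (x + 1))
        as [c [E Hc]]; [lra| |].
      - intros c Hc. apply is_derive_Reals. rewrite exp_split_ln by lra.
        auto_derive; [repeat split; lra|]. field. lra.
      - apply Rle_trans with (exp (- (1 + d) * ln c)).
        + left. apply exp_increasing. pose proof (ln_increasing c (x + 1) ltac:(lra) ltac:(lra)). nra.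
        + replace (x + 1 - x) with 1 in E by ring. rewrite Rmult_1_r in E.
          rewrite <- E. right. field. lra. }
    unfold Rdiv in *. lra.
Qed.

(** * Finite Euler products of zeta by the same sieve *)

Lemma sieve_ones (N n : nat) : (1 <= n)%nat ->
  ((exists q, prime (Z.of_nat q) /\ (q <= N)%nat /\ (n mod q = 0)%nat) ->
     coef_sieve 1 (fun _ _ => RtoC 1) N (fun _ => RtoC 1) n = 0) /\
  (~ (exists q, prime (Z.of_nat q) /\ (q <= N)%nat /\ (n mod q = 0)%nat) ->
     coef_sieve 1 (fun _ _ => RtoC 1) N (fun _ => RtoC 1) n = 1).
Proof.
  revert n. induction N as [|N IH]; intros n Hn; cbn [coef_sieve].
  - split; [|reflexivity]. intros (q & Hq & Hq0 & _). apply prime_ge_2_nat in Hq. lia.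
  - destruct (prime_dec (Z.of_nat (S N))) as [Hp|Hp].
    + pose proof (prime_ge_2_nat _ Hp) as Hp2.
      cbn [seq coef_prod]. unfold coef_mul.
      destruct (Nat.eqb_spec (n mod S N) 0) as [E|E].
      * pose proof (Nat.div_mod n (S N) ltac:(lia)) as D. rewrite E, Nat.add_0_r in D.
        set (k := (n / S N)%nat) in *.
        assert (Hk : (1 <= k)%nat) by (destruct k; lia).
        (* n and k = n / (N + 1) have the same prime divisors up to N, so the two coefficients being
           subtracted agree. *)
        assert (Heq : (exists q, prime (Z.of_nat q) /\ (q <= N)%nat /\ (n mod q = 0)%nat) <->
                      (exists q, prime (Z.of_nat q) /\ (q <= N)%nat /\ (k mod q = 0)%nat)).
        { split; intros (q & Hq & HqN & Hd); exists q; (split; [exact Hq|split; [exact HqN|]]);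
            apply Nat.Lcm0.mod_divide; apply Nat.Lcm0.mod_divide in Hd.
          - destruct Hd as [c Hc].
            assert (HZ : (Z.of_nat q | Z.of_nat (S N) * Z.of_nat k)%Z).
            { exists (Z.of_nat c). rewrite <- !Nat2Z.inj_mul. f_equal. lia. }
            destruct (prime_mult _ Hq _ _ HZ) as [H|H].
            + exfalso. assert (EZ : Z.of_nat q = Z.of_nat (S N)).
              { apply (Zpow_facts.prime_power_prime _ _ 1); [lia|exact Hq|exact Hp|]. rewrite Z.pow_1_r. exact H. }
              apply Nat2Z.inj in EZ. lia.
            + destruct H as [e He]. exists (Z.to_nat e).
              pose proof (prime_ge_2_nat _ Hq). apply Nat2Z.inj.
              assert (0 <= e)%Z by nia. rewrite Nat2Z.inj_mul, Z2Nat.id by assumption. exact He.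
          - rewrite D. apply Nat.divide_mul_r. exact Hd. }
        split; [intros _|intros H; exfalso; apply H; exists (S N); auto].
        destruct (IH n Hn) as [A1 A2]. destruct (IH k Hk) as [B1 B2].
        destruct (classic (exists q, prime (Z.of_nat q) /\ (q <= N)%nat /\ (n mod q = 0)%nat)) as [Hc|Hc].
        -- rewrite A1, B1 by tauto. ring.
        -- rewrite A2, B2 by tauto. ring.
      * destruct (IH n Hn) as [A1 A2]. split.
        -- intros (q & Hq & HqN & Hd). rewrite A1; [ring|].
           exists q. split; [exact Hq|]. split; [|exact Hd].
           destruct (Nat.eq_dec q (S N)) as [->|]; [contradiction|lia].
        -- intros H. rewrite A2; [ring|]. intros (q & Hq & HqN & Hd). apply H. exists q. auto.
    + destruct (IH n Hn) as [A1 A2]. split.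
      * intros (q & Hq & HqN & Hd). apply A1. exists q. split; [exact Hq|]. split; [|exact Hd].
        destruct (Nat.eq_dec q (S N)) as [->|]; [contradiction|lia].
      * intros H. apply A2. intros (q & Hq & HqN & Hd). apply H. exists q. auto.
Qed.

Lemma nps_RtoC (n : nat) (d : R) : nps n (RtoC (1 + d)) = RtoC (exp (- (1 + d) * ln (INR n))).
Proof. unfold nps, cpow. rewrite <- RtoC_opp, <- RtoC_mult, cexp_RtoC. reflexivity. Qed.

Definition plog (d : R) (n : nat) : R :=
  if prime_dec (Z.of_nat n) then - ln (1 - exp (- (1 + d) * ln (INR n))) else 0.

Lemma exp_neg_ln_lt_1 (d : R) (n : nat) : 0 < d -> (2 <= n)%nat ->
  0 < exp (- (1 + d) * ln (INR n)) <= 1 / 2.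
Proof.
  intros Hd Hn. assert (H2 : 2 <= INR n) by (apply (le_INR 2) in Hn; simpl in Hn; lra).
  split; [apply exp_pos|].
  assert (0 < ln (INR n)) by (rewrite <- ln_1; apply ln_increasing; lra).
  apply Rle_trans with (exp (- ln (INR n))).
  - left. apply exp_increasing. nra.
  - rewrite exp_Ropp, exp_ln by lra. unfold Rdiv. rewrite Rmult_1_l. apply Rinv_le_contravar; lra.
Qed.

(** Only one inequality of Euler's product is needed: the sieved zeta series has coefficients 0 or 1
    with first coefficient 1, so zeta(1 + d) times the reciprocal factors up to N is at least 1. *)
Lemma plog_sum_le (d Z : R) (N : nat) :
  0 < d -> (forall n, zsum d n <= Z) -> rsum (plog d) N <= ln Z.
Proof.
  intros Hd HZ. set (s := RtoC (1 + d)).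
  assert (Hdom : forall n, (1 <= n)%nat -> Cmod (RtoC 1 * nps n s) <= exp (- (1 + d) * ln (INR n))).
  { intros n _. unfold s. rewrite nps_RtoC, Cmult_1_l, Cmod_R, Rabs_right; [lra|left; apply exp_pos]. }
  destruct (climit_csum_exists (fun n => RtoC 1 * nps n s)%C _ Z Hdom HZ) as [l Hl].
  assert (HlZ : Cmod l <= Z).
  { apply (climit_Cmod_le _ _ _ 0 Hl). intros n _.
    pose proof (Cmod_csum_diff_le _ (fun n => exp (- (1 + d) * ln (INR n))) 0 n
      (fun i Hi => Hdom i ltac:(lia))) as H. simpl in H.
    replace (csum (fun n => RtoC 1 * nps n s) n - 0)%C with (csum (fun n => RtoC 1 * nps n s)%C n) in H by ring.
    specialize (HZ n). unfold zsum in HZ. lra. }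
  pose proof (dsum_coef_sieve (fun _ _ => RtoC 1) 1 N (fun _ => RtoC 1) s l Hl) as HD.
  set (P := eprod (efactor (fun _ _ => RtoC 1) 1 s) N) in *.
  assert (H1 : 1 <= Cmod (l * P)).
  { apply Rnot_lt_le. intros Hlt.
    destruct (HD (1 - Cmod (l * P)) ltac:(lra)) as [M HM]. specialize (HM (S M) ltac:(lia)).
    set (b := coef_sieve 1 (fun _ _ => RtoC 1) N (fun _ => RtoC 1)) in *.
    assert (Hge : forall k, 1 <= Re (csum (fun n => b n * nps n s)%C (S k))).
    { assert (Hb : forall n, (1 <= n)%nat -> 0 <= Re (b n * nps n s)%C).
      { intros n Hn. destruct (sieve_ones N n Hn) as [A1 A2]. fold b in A1, A2. unfold s. rewrite nps_RtoC.
        pose proof (exp_pos (- (1 + d) * ln (INR n))).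
        destruct (classic (exists q, prime (Z.of_nat q) /\ (q <= N)%nat /\ (n mod q = 0)%nat)) as [Hc|Hc];
          [rewrite A1|rewrite A2]; try assumption; simpl; lra. }
      intros k. induction k as [|k IH].
      - destruct (sieve_ones N 1 ltac:(lia)) as [_ A2]. fold b in A2.
        cbn [csum]. rewrite A2.
        + unfold s. rewrite nps_RtoC. simpl. rewrite ln_1, Rmult_0_r, exp_0. lra.
        + intros (q & Hq & _ & Hd1). apply prime_ge_2_nat in Hq.
          rewrite Nat.mod_small in Hd1 by lia. lia.
      - cbn [csum] in *. specialize (Hb (S (S k)) ltac:(lia)).
        change (Re ((csum (fun n => b n * nps n s) k + b (S k) * nps (S k) s) + b (S (S k)) * nps (S (S k)) s)%C)
          with (Re (csum (fun n => b n * nps n s)%C k + b (S k) * nps (S k) s)%C + Re (b (S (S k)) * nps (S (S k)) s)%C).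
        lra. }
    specialize (Hge M).
    pose proof (re_le_Cmod (csum (fun n => b n * nps n s)%C (S M))) as R1.
    pose proof (Rle_abs (Re (csum (fun n => b n * nps n s)%C (S M)))) as R2.
    pose proof (Cmod_triangle_inv (csum (fun n => b n * nps n s)%C (S M)) (l * P)). lra. }
  assert (HP : Cmod P = exp (- rsum (plog d) N)).
  { unfold P. clear -Hd. induction N as [|N IH]; cbn [eprod rsum].
    - rewrite Cmod_1, Ropp_0, exp_0. reflexivity.
    - rewrite Cmod_mult, IH, Ropp_plus_distr, exp_plus. f_equal. unfold plog.
      destruct (prime_dec (Z.of_nat (S N))) as [Hp|Hp].
      + unfold efactor. cbn [seq]. rewrite Cprod_cons, Cprod_nil, Cmult_1_r.
        unfold s. rewrite nps_RtoC, Cmult_1_l, <- RtoC_minus, Cmod_R, Ropp_involutive.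
        apply prime_ge_2_nat in Hp.
        pose proof (exp_neg_ln_lt_1 d (S N) Hd Hp). rewrite exp_ln, Rabs_right; lra.
      + rewrite Cmod_1, Ropp_0, exp_0. reflexivity. }
  rewrite Cmod_mult, HP in H1.
  assert (HZ0 : 1 <= Z * exp (- rsum (plog d) N)).
  { eapply Rle_trans; [exact H1|]. apply Rmult_le_compat_r; [left; apply exp_pos|exact HlZ]. }
  assert (HZp : 0 < Z).
  { pose proof (exp_pos (- rsum (plog d) N)). nra. }
  apply Rnot_lt_le. intros Hlt.
  rewrite <- (exp_ln Z) in HZ0 by exact HZp. rewrite <- exp_plus in HZ0.
  assert (exp (ln Z + - rsum (plog d) N) < exp 0) by (apply exp_increasing; lra).
  rewrite exp_0 in H. lra.
Qed.

(** * The logarithm of L *)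

Lemma box_convex_segment (D : C -> Prop) (p q : C) (t : R) :
  box_convex D -> D p -> D q -> 0 <= t <= 1 -> D (p + RtoC t * (q - p))%C.
Proof.
  intros HB Hp Hq Ht. apply (HB p q); [exact Hp|exact Hq|].
  assert (K : forall a b, Rmin a b <= a + t * (b - a) <= Rmax a b).
  { intros a b. destruct (Rle_dec a b).
    - rewrite Rmin_left, Rmax_right by lra. nra.
    - rewrite Rmin_right, Rmax_left by lra. nra. }
  split.
  - replace (Re (p + t * (q - p))) with (Re p + t * (Re q - Re p)); [apply K|].
    unfold Re; simpl; ring.
  - replace (Im (p + t * (q - p))) with (Im p + t * (Im q - Im p)); [apply K|].
    unfold Im; simpl; ring.
Qed.

(** g is the primitive of f'/f with value w0 at z0; f e^(-g) has derivative 0 and equals 1 at z0. *)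
Lemma log_exists (D : C -> Prop) (f f1 f2 : C -> C) (z0 w0 : C) :
  Copen D -> box_convex D -> D z0 -> cexp w0 = f z0 ->
  (forall z, D z -> f z <> 0 /\ Cderiv f z (f1 z) /\ Cderiv f1 z (f2 z)) ->
  exists g, g z0 = w0 /\ forall z, D z -> cexp (g z) = f z /\ Cderiv g z (f1 z / f z).
Proof.
  intros HO HB H0 Hw Hf.
  destruct (primitive_exists D (fun z => f1 z / f z)%C z0 HO HB H0) as [F HF].
  { intros z Hz. destruct (Hf z Hz) as (A & B & E). eexists. apply Cderiv_div; eassumption. }
  set (g := fun z => (F z + (w0 - F z0))%C).
  assert (Hg : forall z, D z -> Cderiv g z (f1 z / f z)).
  { intros z Hz. eapply Cderiv_eq; [apply Cderiv_plus; [apply HF; exact Hz|apply Cderiv_const]|ring]. }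
  exists g. split; [unfold g; ring|]. intros z Hz. split; [|apply Hg; exact Hz].
  set (h := fun z => (f z * cexp (- g z))%C).
  assert (Hh : forall u, D u -> Cderiv h u 0).
  { intros u Hu. destruct (Hf u Hu) as (A & B & _). eapply Cderiv_eq.
    - apply Cderiv_mult; [exact B|]. apply (Cderiv_comp (fun v => cexp (- v)) g); [apply Cderiv_cexp_opp|apply Hg; exact Hu].
    - cbv beta. field. exact A. }
  assert (E : Cmod (h z - h z0) <= 0 * Cmod (z - z0)).
  { apply (Cderiv_increment_bound h (fun _ => 0)).
    - intros t Ht. apply Hh, box_convex_segment; assumption.
    - intros t Ht. rewrite Cmod_0. lra. }
  rewrite Rmult_0_l in E.
  assert (E0 : (h z - h z0)%C = 0) by (apply Cmod_eq_0; pose proof (Cmod_ge_0 (h z - h z0)); lra).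
  assert (E1 : h z0 = 1).
  { unfold h, g. replace (F z0 + (w0 - F z0))%C with w0 by ring. rewrite cexp_opp, Hw.
    field. apply (Hf z0 H0). }
  assert (E2 : h z = 1) by (transitivity (h z - h z0 + h z0)%C; [ring|rewrite E0, E1; ring]).
  unfold h in E2. rewrite cexp_opp in E2.
  transitivity (f z * / cexp (g z) * cexp (g z))%C; [rewrite E2; ring|field; apply cexp_neq_0].
Qed.

(** The bound comes without the power series: |1 / (1 - t z)| <= 1 / (1 - t |z|) is integrated along
    the ray to z. Pairing with conj W, where W = l1 z, reduces this to real functions of t. *)
Lemma neg_log_one_minus : exists l1 : C -> C,
  (forall z, Re z < 1 -> cexp (l1 z) = (/ (1 - z))%C /\ Cderiv l1 z (/ (1 - z))) /\
  (forall z, Cmod z < 1 -> Cmod (l1 z) <= - ln (1 - Cmod z)).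
Proof.
  set (D := fun z : C => Re z < 1).
  assert (HO : Copen D).
  { intros z Hz. exists (1 - Re z). unfold D in *. split; [lra|]. intros w Hw.
    pose proof (re_le_Cmod (w - z)) as H. change (Re (w - z)) with (Re w - Re z) in H.
    pose proof (Rle_abs (Re w - Re z)). lra. }
  assert (HB : box_convex D).
  { intros z w u Hz Hw [[_ Hu] _]. unfold D in *. eapply Rle_lt_trans; [exact Hu|]. apply Rmax_case; assumption. }
  assert (Hne : forall z, D z -> (1 - z)%C <> 0).
  { intros z Hz E. apply (f_equal Re) in E. unfold D, Re in *. simpl in *. lra. }
  assert (H0 : D 0) by (unfold D; simpl; lra).
  destruct (log_exists D (fun z => 1 - z)%C (fun _ => 0 - 1)%C (fun _ => 0) 0 0 HO HB H0) as [g [Hg0 Hg]].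
  - rewrite cexp_0. ring.
  - intros z Hz. split; [apply Hne; exact Hz|]. split; [|apply Cderiv_const].
    apply Cderiv_minus; [apply Cderiv_const|apply Cderiv_id].
  - exists (fun z => 0 - g z)%C.
    assert (Hd : forall z, Re z < 1 -> Cderiv (fun z => 0 - g z)%C z (/ (1 - z))).
    { intros z Hz. eapply Cderiv_eq; [apply Cderiv_minus; [apply Cderiv_const|apply Hg; exact Hz]|].
      field. apply Hne. exact Hz. }
    split.
    + intros z Hz. split; [|apply Hd; exact Hz].
      replace (0 - g z)%C with (- g z)%C by ring. rewrite cexp_opp. f_equal. apply Hg. exact Hz.
    + intros z Hz. set (l1 := fun z => (0 - g z)%C) in *. set (r := Cmod z) in *.
      change (Cmod (l1 z) <= - ln (1 - r)). set (W := l1 z).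
      assert (Hr : 0 <= r) by apply Cmod_ge_0.
      assert (Htz : forall t, 0 <= t <= 1 -> Cmod (0 + RtoC t * z) = t * r).
      { intros t Ht. rewrite Cplus_0_l, Cmod_mult, Cmod_R, Rabs_right by lra. reflexivity. }
      assert (Hre : forall t, 0 <= t <= 1 -> Re (0 + RtoC t * z) < 1).
      { intros t Ht. pose proof (re_le_Cmod (0 + RtoC t * z)) as H. rewrite Htz in H by exact Ht.
        pose proof (Rle_abs (Re (0 + RtoC t * z))). nra. }
      assert (Hh : 0 <= Cmod W * - ln (1 - 1 * r) - Re (Cconj W * l1 (0 + RtoC 1 * z))%C).
      { apply (nonneg_of_derive (fun t => Cmod W * - ln (1 - t * r) - Re (Cconj W * l1 (0 + RtoC t * z))%C)
          (fun t => Cmod W * (r / (1 - t * r)) - Re (Cconj W * / (1 - (0 + RtoC t * z)) * z)%C)); [lra| | |].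
        - intros t Ht. apply (is_derive_minus (K := R_AbsRing) (V := R_NormedModule)).
          + auto_derive; [nra|]. field. nra.
          + apply (Cderiv_line_Re (fun w => Cconj W * l1 w)%C). apply Cderiv_scal. apply Hd, Hre, Ht.
        - intros t Ht. pose proof (Hne _ (Hre t Ht)) as Hn.
          pose proof (re_le_Cmod (Cconj W * / (1 - (0 + t * z)) * z)) as H1.
          rewrite !Cmod_mult, Cmod_conj, Cmod_inv in H1 by exact Hn. fold r in H1.
          pose proof (Rle_abs (Re (Cconj W * / (1 - (0 + t * z)) * z))) as H2.
          assert (H3 : / Cmod (1 - (0 + t * z)) <= / (1 - t * r)).
          { apply Rinv_le_contravar; [nra|].
            pose proof (Cmod_triangle_inv 1 (0 + t * z)) as H. rewrite Cmod_1, Htz in H by exact Ht. exact H. }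
          assert (H4 : Cmod W * / Cmod (1 - (0 + t * z)) * r <= Cmod W * / (1 - t * r) * r).
          { apply Rmult_le_compat_r; [exact Hr|]. apply Rmult_le_compat_l; [apply Cmod_ge_0|exact H3]. }
          unfold Rdiv. lra.
        - rewrite Rmult_0_l, Rminus_0_r, ln_1.
          replace (0 + 0 * z)%C with (RtoC 0) by ring. unfold l1. rewrite Hg0. simpl. lra. }
      replace (0 + 1 * z)%C with z in Hh by ring. rewrite Rmult_1_l in Hh. fold W in Hh.
      assert (EW : Re (Cconj W * W)%C = Cmod W * Cmod W).
      { pose proof (Cmod2_alt W) as H. destruct W as [a b]. simpl in *. lra. }
      rewrite EW in Hh. pose proof (Cmod_ge_0 W) as HW.
      destruct (Req_dec (Cmod W) 0) as [E|E].
      * rewrite E. assert (ln (1 - r) <= ln 1) by (apply ln_le; lra). rewrite ln_1 in H. lra.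
      * apply Rmult_le_reg_l with (Cmod W); lra.
Qed.

Lemma climit_cont (f : C -> C) (u : nat -> C) (l : C) : Ccont f l -> climit u l -> climit (fun n => f (u n)) (f l).
Proof.
  intros Hf Hu eps He. destruct (Hf eps He) as [d [Hd H]]. destruct (Hu d Hd) as [N HN]. exists N. auto.
Qed.

Lemma cexp_csum (h : nat -> C) (n : nat) : cexp (csum h n) = Cprod (fun j => cexp (h j)) (seq 1 n).
Proof.
  induction n as [|n IH]; [apply cexp_0|].
  rewrite seq_S, Cprod_app, Cprod_cons, Cprod_nil, <- IH. cbn [csum]. rewrite cexp_plus.
  change (1 + n)%nat with (S n). ring.
Qed.

Lemma Cprod_ext_in {A : Type} (f g : A -> C) (l : list A) :
  (forall x, In x l -> f x = g x) -> Cprod f l = Cprod g l.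
Proof.
  intros H. induction l as [|x l IH]; [reflexivity|]. rewrite !Cprod_cons, IH, H; [reflexivity|left; reflexivity|].
  intros y Hy. apply H. right. exact Hy.
Qed.

Lemma Cderiv_csum (h : nat -> C -> C) (z : C) (n : nat) :
  (forall k, (1 <= k <= n)%nat -> exists l, Cderiv (h k) z l) ->
  exists l, Cderiv (fun w => csum (fun k => h k w) n) z l.
Proof.
  induction n as [|n IH]; intros H.
  - exists 0. cbn [csum]. apply Cderiv_const.
  - destruct IH as [l Hl]; [intros k Hk; apply H; lia|]. destruct (H (S n) ltac:(lia)) as [l' Hl'].
    exists (l + l')%C. apply Cderiv_plus; assumption.
Qed.

Lemma Cmod_csum_le (h : nat -> C) (B : R) (n : nat) :
  (forall k, (1 <= k <= n)%nat -> Cmod (h k) <= B) -> Cmod (csum h n) <= INR n * B.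
Proof.
  induction n as [|n IH]; intros H.
  - simpl. rewrite Cmod_0. lra.
  - cbn [csum]. rewrite S_INR. eapply Rle_trans; [apply Cmod_triangle|].
    specialize (IH ltac:(intros k Hk; apply H; lia)). specialize (H (S n) ltac:(lia)). lra.
Qed.

Lemma neg_ln_one_minus_le (x y : R) : x <= y -> y < 1 -> - ln (1 - x) <= - ln (1 - y).
Proof. intros H H1. pose proof (ln_le (1 - y) (1 - x)). lra. Qed.

Lemma plog_decr (d d' : R) (n : nat) : 0 < d -> d <= d' -> plog d' n <= plog d n.
Proof.
  intros Hd Hdd. unfold plog. destruct (prime_dec (Z.of_nat n)) as [Hp|Hp]; [|lra].
  apply prime_ge_2_nat in Hp. pose proof (exp_neg_ln_lt_1 d n Hd Hp).
  apply neg_ln_one_minus_le; [|lra]. apply exp_le_compat.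
  assert (0 <= ln (INR n)) by (rewrite <- ln_1; apply ln_le; [lra|apply (le_INR 1); lia]). nra.
Qed.

Lemma plog_nonneg (d : R) (n : nat) : 0 < d -> 0 <= plog d n.
Proof.
  intros Hd. unfold plog. destruct (prime_dec (Z.of_nat n)) as [Hp|Hp]; [|lra].
  apply prime_ge_2_nat in Hp. pose proof (exp_neg_ln_lt_1 d n Hd Hp).
  pose proof (neg_ln_one_minus_le 0 (exp (- (1 + d) * ln (INR n)))) as H1.
  rewrite Rminus_0_r, ln_1 in H1. lra.
Qed.

Lemma rsum_scal (c : R) (g : nat -> R) (n : nat) : rsum (fun k => c * g k) n = c * rsum g n.
Proof. induction n as [|n IH]; simpl; [ring|]. rewrite IH. ring. Qed.

(** Summing the logarithms of the Euler factors. Only continuity of the sum is established, by a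
    uniform majorant; that suffices to identify it with the holomorphic logarithm. *)
Lemma euler_log (L : C -> C) (alpha : nat -> nat -> C) (m : nat) :
  (forall p j, prime (Z.of_nat p) -> (1 <= j <= m)%nat -> Cmod (alpha j p) <= 1) ->
  (forall s, 1 < Re s -> climit (eprod (einv alpha m s)) (L s)) ->
  exists ell : C -> C, forall s, 1 < Re s ->
    cexp (ell s) = L s /\ Ccont ell s /\
    (forall Z, (forall n, zsum (Re s - 1) n <= Z) -> Cmod (ell s) <= INR m * ln Z).
Proof.
  intros Hal HL. destruct neg_log_one_minus as (l1 & Hl1 & Hl1b).
  set (phi := fun (n : nat) (s : C) => if prime_dec (Z.of_nat n)
     then csum (fun j => l1 (alpha j n * nps n s)%C) m else 0).
  assert (Hx : forall n j s, 1 < Re s -> prime (Z.of_nat n) -> (1 <= j <= m)%nat ->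
     Cmod (alpha j n * nps n s) <= exp (- (1 + (Re s - 1)) * ln (INR n)) /\
     exp (- (1 + (Re s - 1)) * ln (INR n)) <= 1 / 2).
  { intros n j s Hs Hp Hj. pose proof (prime_ge_2_nat n Hp) as Hn.
    split; [|apply (exp_neg_ln_lt_1 (Re s - 1) n); [lra|exact Hn]].
    rewrite Cmod_mult, Cmod_nps by lia.
    replace (- (1 + (Re s - 1)) * ln (INR n)) with (- (Re s * ln (INR n))) by ring.
    pose proof (exp_pos (- (Re s * ln (INR n)))). pose proof (Hal n j Hp Hj). nra. }
  assert (Hphi : forall n s, 1 < Re s -> Cmod (phi n s) <= INR m * plog (Re s - 1) n).
  { intros n s Hs. unfold phi, plog. destruct (prime_dec (Z.of_nat n)) as [Hp|Hp].
    - apply Cmod_csum_le. intros j Hj. destruct (Hx n j s Hs Hp Hj) as [A B].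
      eapply Rle_trans; [apply Hl1b; lra|]. apply neg_ln_one_minus_le; lra.
    - rewrite Cmod_0. lra. }
  assert (Hderiv : forall n s, 1 < Re s -> exists l, Cderiv (phi n) s l).
  { intros n s Hs. unfold phi. destruct (prime_dec (Z.of_nat n)) as [Hp|Hp].
    - apply (Cderiv_csum (fun j s => l1 (alpha j n * nps n s)%C)). intros j Hj.
      destruct (Hx n j s Hs Hp Hj) as [A B].
      assert (Hre : Re (alpha j n * nps n s)%C < 1).
      { pose proof (re_le_Cmod (alpha j n * nps n s)). pose proof (Rle_abs (Re (alpha j n * nps n s))). lra. }
      eexists. apply (Cderiv_comp l1 (fun s => alpha j n * nps n s)%C); [apply Hl1; exact Hre|].
      apply Cderiv_scal. unfold nps, cpow. apply Cderiv_cexp_comp.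
      apply (Cderiv_ext (fun s => - RtoC (ln (INR n)) * s)%C); [intros; ring|]. apply Cderiv_scal, Cderiv_id.
    - exists 0. apply Cderiv_const. }
  assert (Hsum : forall s, 1 < Re s -> forall Z, (forall n, zsum (Re s - 1) n <= Z) ->
     forall n, rsum (fun n => INR m * plog (Re s - 1) n) n <= INR m * ln Z).
  { intros s Hs Z HZ n. rewrite rsum_scal. apply Rmult_le_compat_l; [apply pos_INR|].
    apply plog_sum_le; [lra|exact HZ]. }
  assert (Hex : forall s, exists l, 1 < Re s -> climit (csum (fun n => phi n s)) l).
  { intros s. destruct (Rlt_dec 1 (Re s)) as [Hs|Hs]; [|exists 0; lra].
    destruct (climit_csum_exists (fun n => phi n s) (fun n => INR m * plog (Re s - 1) n)
      (INR m * ln (1 + / (Re s - 1)))) as [l Hl].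
    - intros n _. apply Hphi, Hs.
    - apply Hsum; [exact Hs|]. intros n. apply zsum_le_crude. lra.
    - exists l. auto. }
  set (ell := fun s => proj1_sig (constructive_indefinite_description _ (Hex s))).
  assert (Hell : forall s, 1 < Re s -> climit (csum (fun n => phi n s)) (ell s))
    by (intros s; exact (proj2_sig (constructive_indefinite_description _ (Hex s)))).
  exists ell. intros s Hs. split; [|split].
  - apply (climit_unique (eprod (einv alpha m s))); [|apply HL; exact Hs].
    eapply climit_ext; [|apply (climit_cont cexp); [eapply Cderiv_Ccont, Cderiv_cexp|apply Hell; exact Hs]].
    intros N. cbv beta. induction N as [|N IH]; cbn [csum eprod]; [apply cexp_0|].
    rewrite cexp_plus, IH. f_equal. unfold phi.
    destruct (prime_dec (Z.of_nat (S N))) as [Hp|Hp]; [|apply cexp_0].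
    rewrite cexp_csum. apply Cprod_ext_in. intros j Hj. apply in_seq in Hj.
    destruct (Hx (S N) j s Hs Hp ltac:(lia)) as [A B]. apply Hl1.
    pose proof (re_le_Cmod (alpha j (S N) * nps (S N) s)). pose proof (Rle_abs (Re (alpha j (S N) * nps (S N) s))). lra.
  (* On Re w > 1 + d0, a neighbourhood of s, the terms at [d0] dominate those at w and make the
     tails uniformly small. *)
  - intros eps He. set (d0 := (Re s - 1) / 2). assert (Hd0 : 0 < d0) by (unfold d0; lra).
    set (G := rsum (fun n => INR m * plog d0 n)).
    assert (HG : ex_finite_lim_seq G).
    { apply (ex_finite_lim_seq_incr _ (INR m * ln (1 + / d0))).
      - intros n. unfold G. cbn [rsum]. pose proof (plog_nonneg d0 (S n) Hd0). pose proof (pos_INR m). nra.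
      - intros n. unfold G. rewrite rsum_scal. apply Rmult_le_compat_l; [apply pos_INR|].
        apply plog_sum_le; [exact Hd0|]. intros i. apply zsum_le_crude. exact Hd0. }
    destruct HG as [g Hg]. apply is_lim_seq_spec in Hg.
    destruct (Hg (mkposreal (eps / 8) ltac:(lra))) as [N HN]. simpl in HN.
    assert (Htail : forall w, 1 + d0 < Re w -> Cmod (ell w - csum (fun n => phi n w) N) <= eps / 4).
    { intros w Hw.
      apply (climit_Cmod_le (fun n => csum (fun n => phi n w) n - csum (fun n => phi n w) N)%C _ _ N).
      - apply climit_minus; [apply Hell; lra|apply climit_const].
      - intros n Hn. replace n with (N + (n - N))%nat by lia. set (k := (n - N)%nat).
        eapply Rle_trans; [apply (Cmod_csum_diff_le _ (fun n => INR m * plog d0 n))|].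
        + intros i _. eapply Rle_trans; [apply Hphi; lra|].
          apply Rmult_le_compat_l; [apply pos_INR|]. apply plog_decr; lra.
        + fold G. pose proof (HN N (Nat.le_refl N)) as A1. pose proof (HN (N + k)%nat ltac:(lia)) as A2.
          apply Rabs_lt_between in A1. apply Rabs_lt_between in A2. lra. }
    destruct (Cderiv_csum phi s N) as [l Hl]; [intros k _; apply Hderiv; exact Hs|].
    destruct (Cderiv_Ccont _ _ _ Hl (eps / 4) ltac:(lra)) as [dl [Hdl Hc]].
    exists (Rmin dl d0). split; [apply Rmin_case; assumption|]. intros w Hw.
    specialize (Hc w (Rlt_le_trans _ _ _ Hw (Rmin_l _ _))).
    assert (Hwd : Cmod (w - s) < d0) by (eapply Rlt_le_trans; [exact Hw|apply Rmin_r]).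
    assert (HRw : 1 + d0 < Re w).
    { pose proof (re_le_Cmod (w - s)) as H. change (Re (w - s)) with (Re w - Re s) in H.
      assert (H2 : Rabs (Re w - Re s) < d0) by lra. apply Rabs_lt_between in H2. unfold d0 in *. lra. }
    pose proof (Htail w HRw) as T1. pose proof (Htail s ltac:(unfold d0 in *; lra)) as T2.
    set (a := csum (fun n => phi n w) N) in *. set (b := csum (fun n => phi n s) N) in *.
    replace (ell w - ell s)%C with ((ell w - a) + (a - b) - (ell s - b))%C by ring.
    eapply Rle_lt_trans; [apply Cmod_triangle_minus|].
    eapply Rle_lt_trans; [apply Rplus_le_compat_r, Cmod_triangle|]. lra.
  - intros Z HZ. apply (climit_Cmod_le _ _ _ 0 (Hell s Hs)). intros n _.
    pose proof (Cmod_csum_diff_le (fun n => phi n s) (fun n => INR m * plog (Re s - 1) n) 0 n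
      (fun i _ => Hphi i s Hs)) as H. cbn [Nat.add csum rsum] in H.
    replace (csum (fun n => phi n s) n - 0)%C with (csum (fun n => phi n s) n) in H by ring.
    pose proof (Hsum s Hs Z HZ n). lra.
Qed.

(** The values of h lie in a discrete subset of the imaginary axis, so h cannot move along the
    segment from p to q. *)
Lemma continuous_log_one_zero (D : C -> Prop) (h : C -> C) (p q : C) :
  box_convex D -> D p -> D q -> (forall z, D z -> Ccont h z) -> (forall z, D z -> cexp (h z) = 1) ->
  h p = 0 -> h q = 0.
Proof.
  intros HB Hp Hq Hc H1 H0.
  assert (Hri : forall z, D z -> Re (h z) = 0 /\ sin (Im (h z)) = 0).
  { intros z Hz. specialize (H1 z Hz). split.
    - apply (f_equal Cmod) in H1. rewrite Cmod_cexp, Cmod_1, <- exp_0 in H1. apply exp_inv in H1. exact H1.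
    - apply (f_equal Im) in H1. unfold cexp in H1. simpl in H1.
      pose proof (exp_pos (Re (h z))). nra. }
  (* Clamping the parameter to [0, 1] gives a function continuous on the whole line, as [IVT_gen]
     demands. *)
  set (cl := fun t => Rmax 0 (Rmin 1 t)).
  assert (Hcl : forall t, 0 <= cl t <= 1).
  { intros t. unfold cl. split; [apply Rmax_l|]. apply Rmax_lub; [lra|apply Rmin_l]. }
  assert (Hlip : forall t u, Rabs (cl t - cl u) <= Rabs (t - u)).
  { assert (Hc3 : forall t, (t <= 0 /\ cl t = 0) \/ (0 <= t <= 1 /\ cl t = t) \/ (1 <= t /\ cl t = 1)).
    { intros t. unfold cl. destruct (Rle_dec t 1).
      - rewrite Rmin_right by lra. destruct (Rle_dec t 0).
        + left. rewrite Rmax_left by lra. lra.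
        + right. left. rewrite Rmax_right by lra. lra.
      - right. right. rewrite Rmin_left, Rmax_right by lra. lra. }
    intros t u. pose proof (Rle_abs (t - u)). pose proof (Rle_abs (- (t - u))) as H'. rewrite Rabs_Ropp in H'.
    pose proof (Rabs_pos (t - u)).
    apply Rabs_le. destruct (Hc3 t) as [?|[?|?]], (Hc3 u) as [?|[?|?]]; lra. }
  set (gam := fun t => (p + RtoC (cl t) * (q - p))%C).
  assert (Hgam : forall t, D (gam t)) by (intros t; apply box_convex_segment; auto).
  set (v := fun t => Im (h (gam t))).
  assert (Hv : continuity v).
  { intros t. apply continuity_pt_filterlim, filterlim_locally. intros eps.
    destruct (Hc (gam t) (Hgam t) eps (cond_pos eps)) as [d [Hd H]].
    pose proof (Cmod_ge_0 (q - p)) as Hqp.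
    assert (Hd' : 0 < d / (Cmod (q - p) + 1)) by (apply Rdiv_lt_0_compat; lra).
    exists (mkposreal _ Hd'). intros u Hu. 
    assert (Hu' : Rabs (u - t) < d / (Cmod (q - p) + 1)) by exact Hu.
    assert (Hg : Cmod (gam u - gam t) < d).
    { replace (gam u - gam t)%C with (RtoC (cl u - cl t) * (q - p))%C
        by (unfold gam; rewrite RtoC_minus; ring).
      rewrite Cmod_mult, Cmod_R.
      apply (Rmult_lt_compat_r (Cmod (q - p) + 1)) in Hu'; [|lra].
      replace (d / (Cmod (q - p) + 1) * (Cmod (q - p) + 1)) with d in Hu' by (field; lra).
      pose proof (Hlip u t). pose proof (Rabs_pos (cl u - cl t)). nra. }
    specialize (H (gam u) Hg).
    change (Rabs (v u - v t) < eps). eapply Rle_lt_trans; [|exact H].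
    apply (im_le_Cmod (h (gam u) - h (gam t))). }
  assert (E0 : gam 0 = p).
  { unfold gam, cl. rewrite (Rmin_right 1 0), Rmax_left by lra. ring. }
  assert (E1 : gam 1 = q).
  { unfold gam, cl. rewrite (Rmin_left 1 1), Rmax_right by lra. ring. }
  assert (V0 : v 0 = 0) by (unfold v; rewrite E0, H0; reflexivity).
  assert (V1 : v 1 = 0).
  (* An intermediate value with 0 < |y| < 1, where the sine does not vanish. *)
  { apply NNPP. intros Hn. set (y := v 1 / (1 + Rabs (v 1))).
    pose proof (Rabs_pos (v 1)) as Hp1.
    assert (Hi : 0 < / (1 + Rabs (v 1))) by (apply Rinv_0_lt_compat; lra).
    assert (Hi1 : / (1 + Rabs (v 1)) <= 1) by (apply (Rmult_le_reg_l (1 + Rabs (v 1))); [lra|rewrite Rinv_r; lra]).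
    destruct (IVT_gen v 0 1 y Hv) as [t [_ Ht]].
    { rewrite V0. unfold y, Rdiv. destruct (Rle_dec 0 (v 1)).
      - rewrite Rmin_left, Rmax_right by lra. nra.
      - rewrite Rmin_right, Rmax_left by lra. nra. }
    destruct (Hri (gam t) (Hgam t)) as [_ Hs]. change (sin (v t) = 0) in Hs. rewrite Ht in Hs.
    assert (Hy1 : Rabs y < 1).
    { unfold y, Rdiv. rewrite Rabs_mult, (Rabs_right (/ _)) by lra.
      apply Rmult_lt_reg_r with (1 + Rabs (v 1)); [lra|]. rewrite Rmult_assoc, Rinv_l by lra. lra. }
    assert (Hy0 : y <> 0).
    { unfold y, Rdiv. apply Rmult_integral_contrapositive_currified; [exact Hn|lra]. }
    pose proof PI2_1 as HPI. apply Rabs_lt_between in Hy1.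
    destruct (Rlt_dec 0 y).
    - pose proof (sin_gt_0 y ltac:(lra) ltac:(lra)). lra.
    - pose proof (sin_gt_0 (- y) ltac:(lra) ltac:(lra)) as H. rewrite sin_neg in H. lra. }
  destruct (Hri q Hq) as [R1 _]. apply C_ext; [exact R1|]. unfold v in V1. rewrite E1 in V1. exact V1.
Qed.

(** Two logarithms are glued: the primitive of L'/L, differentiable on all of D, and the Euler
    product sum, which carries the bound for Re z > 1. They agree at s1, hence on the part of D to
    the right of 1. *)
Lemma log_L_function (L L1 L2 : C -> C) (alpha : nat -> nat -> C) (m : nat) (D : C -> Prop) (s1 : C) :
  (forall p j, prime (Z.of_nat p) -> (1 <= j <= m)%nat -> Cmod (alpha j p) <= 1) ->
  (forall s, 1 < Re s -> climit (eprod (einv alpha m s)) (L s)) ->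
  Copen D -> box_convex D -> D s1 -> 1 < Re s1 ->
  (forall z, D z -> L z <> 0 /\ Cderiv L z (L1 z) /\ Cderiv L1 z (L2 z)) ->
  exists f, twice_diff D f /\
    (forall z, D z -> cexp (f z) = L z /\ Cderiv f z (L1 z / L z)) /\
    (forall z Z, D z -> 1 < Re z -> (forall n, zsum (Re z - 1) n <= Z) -> Cmod (f z) <= INR m * ln Z).
Proof.
  intros Hal HL HO HB Hs1 Hs1' HD.
  destruct (euler_log L alpha m Hal HL) as [ell Hell].
  destruct (log_exists D L L1 L2 s1 (ell s1) HO HB Hs1) as [f [Hf0 Hf]].
  { apply Hell. exact Hs1'. } { exact HD. }
  exists f. split; [|split; [exact Hf|]].
  - exists (fun z => L1 z / L z)%C. eexists. intros z Hz. split; [apply Hf; exact Hz|].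
    destruct (HD z Hz) as (A & B & E). apply (Cderiv_div L1 L z (L2 z) (L1 z)); assumption.
  - intros z Z Hz Hz1 HZ.
    assert (E : f z = ell z).
    { enough (f z - ell z = 0)%C as E.
      { transitivity (f z - ell z + ell z)%C; [ring|rewrite E; ring]. }
      apply (continuous_log_one_zero (fun u => D u /\ 1 < Re u) (fun u => f u - ell u)%C s1 z).
      - intros u w y [Hu Hu1] [Hw Hw1] Hy. split; [apply (HB u w); assumption|].
        destruct Hy as [[Hy _] _]. eapply Rlt_le_trans; [|exact Hy]. apply Rmin_case; assumption.
      - auto.
      - auto.
      - intros u [Hu Hu1] eps He.
        destruct (Cderiv_Ccont _ _ _ (proj2 (Hf u Hu)) (eps / 2) ltac:(lra)) as [d1 [Hd1 H1]].
        destruct (proj1 (proj2 (Hell u Hu1)) (eps / 2) ltac:(lra)) as [d2 [Hd2 H2]].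
        exists (Rmin d1 d2). split; [apply Rmin_case; assumption|]. intros w Hw.
        specialize (H1 w (Rlt_le_trans _ _ _ Hw (Rmin_l _ _))).
        specialize (H2 w (Rlt_le_trans _ _ _ Hw (Rmin_r _ _))).
        replace (f w - ell w - (f u - ell u))%C with ((f w - f u) - (ell w - ell u))%C by ring.
        eapply Rle_lt_trans; [apply Cmod_triangle_minus|]. lra.
      - intros u [Hu Hu1]. replace (f u - ell u)%C with (f u + - ell u)%C by ring.
        rewrite cexp_plus, cexp_opp, (proj1 (Hf u Hu)), (proj1 (Hell u Hu1)).
        field. apply (HD u Hu).
      - rewrite Hf0. ring. }
    rewrite E. apply Hell; assumption.
Qed.

(** * The explicit estimate *)

Lemma ln_le_sub_1 (x : R) : 0 < x -> ln x <= x - 1.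
Proof. intros Hx. pose proof (exp_ineq1_le (ln x)) as H. rewrite exp_ln in H by exact Hx. lra. Qed.

Lemma ln_le_linear (a b : R) : 0 < a -> 0 < b -> ln b <= ln a + (b / a - 1).
Proof.
  intros Ha Hb. pose proof (ln_le_sub_1 (b / a) (Rdiv_lt_0_compat _ _ Hb Ha)) as H.
  unfold Rdiv in H. rewrite ln_mult, ln_Rinv in H by (try apply Rinv_0_lt_compat; assumption).
  unfold Rdiv. lra.
Qed.

Lemma lnln_ge_2 (u : R) : exp (exp 2) <= u -> 2 <= ln (ln u) /\ exp 2 <= ln u.
Proof.
  intros Hu.
  assert (H1 : exp 2 <= ln u).
  { rewrite <- (ln_exp (exp 2)). apply ln_le; [apply exp_pos|exact Hu]. }
  split; [|exact H1]. rewrite <- (ln_exp 2). apply ln_le; [apply exp_pos|exact H1].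
Qed.

Lemma exp_2_ge_3 : 3 <= exp 2.
Proof. pose proof (exp_ineq1_le 2). lra. Qed.

Lemma log_plus_nonneg (u : R) : 0 <= log_plus u.
Proof. apply Rmax_l. Qed.

(** The derivative of log log(c x) is at most 1 / a on [a, b]. For a >= C3 this makes x - C3 log
    log(c x) nondecreasing, so the condition at t0 passes to |t|. *)
Lemma lnln_increment (c a b : R) : 1 <= c -> 0 < a <= b -> 1 <= ln (c * a) ->
  ln (ln (c * b)) <= ln (ln (c * a)) + (b - a) / a.
Proof.
  intros Hc Hab H1. set (q := ln (c * a)) in *.
  assert (Hlb : ln (c * b) <= q + (b / a - 1)).
  { unfold q. pose proof (ln_le_linear (c * a) (c * b) ltac:(nra) ltac:(nra)) as H.
    replace (c * b / (c * a)) with (b / a) in H by (field; lra). exact H. }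
  assert (Hge : q <= ln (c * b)) by (apply ln_le; nra).
  pose proof (ln_le_linear q (ln (c * b)) ltac:(lra) ltac:(lra)) as H.
  assert (Hx : 0 <= b / a - 1).
  { replace (b / a - 1) with ((b - a) / a) by (field; lra). apply Rdiv_le_0_compat; lra. }
  replace ((b - a) / a) with (b / a - 1) by (field; lra).
  assert (ln (c * b) / q - 1 <= b / a - 1); [|lra].
  apply Rmult_le_reg_r with q; [lra|].
  replace ((ln (c * b) / q - 1) * q) with (ln (c * b) - q) by (field; lra). nra.
Qed.

Lemma Rdiv_le_compat (a b x y : R) : 0 <= a <= b -> 0 < y <= x -> a / x <= b / y.
Proof.
  intros Ha Hx. unfold Rdiv. apply Rmult_le_compat; try lra.
  - left. apply Rinv_0_lt_compat. lra.
  - apply Rinv_le_contravar; lra.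
Qed.

(** Monotonicity by ratios instead of derivatives: when log u grows by the factor 1 + x, each
    numerator over log u grows by at most that factor. *)
Lemma K_fun_bounds (d ell C0 C1 u0 u : R) (m : nat) :
  0 < d -> 0 < ell -> 0 < C1 <= 1 -> exp (exp 2) <= u0 <= u ->
  / 4 * d <= K_fun d m ell C0 C1 u <= K_fun d m ell C0 C1 u0.
Proof.
  intros Hd Hell HC1 Hu.
  destruct (lnln_ge_2 u0 ltac:(lra)) as [Hp0 Hl0]. destruct (lnln_ge_2 u ltac:(lra)) as [Hp Hl].
  pose proof exp_2_ge_3 as HE. pose proof euler_gamma_bounds as Hg. pose proof (pos_INR m) as Hm.
  assert (Hll : ln u0 <= ln u) by (apply ln_le; [eapply Rlt_le_trans; [apply exp_pos|apply Hu]|lra]).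
  unfold K_fun. set (g := euler_gamma) in *. set (P := log_plus C0). assert (HP : 0 <= P) by apply log_plus_nonneg.
  set (l0 := ln u0) in *. set (l := ln u) in *.
  pose proof (ln_le l0 l ltac:(lra) Hll) as Hpp.
  set (x := l / l0 - 1).
  assert (Hx : 0 <= x).
  { unfold x. replace (l / l0 - 1) with ((l - l0) / l0) by (field; lra). apply Rdiv_le_0_compat; lra. }
  assert (Hlx : l = l0 * (1 + x)) by (unfold x; field; lra).
  assert (Hpx : ln l <= ln l0 + x) by (apply ln_le_linear; lra).
  set (p0 := ln l0) in *. set (p := ln l) in *.
  (* As p0 >= 2, the triple logarithm grows by at most x / 2, which is absorbed by x times its value
     since that value exceeds 1/2. *)
  assert (Hq0 : / 2 < ln p0) by (eapply Rlt_le_trans; [apply ln_lt_2|apply ln_le; lra]).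
  assert (Hqq : ln p0 <= ln p) by (apply ln_le; lra).
  assert (Hqx : ln p <= ln p0 + x / 2).
  { pose proof (ln_le_linear p0 p ltac:(lra) ltac:(lra)) as H.
    assert (p / p0 - 1 <= x / 2); [|lra].
    apply Rmult_le_reg_r with p0; [lra|].
    replace ((p / p0 - 1) * p0) with (p - p0) by (field; lra). nra. }
  set (Q0 := ln p0) in *. set (Q := ln p) in *.
  assert (HJ : 0 <= ln (1 / C1)).
  { rewrite <- ln_1. apply ln_le; [lra|]. apply Rmult_le_reg_r with C1; [lra|].
    replace (1 / C1 * C1) with 1 by (field; lra). lra. }
  set (J := ln (1 / C1)) in *.
  assert (T1 : 0 <= C1 * d / (2 * p) <= C1 * d / (2 * p0)).
  { split; [apply Rdiv_le_0_compat; nra|]. apply Rdiv_le_compat; nra. }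
  assert (T2 : 0 <= 2 * C1 / p <= 2 * C1 / p0).
  { split; [apply Rdiv_le_0_compat; nra|]. apply Rdiv_le_compat; nra. }
  assert (T3 : 0 <= ell * p / l <= ell * p0 / l0).
  { split; [apply Rdiv_le_0_compat; nra|].
    apply Rmult_le_reg_r with l; [lra|]. replace (ell * p / l * l) with (ell * p) by (field; lra).
    replace (ell * p0 / l0 * l) with (ell * (p0 * (1 + x))) by (rewrite Hlx; field; lra).
    apply Rmult_le_compat_l; [lra|]. nra. }
  assert (T4 : 0 <= P / l <= P / l0).
  { split; [apply Rdiv_le_0_compat; lra|]. apply Rdiv_le_compat; lra. }
  assert (T5 : 0 <= (Q + J + g * C1 / p) / l <= (Q0 + J + g * C1 / p0) / l0).
  { assert (G : 0 <= g * C1 / p <= g * C1 / p0).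
    { split; [apply Rdiv_le_0_compat; nra|]. apply Rdiv_le_compat; nra. }
    split; [apply Rdiv_le_0_compat; lra|].
    apply Rmult_le_reg_r with l; [lra|].
    replace ((Q + J + g * C1 / p) / l * l) with (Q + J + g * C1 / p) by (field; lra).
    replace ((Q0 + J + g * C1 / p0) / l0 * l) with ((Q0 + J + g * C1 / p0) * (1 + x)) by (rewrite Hlx; field; lra).
    nra. }
  assert (T6 : 0 <= INR m / l * (Q + J + g * C1 / p) <= INR m / l0 * (Q0 + J + g * C1 / p0)).
  { replace (INR m / l * (Q + J + g * C1 / p)) with (INR m * ((Q + J + g * C1 / p) / l)) by (field; lra).
    replace (INR m / l0 * (Q0 + J + g * C1 / p0)) with (INR m * ((Q0 + J + g * C1 / p0) / l0)) by (field; lra).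
    split; [apply Rmult_le_pos; lra|]. apply Rmult_le_compat_l; lra. }
  set (Y := ell * p / l + INR m / l * (Q + J + g * C1 / p) + P / l).
  set (Y0 := ell * p0 / l0 + INR m / l0 * (Q0 + J + g * C1 / p0) + P / l0).
  assert (HY : 0 <= Y <= Y0) by (unfold Y, Y0; lra).
  assert (0 <= (1 + 2 * C1 / p) * Y <= (1 + 2 * C1 / p0) * Y0).
  { split; [apply Rmult_le_pos; lra|]. apply Rmult_le_compat; lra. }
  lra.
Qed.

Lemma ln_1_plus_ge (x : R) : 0 <= x -> x / (1 + x) <= ln (1 + x).
Proof.
  intros Hx. pose proof (ln_le_sub_1 (/ (1 + x)) ltac:(apply Rinv_0_lt_compat; lra)) as H.
  rewrite ln_Rinv in H by lra. replace (x / (1 + x)) with (1 - / (1 + x)) by (field; lra). lra.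
Qed.

(** The origin of the first correction factor in [b1_fun]: the cost of replacing log U by log(c t).
    With x = log(c t) / log v - 1, the extra logarithm grows by at most the factor 1 + x compared
    with its value at v. *)
Lemma log_height_ratio (C3 v t c : R) :
  1 <= C3 -> exp (exp 2) <= v -> v <= t -> 1 <= c ->
  ln (c * (t + C3 * ln (ln (c * t)) + 3 / 2))
  <= ln (c * t) * (1 + ln (1 + (C3 * ln (ln v) + 3 / 2) / v) / ln v).
Proof.
  intros HC3 Hv Ht Hc.
  assert (Hv0 : 0 < v) by (eapply Rlt_le_trans; [apply exp_pos|exact Hv]).
  destruct (lnln_ge_2 v Hv) as [Hp0 Hq0]. pose proof exp_2_ge_3 as HE.
  assert (Hqq : ln v <= ln (c * t)) by (apply ln_le; nra).
  set (q0 := ln v) in *. set (q := ln (c * t)) in *.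
  assert (Hpp : ln q0 <= ln q) by (apply ln_le; lra).
  pose proof (ln_le_linear q0 q ltac:(lra) ltac:(lra)) as Hpx.
  set (p0 := ln q0) in *. set (p := ln q) in *.
  set (x := q / q0 - 1) in *.
  assert (Hx : 0 <= x).
  { unfold x. replace (q / q0 - 1) with ((q - q0) / q0) by (field; lra). apply Rdiv_le_0_compat; lra. }
  set (k0 := (C3 * p0 + 3 / 2) / v). set (k := (C3 * p + 3 / 2) / v).
  (* From log log v >= 2; it turns the additive growth (C3 / v) x of k into relative growth of at
     most k0 x. *)
  assert (Hk0 : 2 * (C3 / v) <= k0).
  { unfold k0. replace (2 * (C3 / v)) with ((2 * C3) / v) by (field; lra). apply Rdiv_le_compat; nra. }
  assert (HCv : 0 < C3 / v) by (apply Rdiv_lt_0_compat; lra).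
  assert (Hk : k <= k0 + (C3 / v) * x).
  { unfold k, k0. replace ((C3 * p0 + 3 / 2) / v + C3 / v * x) with ((C3 * (p0 + x) + 3 / 2) / v) by (field; lra).
    assert (C3 * p <= C3 * (p0 + x)) by (apply Rmult_le_compat_l; lra).
    assert (0 <= C3 * p) by (apply Rmult_le_pos; lra).
    apply Rdiv_le_compat; lra. }
  assert (Hkpos : 0 <= k) by (unfold k; apply Rdiv_le_0_compat; nra).
  assert (E1 : ln (c * (t + C3 * p + 3 / 2)) <= q + ln (1 + k)).
  { assert (0 <= C3 * p) by (apply Rmult_le_pos; lra).
    unfold q. rewrite <- ln_mult by (try apply Rmult_lt_0_compat; lra).
    apply ln_le; [apply Rmult_lt_0_compat; lra|].
    assert (C3 * p + 3 / 2 <= t * k).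
    { unfold k. replace (t * ((C3 * p + 3 / 2) / v)) with ((C3 * p + 3 / 2) * (t / v)) by (field; lra).
      assert (1 <= t / v).
      { apply Rmult_le_reg_r with v; [lra|]. replace (t / v * v) with t by (field; lra). lra. }
      assert (0 <= C3 * p + 3 / 2) by nra. nra. }
    replace (c * t * (1 + k)) with (c * (t + t * k)) by ring.
    apply Rmult_le_compat_l; lra. }
  assert (E2 : ln (1 + k) <= ln (1 + k0) * (1 + x)).
  { pose proof (ln_le_linear (1 + k0) (1 + k) ltac:(lra) ltac:(lra)) as H.
    pose proof (ln_1_plus_ge k0 ltac:(lra)) as H2.
    assert (H3 : (1 + k) / (1 + k0) - 1 <= k0 / (1 + k0) * x).
    { apply Rmult_le_reg_r with (1 + k0); [lra|].
      replace (((1 + k) / (1 + k0) - 1) * (1 + k0)) with (k - k0) by (field; lra).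
      replace (k0 / (1 + k0) * x * (1 + k0)) with (k0 * x) by (field; lra). nra. }
    nra. }
  eapply Rle_trans; [exact E1|].
  assert (E3 : ln (1 + k0) * (1 + x) = q * (ln (1 + k0) / q0)) by (unfold x; field; lra).
  lra.
Qed.

(** The origin of [R_fun]. For large radii the exponent is nearly the linear ratio u / (1/2) = 2 u;
    shifting the line Re = 1 to 1 + C2/lam contributes 2 C2, and curvature contributes 1 / (2 C3),
    both over lam. *)
Lemma three_circles_exponent (C2 C3 lam lam' rz r1 : R) :
  0 < C2 -> 1 <= C3 -> 2 <= lam' <= lam -> r1 = C3 * lam - 1 / 2 ->
  1 / 2 + C2 / lam <= rz <= 1 + C2 / lam ->
  ln ((r1 + (1 + C2 / lam - rz)) / r1) / ln ((r1 + 1 / 2) / r1)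
  <= 2 * (1 - rz) + (2 * C2 + 1 / (2 * C3)) * / (1 - 1 / (4 * C3 * lam')) / lam.
Proof.
  intros HC2 HC3 Hlam Hr1 Hz. set (u := 1 + C2 / lam - rz).
  assert (Hu : 0 <= u <= 1 / 2) by (unfold u; lra).
  assert (HCl : 2 <= C3 * lam) by nra.
  assert (Hr : 3 / 2 <= r1) by lra.
  assert (N : ln ((r1 + u) / r1) <= u / r1).
  { replace ((r1 + u) / r1) with (1 + u / r1) by (field; lra). apply ln_1_plus_le.
    apply Rdiv_le_0_compat; lra. }
  (* log((1 + h) / (1 - h)) >= 2 h with h = 1 / (4 r1 + 1), for which (1 + h) / (1 - h) = (r1 + 1/2)
     / r1. *)
  assert (Dn : 2 / (4 * r1 + 1) <= ln ((r1 + 1 / 2) / r1)).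
  { pose proof (ln_ratio_ge (/ (4 * r1 + 1))) as H.
    assert (Hh : 0 <= / (4 * r1 + 1) < 1).
    { split; [left; apply Rinv_0_lt_compat; lra|].
      apply Rmult_lt_reg_l with (4 * r1 + 1); [lra|]. rewrite Rinv_r; lra. }
    specialize (H Hh).
    replace (1 + / (4 * r1 + 1)) with ((4 * r1 + 2) / (4 * r1 + 1)) in H by (field; lra).
    replace (1 - / (4 * r1 + 1)) with (4 * r1 / (4 * r1 + 1)) in H by (field; lra).
    unfold Rdiv in H. rewrite !(ln_mult _ (/ (4 * r1 + 1))) in H by (try apply Rinv_0_lt_compat; lra).
    replace ((r1 + 1 / 2) / r1) with ((4 * r1 + 2) * / (4 * r1)) by (field; lra).
    rewrite ln_mult, ln_Rinv by (try apply Rinv_0_lt_compat; lra).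
    unfold Rdiv. lra. }
  assert (Dp : 0 < 2 / (4 * r1 + 1)) by (apply Rdiv_lt_0_compat; lra).
  assert (Hur : 0 <= u / r1) by (apply Rdiv_le_0_compat; lra).
  assert (HQ : ln ((r1 + u) / r1) / ln ((r1 + 1 / 2) / r1) <= (u / r1) / (2 / (4 * r1 + 1))).
  { apply Rmult_le_reg_r with (ln ((r1 + 1 / 2) / r1)); [lra|].
    unfold Rdiv at 1. rewrite Rmult_assoc, Rinv_l, Rmult_1_r by lra.
    eapply Rle_trans; [exact N|].
    apply Rle_trans with ((u / r1) / (2 / (4 * r1 + 1)) * (2 / (4 * r1 + 1))).
    - right. field. lra.
    - apply Rmult_le_compat_l; [|exact Dn]. apply Rdiv_le_0_compat; lra. }
  eapply Rle_trans; [exact HQ|].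
  replace ((u / r1) / (2 / (4 * r1 + 1))) with (2 * u + u / (2 * r1)) by (field; lra).
  assert (HW : u / (2 * r1) <= 1 / (2 * C3) / lam).
  { replace (1 / (2 * C3) / lam) with ((1 / 2) / (C3 * lam)) by (field; nra).
    apply Rdiv_le_compat; lra. }
  set (w := 1 / (4 * C3 * lam')).
  assert (Hw : 0 < w <= 1 / 8).
  { unfold w. split; [apply Rdiv_lt_0_compat; nra|]. apply Rdiv_le_compat; nra. }
  assert (HI : 1 <= / (1 - w)).
  { apply Rmult_le_reg_l with (1 - w); [lra|]. rewrite Rinv_r; lra. }
  assert (HB : 0 <= 2 * C2 + 1 / (2 * C3)).
  { assert (0 < 1 / (2 * C3)) by (apply Rdiv_lt_0_compat; lra). lra. }
  assert (HF : (2 * C2 + 1 / (2 * C3)) / lam <= (2 * C2 + 1 / (2 * C3)) * / (1 - w) / lam).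
  { unfold Rdiv at 1 3. apply Rmult_le_compat_r; [left; apply Rinv_0_lt_compat; lra|]. nra. }
  replace ((2 * C2 + 1 / (2 * C3)) / lam) with (2 * (C2 / lam) + 1 / (2 * C3) / lam) in HF by (field; lra).
  unfold u in *. lra.
Qed.

(** * Regularity of L away from 1, and the zero-free domain *)

Lemma twice_diff_pow (D : C -> Prop) (f : C -> C) (k : nat) :
  twice_diff D f -> twice_diff D (fun z => f z ^ k)%C.
Proof.
  intros Hf. induction k as [|k IH].
  - destruct (twice_diff_const D 1) as (f1 & f2 & H). exists f1, f2. exact H.
  - destruct (twice_diff_mult D _ _ Hf IH) as (f1 & f2 & H). exists f1, f2. exact H.
Qed.

Lemma continuation_twice_diff (L : C -> C) :
  continuation L -> exists L1 L2, forall z, z <> RtoC 1 -> Cderiv L z (L1 z) /\ Cderiv L1 z (L2 z).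
Proof.
  intros (k & F & HF & _ & HFL).
  assert (Hex1 : forall z, exists l, Cderiv F z l).
  { intros z. destruct (HF z) as [l Hl]. exists l. apply Cderiv_is_derive. exact Hl. }
  set (F1 := fun z => proj1_sig (constructive_indefinite_description _ (Hex1 z))).
  assert (HF1 : forall z, Cderiv F z (F1 z))
    by (intros z; exact (proj2_sig (constructive_indefinite_description _ (Hex1 z)))).
  assert (Hex2 : forall z, exists l, Cderiv F1 z l) by (intros z; apply (entire_derive_derive F F1 HF1)).
  set (F2 := fun z => proj1_sig (constructive_indefinite_description _ (Hex2 z))).
  assert (HF2 : forall z, Cderiv F1 z (F2 z))
    by (intros z; exact (proj2_sig (constructive_indefinite_description _ (Hex2 z)))).
  (* z - 1 is written in the shape [p + q * z] expected by [twice_diff_affine]. *)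
  assert (Hpow : forall z, z <> RtoC 1 -> ((- (1) + 1 * z) ^ k)%C <> 0).
  { intros z Hz. apply Cmod_gt_0. rewrite Cmod_pow. apply pow_lt, Cmod_gt_0.
    intros E. apply Hz. replace z with (1 + (- (1) + 1 * z))%C by ring. rewrite E. ring. }
  assert (HG : twice_diff (fun z => z <> 1) (fun z => F z * / (- (1) + 1 * z) ^ k)%C).
  { apply twice_diff_mult; [exists F1, F2; auto|].
    apply (twice_diff_comp _ (fun z => z <> 0) Cinv (fun z => (- (1) + 1 * z) ^ k)%C);
      [apply twice_diff_Cinv| |exact Hpow].
    apply twice_diff_pow, twice_diff_affine. }
  destruct HG as (L1 & L2 & HG). exists L1, L2. intros z Hz. destruct (HG z Hz) as [A B].
  split; [|exact B].
  assert (Hz0 : (z - 1)%C <> 0).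
  { intros E. apply Hz. replace z with (z - 1 + 1)%C by ring. rewrite E. ring. }
  apply (Cderiv_local (fun z => F z * / (- (1) + 1 * z) ^ k)%C L z _ (Cmod (z - 1)));
    [apply Cmod_gt_0; exact Hz0| |exact A].
  intros w Hw. assert (Hw1 : w <> RtoC 1).
  { intros ->. rewrite Cmod_minus_sym in Hw. lra. }
  rewrite (HFL w Hw1). specialize (Hpow w Hw1).
  replace (- (1) + 1 * w)%C with (w - 1)%C in * by ring. field. exact Hpow.
Qed.

Lemma rectangle_open (b y W : R) : Copen (fun z => b < Re z /\ Rabs (Im z - y) < W).
Proof.
  intros z [H1 H2]. exists (Rmin (Re z - b) (W - Rabs (Im z - y))).
  split; [apply Rmin_case; lra|]. intros w Hw.
  assert (A1 : Cmod (w - z) < Re z - b) by (eapply Rlt_le_trans; [exact Hw|apply Rmin_l]).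
  assert (A2 : Cmod (w - z) < W - Rabs (Im z - y)) by (eapply Rlt_le_trans; [exact Hw|apply Rmin_r]).
  pose proof (re_le_Cmod (w - z)) as R1. pose proof (im_le_Cmod (w - z)) as R2.
  change (Re (w - z)) with (Re w - Re z) in R1. change (Im (w - z)) with (Im w - Im z) in R2.
  split.
  - assert (A3 : Rabs (Re w - Re z) < Re z - b) by lra. apply Rabs_lt_between in A3. lra.
  - replace (Im w - y) with ((Im w - Im z) + (Im z - y)) by ring.
    pose proof (Rabs_triang (Im w - Im z) (Im z - y)). lra.
Qed.

Lemma rectangle_box_convex (b y W : R) : box_convex (fun z => b < Re z /\ Rabs (Im z - y) < W).
Proof.
  intros z w u [Hz1 Hz2] [Hw1 Hw2] [[Hu1 _] Hu2]. apply Rabs_lt_between in Hz2. apply Rabs_lt_between in Hw2.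
  split.
  - eapply Rlt_le_trans; [|exact Hu1]. apply Rmin_case; assumption.
  - apply Rabs_lt_between.
    assert (y - W < Rmin (Im z) (Im w)) by (apply Rmin_case; lra).
    assert (Rmax (Im z) (Im w) < y + W) by (apply Rmax_case; lra). lra.
Qed.

Lemma Re_Im_le_Cmod (w z : C) : Rabs (Re w - Re z) <= Cmod (w - z) /\ Rabs (Im w - Im z) <= Cmod (w - z).
Proof. split; [apply (re_le_Cmod (w - z))|apply (im_le_Cmod (w - z))]. Qed.

Lemma le_mult_l (a b : R) : 1 <= a -> 0 <= b -> b <= a * b.
Proof. intros; nra. Qed.

Theorem corollary4 (L : C -> C) (m : nat) (d C0 ell c T : R)
  (C1 C2 C3 C4 t0 T1 T2 : R) (s : C)
  (hL : SP L) (hm : polynomial_Euler_product L m)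
  (hd : has_degree L d) (hd0 : 0 < d)
  (hC0 : 0 < C0) (hell : 0 < ell) (hc : 1 <= c) (hT : exp 1 <= T)
  (hgrowth : forall w : C, T <= Rabs (Im w) -> 1 / 2 <= Re w -> L w <> RtoC 0 ->
     ln (Cmod (L w)) <= / 4 * d * ln (c * Rabs (Im w))
                        + ell * ln (ln (c * Rabs (Im w))) + log_plus C0)
  (hC1 : 0 < C1 <= 1) (hC2 : 0 < C2 <= 2 * C1) (hC3 : 1 <= C3)
  (hC4 : 0 < C4 <= C2 / 2.0001)
  (ht : t0 <= Rabs (Im s)) (ht0 : T1 <= t0)
  (hT1 : Rmax (exp (exp (2 * (1.00006 * C2 + C4))))
           (Rmax (exp (4 * INR m / d)) (Rmax C3 (exp (exp 2)))) + 1 <= T1)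
  (ht0T2 : T2 <= t0 - C3 * ln (ln (c * t0)) - 3 / 2)
  (hT2 : Rmax (T + 1) (exp (exp 2)) <= T2)
  (hT1' : 1 <= T1 - 2 * C3 * ln (ln T1))
  (hzero : forall z : C, 1 / 2 < Re z ->
     Rabs (Im z - Im s) <= C3 * ln (ln (c * (Rabs (Im s) + 1))) + 3 ->
     L z <> RtoC 0)
  (hsigma : 1 / 2 + (1.00006 * C2 + C4) / ln (ln (c * Rabs (Im s))) <= Re s
            <= 1 + C4 / ln (ln (c * Rabs (Im s)))) :
  let b2 := b1_fun d m ell C0 C1 C3 (T1 - 1) T2 in
  let R2 := R_fun C2 C3 (T1 - 1) in
  let a2 := 1.0002 * INR m / (C2 * C4)
            * exp (2 * C4 * (1 + log_plus b2 / ln (ln T1))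
                   + (1 + log_plus b2 / ln (ln (T1 - 1))) * R2) in
  Cmod (C_derive L s / L s)%C
    <= a2 * Rpower (b2 * ln (c * Rabs (Im s))) (2 * (1 - Re s))
       * (ln (ln (c * Rabs (Im s)))) ^ 2.
Proof.
  intros b2 R2 a2.
  apply (Rplus_le_compat_r (- (1))) in hT1.
  rewrite Rplus_assoc, Rplus_opp_r, Rplus_0_r in hT1. fold (T1 - 1) in hT1.
  assert (M1 : exp (exp (2 * (1.00006 * C2 + C4))) <= T1 - 1) by (eapply Rle_trans; [apply Rmax_l|exact hT1]).
  apply (Rle_trans _ _ _ (Rmax_r _ _)) in hT1.
  assert (M2 : exp (4 * INR m / d) <= T1 - 1) by (eapply Rle_trans; [apply Rmax_l|exact hT1]).
  assert (M34 : Rmax C3 (exp (exp 2)) <= T1 - 1) by (eapply Rle_trans; [apply Rmax_r|exact hT1]).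
  assert (M3 : C3 <= T1 - 1) by (eapply Rle_trans; [apply Rmax_l|exact M34]).
  assert (M4 : exp (exp 2) <= T1 - 1) by (eapply Rle_trans; [apply Rmax_r|exact M34]).
  assert (N1 : T + 1 <= T2) by (eapply Rle_trans; [apply Rmax_l|exact hT2]).
  assert (N2 : exp (exp 2) <= T2) by (eapply Rle_trans; [apply Rmax_r|exact hT2]).
  clear hT1 hT2 M34.
  set (v := T1 - 1) in *. set (t := Rabs (Im s)) in *. set (tau := c * t) in *.
  assert (Hvt : v + 1 <= t) by (unfold v; lra).
  pose proof exp_2_ge_3 as HE2.
  assert (HEE : 4 <= exp (exp 2)) by (pose proof (exp_ineq1_le (exp 2)); lra).
  assert (Hv0 : 3 <= v) by lra.
  assert (Htau : t <= tau) by (apply le_mult_l; lra).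
  destruct (lnln_ge_2 v M4) as [Lv Lv'].
  destruct (lnln_ge_2 T1 ltac:(unfold v in *; lra)) as [LT LT'].
  destruct (lnln_ge_2 tau ltac:(lra)) as [Llam Ltau'].
  set (lam := ln (ln tau)) in *. set (lam' := ln (ln v)) in *.
  assert (Hlam1 : ln (ln T1) <= lam).
  { apply ln_le; [lra|]. apply ln_le; unfold v in *; lra. }
  assert (Hlam2 : lam' <= ln (ln T1)).
  { apply ln_le; [lra|]. apply ln_le; unfold v in *; lra. }
  (* This makes C2 / lam at most 1/2, so that the line Re = 1/2 + C2 / lam does not pass 1. *)
  assert (HC2lam : 2 * (1.00006 * C2 + C4) <= lam').
  { rewrite <- (ln_exp (2 * (1.00006 * C2 + C4))). apply ln_le; [apply exp_pos|].
    rewrite <- (ln_exp (exp _)). apply ln_le; [apply exp_pos|exact M1]. }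
  assert (HmR : 1 <= INR m) by (destruct hm as [hm1 _]; apply (le_INR 1); exact hm1).
  set (dl := C2 / lam). set (rho := C4 / lam).
  assert (Hdl : 0 < dl <= 1 / 2).
  { unfold dl. split; [apply Rdiv_lt_0_compat; lra|].
    apply Rmult_le_reg_r with lam; [lra|]. replace (C2 / lam * lam) with C2 by (field; lra). lra. }
  assert (HC41 : C4 <= 1).
  { destruct hC4 as [_ h]. apply Rle_trans with (1 := h). apply Rmult_le_reg_r with 2.0001; [lra|].
    replace (C2 / 2.0001 * 2.0001) with C2 by (field; lra). lra. }
  assert (Hrho : 0 < rho <= 1 / 2).
  { unfold rho. split; [apply Rdiv_lt_0_compat; lra|].
    apply Rmult_le_reg_r with lam; [lra|]. replace (C4 / lam * lam) with C4 by (field; lra). lra. }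
  (* The vertical reach: at most 1/2 for Cauchy's disc, C3 lam for the outer circle of the three,
     and at most 1 for the Borel-Caratheodory discs. *)
  set (H := C3 * lam + 3 / 2).
  assert (HC3lam : 2 <= C3 * lam) by (apply Rle_trans with lam; [lra|apply le_mult_l; lra]).
  set (U := c * (t + H)).
  assert (Hlow : T2 <= t - H).
  { assert (h1 : lam <= ln (ln (c * t0)) + (t - t0) / t0).
    { apply lnln_increment; [exact hc|unfold v in *; lra|].
      apply Rle_trans with (ln v); [lra|]. apply ln_le; [lra|].
      apply Rle_trans with t0; [unfold v in *; lra|apply le_mult_l; unfold v in *; lra]. }
    assert (h2 : C3 * ((t - t0) / t0) <= t - t0).
    { replace (C3 * ((t - t0) / t0)) with ((C3 / t0) * (t - t0)) by (field; unfold v in *; lra).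
      assert (C3 / t0 <= 1).
      { apply Rmult_le_reg_r with t0; [unfold v in *; lra|]. replace (C3 / t0 * t0) with C3 by (field; unfold v in *; lra).
        unfold v in *; lra. }
      rewrite <- (Rmult_1_l (t - t0)) at 2. apply Rmult_le_compat_r; lra. }
    apply (Rmult_le_compat_l C3) in h1; [|lra]. unfold H. lra. }
  (* The half height of the zero-free box. H < W lets all discs fit in; W < t keeps the box off the
     real axis and so away from s = 1. *)
  set (W := C3 * ln (ln (c * (t + 1))) + 3) in *.
  assert (HHW : H < W).
  { unfold H, W. assert (lam <= ln (ln (c * (t + 1)))).
    { apply ln_le; [lra|]. apply ln_le; [lra|]. apply Rmult_le_compat_l; lra. }
    assert (C3 * lam <= C3 * ln (ln (c * (t + 1)))) by (apply Rmult_le_compat_l; lra). lra. }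
  assert (HWt : W < t).
  { assert (h1 : ln (ln (c * (t + 1))) <= lam + (t + 1 - t) / t).
    { apply lnln_increment; [exact hc|lra|]. fold tau. lra. }
    assert (h2 : C3 * ((t + 1 - t) / t) <= 1).
    { replace (C3 * ((t + 1 - t) / t)) with (C3 / t) by (field; lra).
      apply Rmult_le_reg_r with t; [lra|]. replace (C3 / t * t) with C3 by (field; lra). lra. }
    apply (Rmult_le_compat_l C3) in h1; [|lra]. unfold W, H in *.
    pose proof (exp_ineq1_le (exp 2)). lra. }
  set (D := fun z : C => 1 / 2 < Re z /\ Rabs (Im z - Im s) < W).
  assert (HDne : forall z, D z -> L z <> 0) by (intros z [h1 h2]; apply hzero; lra).
  assert (HD1 : forall z, D z -> z <> RtoC 1).
  { intros z [_ h2] ->. simpl in h2. unfold Rminus in h2. rewrite Rplus_0_l, Rabs_Ropp in h2. fold t in h2. lra. }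
  destruct hL as ((a & Hser & Hram) & Hcont & _).
  destruct (continuation_twice_diff L Hcont) as (L1 & L2 & HL12).
  destruct hm as (Hm1 & alpha & Halpha).
  assert (Hnz : forall z, 1 < Re z -> forall p j, prime (Z.of_nat p) -> (1 <= j <= m)%nat ->
     (1 - alpha j p * nps p z)%C <> 0) by (intros z Hz; apply (Halpha z Hz)).
  assert (Hlim : forall z, 1 < Re z -> climit (eprod (einv alpha m z)) (L z)).
  { intros z Hz. destruct (Halpha z Hz) as [_ h]. apply is_Clim_seq_climit in h.
    eapply climit_ext; [|exact h]. intros N. apply Cprod_primes_upto. }
  pose proof (alpha_le_1 a L alpha m Hser Hram Hnz Hlim) as Hal.
  assert (HW0 : 0 < W) by (unfold H in *; lra).
  destruct (log_L_function L L1 L2 alpha m D (2, Im s) Hal Hlim (rectangle_open _ _ _) (rectangle_box_convex _ _ _))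
    as (f & Hf2 & HfL & Hfb).
  { unfold D; simpl. rewrite Rminus_diag, Rabs_R0. lra. }
  { simpl. lra. }
  { intros z Hz. split; [apply HDne; exact Hz|]. apply HL12, HD1, Hz. }
  (* m log zeta(1 + dl) <= m log(1 + 1/dl) <= m / dl. *)
  assert (HfM : forall z, D z -> 1 + dl <= Re z -> Cmod (f z) <= INR m * lam / C2).
  { intros z Hz Hre. eapply Rle_trans; [apply (Hfb z (1 + / (Re z - 1)) Hz ltac:(lra))|].
    - intros n. apply zsum_le_crude. lra.
    - replace (INR m * lam / C2) with (INR m * / dl) by (unfold dl; field; lra).
      apply Rmult_le_compat_l; [lra|].
      eapply Rle_trans; [apply ln_1_plus_le; left; apply Rinv_0_lt_compat; lra|].
      apply Rinv_le_contravar; lra. }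
  assert (HU : exp (exp 2) <= T2 <= U).
  { split; [exact N2|]. unfold U. assert (0 <= H) by (unfold H; lra).
    apply Rle_trans with (1 * (t + H)); [lra|]. apply Rmult_le_compat_r; lra. }
  destruct (lnln_ge_2 U ltac:(lra)) as [LU LU'].
  (* Centres at Re = 1 + de: the same de serves at all heights of the box because it is defined by U
     and not by the height of the point. *)
  set (de := C1 / ln (ln U)).
  assert (Hde : 0 < de <= 1 / 2).
  { unfold de. split; [apply Rdiv_lt_0_compat; lra|].
    apply Rmult_le_reg_r with (ln (ln U)); [lra|]. replace (C1 / ln (ln U) * ln (ln U)) with C1 by (field; lra). lra. }
  pose proof euler_gamma_bounds as Hg.
  (* m times the logarithm of e^(gamma de) / de, the sharper zeta bound, which is where
     [euler_gamma] enters [K_fun]. *)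
  set (Fb := INR m * (ln (/ de) + euler_gamma * de)).
  assert (Hlnde : 0 <= ln (/ de)).
  { rewrite <- ln_1. apply ln_le; [lra|]. rewrite <- Rinv_1. apply Rinv_le_contravar; lra. }
  assert (HFb0 : 0 <= Fb) by (unfold Fb; apply Rmult_le_pos; [lra|]; apply Rplus_le_le_0_compat; [lra|apply Rmult_le_pos; lra]).
  assert (HfF : forall z, D z -> 1 + de <= Re z -> Cmod (f z) <= Fb).
  { intros z Hz Hre. eapply Rle_trans; [apply (Hfb z (exp (euler_gamma * de) / de) Hz ltac:(lra))|].
    - intros n. eapply Rle_trans; [|apply (zsum_le_exp de n Hde)].
      unfold zsum. clear -Hre. induction n as [|n IH]; cbn [rsum]; [lra|].
      apply Rplus_le_compat; [exact IH|]. apply exp_le_compat.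
      assert (0 <= ln (INR (S n))) by (rewrite <- ln_1; apply ln_le; [lra|apply (le_INR 1); lia]). nra.
    - right. unfold Fb, Rdiv. rewrite ln_mult, ln_exp by (try apply exp_pos; apply Rinv_0_lt_compat; lra). ring. }
  (* The growth hypothesis at the top of the box; it bounds Re f because Re f = log |L|. *)
  set (A := / 4 * d * ln U + ell * ln (ln U) + log_plus C0).
  pose proof (log_plus_nonneg C0) as HlpC.
  assert (HA : 0 < A) by (unfold A; assert (0 < / 4 * d * ln U) by (apply Rmult_lt_0_compat; lra);
    assert (0 <= ell * ln (ln U)) by (apply Rmult_le_pos; lra); lra).
  assert (HfA : forall z, 1 / 2 < Re z -> Rabs (Im z - Im s) <= H -> Re (f z) <= A).
  { intros z Hz1 Hz2. assert (Hz : D z) by (split; lra).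
    assert (Him : t - H <= Rabs (Im z) <= t + H).
    { pose proof (Rabs_triang (Im z - Im s) (Im s)) as X1.
      replace (Im z - Im s + Im s) with (Im z) in X1 by ring.
      pose proof (Rabs_triang (Im s - Im z) (Im z)) as X2.
      replace (Im s - Im z + Im z) with (Im s) in X2 by ring.
      rewrite Rabs_minus_sym in X2. fold t in X1, X2. lra. }
    assert (HcI : T2 <= c * Rabs (Im z) <= U) 
      by (unfold U; split; [apply Rle_trans with (1 * Rabs (Im z)); [lra|apply Rmult_le_compat_r; lra]
        |apply Rmult_le_compat_l; lra]).
    destruct (HfL z Hz) as [E _].
    assert (E1 : Re (f z) = ln (Cmod (L z))) by (rewrite <- E, Cmod_cexp, ln_exp; reflexivity).
    rewrite E1. eapply Rle_trans; [apply hgrowth; [lra|lra|apply HDne; exact Hz]|].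
    unfold A. destruct (lnln_ge_2 (c * Rabs (Im z)) ltac:(lra)) as [B1 B2].
    assert (G1 : ln (c * Rabs (Im z)) <= ln U) by (apply ln_le; lra).
    assert (G2 : ln (ln (c * Rabs (Im z))) <= ln (ln U)) by (apply ln_le; lra).
    assert (/ 4 * d * ln (c * Rabs (Im z)) <= / 4 * d * ln U) by (apply Rmult_le_compat_l; lra).
    assert (ell * ln (ln (c * Rabs (Im z))) <= ell * ln (ln U)) by (apply Rmult_le_compat_l; lra).
    lra. }
  (* (1 + 2 de) / dl is 2 R / (R - r) for R = 1/2 + de and r = R - dl. *)
  set (B := (1 + 2 * de) / dl * (A + Fb)).
  assert (Hcoef : 1 <= (1 + 2 * de) / dl).
  { apply Rmult_le_reg_r with dl; [lra|]. replace ((1 + 2 * de) / dl * dl) with (1 + 2 * de) by (field; lra). lra. }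
  (* Borel-Caratheodory on the disc centred on Re = 1 + de and touching Re = 1/2; for
     Re w >= 1 + de the Euler product bound Fb is already smaller. *)
  assert (HfB : forall w, 1 / 2 + dl <= Re w -> Rabs (Im w - Im s) <= C3 * lam + 1 / 2 -> Cmod (f w) <= B).
  { intros w Hw1 Hw2. destruct (Rle_dec (1 + de) (Re w)) as [Hc1|Hc1].
    - apply Rle_trans with Fb; [apply HfF; [split; unfold H in *; lra|exact Hc1]|]. unfold B.
      apply Rle_trans with (A + Fb); [lra|apply le_mult_l; lra].
    - set (p := (1 + de, Im w) : C).
      assert (Hin : forall z, Cmod (z - p) < 1 / 2 + de -> 1 / 2 < Re z /\ Rabs (Im z - Im s) <= H).
      { intros z Hz. destruct (Re_Im_le_Cmod z p) as [X1 X2]. unfold p in X1, X2; simpl in X1, X2. fold p in X1, X2.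
        assert (X3 : Rabs (Re z - (1 + de)) < 1 / 2 + de) by lra. apply Rabs_lt_between in X3.
        split; [lra|]. replace (Im z - Im s) with ((Im z - Im w) + (Im w - Im s)) by ring.
        pose proof (Rabs_triang (Im z - Im w) (Im w - Im s)). unfold H. lra. }
      assert (Hpc : Cmod (p - p) < 1 / 2 + de).
      { replace (p - p)%C with (RtoC 0) by ring. rewrite Cmod_0. lra. }
      assert (HpF : Cmod (f p) <= Fb).
      { destruct (Hin p Hpc). apply HfF; [split; lra|unfold p; simpl; lra]. }
      pose proof (borel_caratheodory f p (1 / 2 + de) (1 / 2 + de - dl) A ltac:(lra) HA) as HBC.
      specialize (HBC (twice_diff_sub D _ f ltac:(intros z Hz; destruct (Hin z Hz); split; lra) Hf2)).
      specialize (HBC ltac:(intros z Hz; destruct (Hin z Hz); apply HfA; assumption) w).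
      eapply Rle_trans; [apply HBC|].
      + eapply Rle_trans; [apply Cmod_le_Re_Im|].
        change (Re (w - p)) with (Re w - (1 + de)). change (Im (w - p)) with (Im w - Im w).
        rewrite Rminus_diag, Rabs_R0, Rabs_left1 by lra. lra.
      + unfold B. replace (2 * (1 / 2 + de) / (1 / 2 + de - (1 / 2 + de - dl))) with ((1 + 2 * de) / dl) by (field; lra).
        apply Rmult_le_compat_l; lra. }
  (* [b2] is (1/m) K2 Q1 Q3: [Q1] converts log U into log(c|t|), and [Q3] is at least 1. *)
  set (Q1 := 1 + ln (1 + (C3 * ln (ln v) + 3 / 2) / v) / ln v).
  set (Q3 := 1 + ln (1 + 1 / ln v * ln (1 + (2 * C3 * ln (ln v) + 1) / v)) / ln (ln v)).
  set (K2 := K_fun d m ell C0 C1 T2).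
  assert (Eb2 : b2 = 1 / INR m * K2 * Q1 * Q3) by reflexivity.
  fold lam' in Q1, Q3.
  assert (HC3l' : 2 <= C3 * lam') by (apply Rle_trans with lam'; [lra|apply le_mult_l; lra]).
  assert (HQ1 : 1 <= Q1).
  { unfold Q1. assert (0 <= ln (1 + (C3 * lam' + 3 / 2) / v) / ln v); [|lra].
    apply Rdiv_le_0_compat; [|lra]. rewrite <- ln_1. apply ln_le; [lra|].
    assert (0 <= (C3 * lam' + 3 / 2) / v) by (apply Rdiv_le_0_compat; lra). lra. }
  assert (HQ3 : 1 <= Q3).
  { unfold Q3. assert (0 <= ln (1 + 1 / ln v * ln (1 + (2 * C3 * lam' + 1) / v)) / lam'); [|lra].
    apply Rdiv_le_0_compat; [|lra]. rewrite <- ln_1. apply ln_le; [lra|].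
    assert (0 <= ln (1 + (2 * C3 * lam' + 1) / v)).
    { rewrite <- ln_1. apply ln_le; [lra|].
      assert (0 <= (2 * C3 * lam' + 1) / v) by (apply Rdiv_le_0_compat; lra). lra. }
    assert (0 <= 1 / ln v) by (apply Rdiv_le_0_compat; lra).
    match goal with |- 1 <= 1 + ?a * ?b => assert (0 <= a * b) by (apply Rmult_le_pos; assumption) end. lra. }
  destruct (K_fun_bounds d ell C0 C1 T2 U m hd0 hell hC1 HU) as [HKd HKU]. fold K2 in HKU.
  assert (HlnU : ln U <= ln tau * Q1).
  { unfold U, H, Q1, lam', lam, tau.
    replace (t + (C3 * ln (ln (c * t)) + 3 / 2)) with (t + C3 * ln (ln (c * t)) + 3 / 2) by ring.
    apply log_height_ratio; lra. }
  (* [K_fun] is by design the Borel-Caratheodory bound, without its factor 1 / dl, divided by log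
     U. *)
  assert (EK : (1 + 2 * de) * (A + Fb) = K_fun d m ell C0 C1 U * ln U).
  { unfold Fb, A, K_fun. 
    assert (Ede : ln (/ de) = ln (ln (ln U)) + ln (1 / C1)).
    { replace (/ de) with (ln (ln U) * (1 / C1)) by (unfold de; field; lra).
      apply ln_mult; [lra|]. apply Rdiv_lt_0_compat; lra. }
    rewrite Ede. unfold de. field. lra. }
  set (X := b2 * ln tau).
  assert (HX1 : (1 + 2 * de) * (A + Fb) <= INR m * X).
  { rewrite EK. replace (INR m * X) with (K2 * (ln tau * Q1) * Q3) by (unfold X; rewrite Eb2; field; lra).
    apply Rle_trans with (K2 * (ln tau * Q1)).
    - apply Rmult_le_compat; lra.
    - assert (0 <= K2 * (ln tau * Q1)) by (apply Rmult_le_pos; [lra|apply Rmult_le_pos; lra]).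
      rewrite (Rmult_comm _ Q3). apply le_mult_l; lra. }
  (* b2 >= d / (4 m) because K >= d / 4, and log(c|t|) >= 4 m / d by the second term of the maximum
     bounding T1. Hence log X >= 0 and exponents may be enlarged freely. *)
  assert (HX : 1 <= X).
  { assert (h1 : 4 * INR m / d <= ln tau).
    { rewrite <- (ln_exp (4 * INR m / d)). apply ln_le; [apply exp_pos|lra]. }
    assert (h2 : / 4 * d / INR m <= b2).
    { rewrite Eb2. replace (1 / INR m * K2 * Q1 * Q3) with ((K2 / INR m) * (Q1 * Q3)) by (field; lra).
      assert (/ 4 * d / INR m <= K2 / INR m) by (apply Rmult_le_compat_r; [left; apply Rinv_0_lt_compat; lra|lra]).
      assert (0 < / 4 * d / INR m) by (apply Rdiv_lt_0_compat; lra).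
      assert (1 <= Q1 * Q3) by (apply Rle_trans with Q3; [lra|apply le_mult_l; lra]).
      apply Rle_trans with (K2 / INR m); [lra|]. rewrite (Rmult_comm (K2 / INR m)). apply le_mult_l; lra. }
    assert (h3 : 0 < / 4 * d / INR m) by (apply Rdiv_lt_0_compat; lra).
    replace 1 with ((/ 4 * d / INR m) * (4 * INR m / d)) by (field; lra).
    unfold X. apply Rmult_le_compat; try lra. apply Rdiv_le_0_compat; lra. }
  assert (Hb2 : 0 < b2) 
    by (apply Rmult_lt_reg_r with (ln tau); [lra|]; rewrite Rmult_0_l; unfold X in HX; lra).
  set (Mx := INR m * lam / C2).
  assert (HMx : 0 < Mx) by (unfold Mx; apply Rdiv_lt_0_compat; [apply Rmult_lt_0_compat|]; lra).
  assert (HBM : B <= Mx * X).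
  { unfold B, Mx. replace ((1 + 2 * de) / dl * (A + Fb)) with (((1 + 2 * de) * (A + Fb)) * (lam / C2)) by (unfold dl; field; lra).
    replace (INR m * lam / C2 * X) with (INR m * X * (lam / C2)) by (field; lra).
    apply Rmult_le_compat_r; [apply Rdiv_le_0_compat; lra|exact HX1]. }
  set (lX := ln X).
  assert (HlX : 0 <= lX) by (unfold lX; rewrite <- ln_1; apply ln_le; lra).
  assert (HR2 : 0 <= R2).
  { unfold R2, R_fun. fold lam'. apply Rmult_le_pos.
    - assert (0 < 1 / (2 * C3)) by (apply Rdiv_lt_0_compat; lra). lra.
    - left. apply Rinv_0_lt_compat.
      assert (1 / (4 * C3 * lam') <= 1 / 8) by (apply Rdiv_le_compat; lra). lra. }
  (* The exponent at a point z of Cauchy's disc, uniformly: 2 (1 - Re z) differs from its value at s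
     by at most 2 C4 / lam, and R2 / lam is the loss in the three circles. The term 2 C4 / lam also
     keeps it nonnegative when Re s > 1. *)
  set (ex := 2 * (1 - Re s) + (2 * C4 + R2) / lam).
  assert (Hex0 : 0 <= ex).
  { unfold ex. replace ((2 * C4 + R2) / lam) with (2 * rho + R2 / lam) by (unfold rho; field; lra).
    assert (0 <= R2 / lam) by (apply Rdiv_le_0_compat; lra). fold rho in hsigma. lra. }
  assert (Hfdisc : forall z, Cmod (z - s) < rho -> D z /\ Cmod (f z) <= Mx * exp (ex * lX)).
  { intros z Hz. destruct (Re_Im_le_Cmod z s) as [X1 X2].
    assert (X3 : Rabs (Re z - Re s) < rho) by lra. apply Rabs_lt_between in X3.
    (* The left end of the range of sigma leaves room for the disc radius rho to the right of 1/2 +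
       dl. *)
    assert (Hsz : 1 / 2 + dl <= Re z <= 1 + 2 * rho).
    { replace ((1.00006 * C2 + C4) / lam) with (1.00006 * dl + rho) in hsigma by (unfold dl, rho; field; lra).
      fold rho in hsigma. lra. }
    assert (HzD : D z) by (split; unfold H in *; lra).
    split; [exact HzD|].
    destruct (Rle_dec (1 + dl) (Re z)) as [Hc1|Hc1].
    { apply Rle_trans with Mx; [apply HfM; assumption|].
      rewrite <- (Rmult_1_r Mx) at 1. apply Rmult_le_compat_l; [lra|].
      rewrite <- exp_0. apply exp_le_compat. apply Rmult_le_pos; assumption. }
    (* The centre lies on the horizontal through z, far to the right: the inner circle touches Re =
       1 + dl, where |f| <= Mx begins, and the outer one touches Re = 1/2 + dl, where |f| <= B
       begins. *)
    set (r1 := C3 * lam - 1 / 2). set (s0 := 1 + dl + r1). set (p := (s0, Im z) : C).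
    assert (Hr1 : 3 / 2 <= r1) by (unfold r1; lra).
    assert (Hring : forall w, Cmod (w - p) <= r1 + 1 / 2 -> 1 / 2 + dl <= Re w /\ Rabs (Im w - Im s) <= C3 * lam + 1 / 2).
    { intros w Hw. destruct (Re_Im_le_Cmod w p) as [Y1 Y2]. unfold p in Y1, Y2; simpl in Y1, Y2. fold p in Y1, Y2.
      assert (Y3 : Rabs (Re w - s0) <= r1 + 1 / 2) by lra. apply Rabs_le_between in Y3.
      split; [unfold s0 in *; lra|].
      replace (Im w - Im s) with ((Im w - Im z) + (Im z - Im s)) by ring.
      pose proof (Rabs_triang (Im w - Im z) (Im z - Im s)). unfold r1 in *. lra. }
    assert (Hzp : Cmod (z - p) = r1 + (1 + dl - Re z)).
    { replace (z - p)%C with (RtoC (Re z - s0)) by (apply C_ext; unfold p, Re, Im; simpl; ring).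
      rewrite Cmod_R, Rabs_left1 by (unfold s0; lra). unfold s0. ring. }
    pose proof (three_circles f D p r1 (r1 + 1 / 2) Mx X ltac:(lra) HMx ltac:(lra) Hf2) as H3.
    specialize (H3 ltac:(intros w Hw; destruct (Hring w ltac:(lra)); split; unfold H in *; lra)).
    assert (H3a : forall w, Cmod (w - p) = r1 -> Cmod (f w) <= Mx).
    { intros w Hw. destruct (Hring w ltac:(lra)) as [Z1 Z2]. apply HfM; [split; unfold H in *; lra|].
      destruct (Re_Im_le_Cmod w p) as [Y1 _]. rewrite Hw in Y1. unfold p in Y1; simpl in Y1.
      apply Rabs_le_between in Y1. unfold s0 in Y1. lra. }
    assert (H3b : forall w, Cmod (w - p) = r1 + 1 / 2 -> Cmod (f w) <= Mx * X).
    { intros w Hw. destruct (Hring w ltac:(lra)) as [Z1 Z2].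
      eapply Rle_trans; [apply HfB; assumption|exact HBM]. }
    specialize (H3 H3a H3b z ltac:(rewrite Hzp; lra)). rewrite Hzp in H3.
    eapply Rle_trans; [exact H3|]. apply Rmult_le_compat_l; [lra|]. apply exp_le_compat.
    apply Rmult_le_compat_r; [exact HlX|].
    pose proof (three_circles_exponent C2 C3 lam lam' (Re z) r1 ltac:(lra) hC3 ltac:(lra) eq_refl ltac:(fold dl; lra)) as HX3.
    fold dl in HX3. eapply Rle_trans; [exact HX3|].
    change ((2 * C2 + 1 / (2 * C3)) * / (1 - 1 / (4 * C3 * lam'))) with R2.
    unfold ex. replace ((2 * C4 + R2) / lam) with (2 * rho + R2 / lam) by (unfold rho; field; lra). lra. }
  assert (HsD : D s).
  { apply (Hfdisc s). replace (s - s)%C with (RtoC 0) by ring. rewrite Cmod_0. lra. }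
  assert (Hder : C_derive L s = L1 s).
  { apply is_C_derive_unique, Cderiv_is_derive. apply HL12, HD1, HsD. }
  rewrite Hder.
  pose proof (cauchy_estimate f s (L1 s / L s) rho (Mx * exp (ex * lX)) ltac:(lra)) as HCE.
  specialize (HCE ltac:(apply Rmult_lt_0_compat; [lra|apply exp_pos])).
  specialize (HCE (twice_diff_sub D _ f (fun z Hz => proj1 (Hfdisc z Hz)) Hf2) (fun z Hz => proj2 (Hfdisc z Hz)) (proj2 (HfL s HsD))).
  eapply Rle_trans; [exact HCE|].
  set (lp := log_plus b2) in *.
  assert (Hlp : 0 <= lp) by apply log_plus_nonneg.
  (* log X = log b2 + lam, since lam is the logarithm of log(c|t|): an exponent of order 1 / lam
     costs only a bounded factor. *)
  assert (HlXlam : lX / lam <= 1 + lp / lam).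
  { assert (lX <= lp + lam).
    { unfold lX, X. rewrite ln_mult by lra. fold lam. assert (ln b2 <= lp) by apply Rmax_r. lra. }
    replace (1 + lp / lam) with ((lp + lam) / lam) by (field; lra).
    apply Rmult_le_compat_r; [left; apply Rinv_0_lt_compat; lra|assumption]. }
  assert (HlpT : lp / lam <= lp / ln (ln T1)) by (apply Rdiv_le_compat; lra).
  assert (Hlpv : lp / lam <= lp / lam') by (apply Rdiv_le_compat; lra).
  set (E := 2 * C4 * (1 + lp / ln (ln T1)) + (1 + lp / lam') * R2) in *.
  assert (HexE : ex * lX <= E + 2 * (1 - Re s) * lX).
  { unfold ex. replace ((2 * (1 - Re s) + (2 * C4 + R2) / lam) * lX)
      with (2 * (1 - Re s) * lX + (2 * C4 + R2) * (lX / lam)) by (field; lra).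
    assert (h1 : 2 * C4 * (lX / lam) <= 2 * C4 * (1 + lp / ln (ln T1))) by (apply Rmult_le_compat_l; lra).
    assert (h2 : R2 * (lX / lam) <= R2 * (1 + lp / lam')) by (apply Rmult_le_compat_l; lra).
    unfold E. lra. }
  apply exp_le_compat in HexE. rewrite exp_plus in HexE.
  unfold a2, Rpower. fold X lX.
  set (P := exp E * exp (2 * (1 - Re s) * lX)) in *.
  assert (HP : 0 < P) by (unfold P; apply Rmult_lt_0_compat; apply exp_pos).
  (* The two factors lam come from the bound m lam / C2 on f and from the radius C4 / lam in
     Cauchy's estimate. *)
  replace (Mx * exp (ex * lX) / rho) with ((INR m / (C2 * C4) * lam ^ 2) * exp (ex * lX)) by (unfold Mx, rho; field; lra).
  set (Y := INR m / (C2 * C4) * lam ^ 2).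
  assert (HY : 0 < Y).
  { unfold Y. apply Rmult_lt_0_compat; [apply Rdiv_lt_0_compat; [lra|apply Rmult_lt_0_compat; lra]|]. apply pow_lt. lra. }
  replace (1.0002 * INR m / (C2 * C4) * exp E * exp (2 * (1 - Re s) * lX) * lam ^ 2) with (1.0002 * (Y * P))
    by (unfold Y, P; field; lra).
  assert (Y * exp (ex * lX) <= Y * P) by (apply Rmult_le_compat_l; lra).
  assert (0 < Y * P) by (apply Rmult_lt_0_compat; assumption). lra.
Qed.
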